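(* Let $k$ be an algebraically closed field, $d\geqslant 1$ an integer, and let $\mathcal{T}$ be a $k$-linear $\operatorname{Hom}$-finite $(d+2)$-angulated category with split idempotents, with $d$-suspension functor $\Sigma^d$ and with a Serre functor $S$. Let $T\in\mathcal{T}$ be an object which is cluster tilting in the sense of Oppermann–Thomas, let $\Gamma=\operatorname{End}_{\mathcal{T}}T$, and let $\mathcal{D}$ be the essential image of the functor $\mathcal{T}(T,-):\mathcal{T}\to\operatorname{mod}\Gamma$. Then: (i) $\mathcal{D}$ is a $d$-cluster tilting subcategory of $\operatorname{mod}\Gamma$. (ii) The functor $\mathcal{T}(T,-)$ induces an equivalence of categories $\mathcal{T}/[\operatorname{add}\Sigma^dT]\xrightarrow{\sim}\mathcal{D}$. (iii) $\Gamma$ is a $d$-Gorenstein algebra, that is, each injective module has projective dimension $\leqslant d$, and each projective module has injective dimension $\leqslant d$. (iv) If the global dimension of $\Gamma$ is finite, then it is at most $d$.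
   Context: **$(d+2)$-angulated categories** (Geiss–Keller–Oppermann). Let $\mathcal{T}$ be an additive category with an automorphism $\Sigma^d$ (the $d$-suspension; the symbol is a single functor), and put $n=d+2$. An $n$-$\Sigma^d$-sequence is a sequence of morphisms $X_1\xrightarrow{\alpha_1}X_2\xrightarrow{\alpha_2}\cdots\xrightarrow{\alpha_{n-1}}X_n\xrightarrow{\alpha_n}\Sigma^dX_1$. Its left rotation is $X_2\xrightarrow{\alpha_2}\cdots\xrightarrow{\alpha_n}\Sigma^dX_1\xrightarrow{(-1)^n\Sigma^d\alpha_1}\Sigma^dX_2$. A morphism to another such sequence $(Y_i,\beta_i)$ is a tuple $\varphi_i:X_i\to Y_i$, $1\leqslant i\leqslant n$, commuting with the structure maps (using $\Sigma^d\varphi_1$ at the last place). $\mathcal{T}$ is $(d+2)$-angulated if it is equipped with a class of $n$-$\Sigma^d$-sequences, called $(d+2)$-angles, closed under isomorphism, such that: (F1) (a) the class is closed under direct sums and direct summands; (b) for each $X$ the trivial sequence $X\xrightarrow{1_X}X\to 0\to\cdots\to 0\to\Sigma^dX$ is a $(d+2)$-angle; (c) each morphism $\alpha_1:X_1\to X_2$ is the first morphism of a $(d+2)$-angle. (F2) A sequence is a $(d+2)$-angle if and only if its left rotation is. (F3) Given two $(d+2)$-angles $(X_i,\alpha_i)$, $(Y_i,\beta_i)$ and $\varphi_1,\varphi_2$ with $\varphi_2\alpha_1=\beta_1\varphi_1$, there are $\varphi_3,\ldots,\varphi_n$ completing them to a morphism of sequences. (F4) In (F3) the $\varphi_3,\ldots,\varphi_n$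 can be chosen so that the cone $X_2\oplus Y_1\to X_3\oplus Y_2\to\cdots\to\Sigma^dX_1\oplus Y_n\to\Sigma^dX_2\oplus\Sigma^dY_1$, with maps $\begin{pmatrix}-\alpha_i&0\\ \varphi_i&\beta_{i-1}\end{pmatrix}$ for $2\leqslant i\leqslant n$ and last map $\begin{pmatrix}-\Sigma^d\alpha_1&0\\ \Sigma^d\varphi_1&\beta_n\end{pmatrix}$, is a $(d+2)$-angle. **Conventions.** $\mathcal{T}(X,Y)$ denotes the morphism space. A Serre functor is an autoequivalence $S$ of $\mathcal{T}$ with natural isomorphisms $D\mathcal{T}(X,Y)\cong\mathcal{T}(Y,SX)$, where $D=\operatorname{Hom}_k(-,k)$. $\operatorname{mod}\Gamma$ is the category of finite dimensional right $\Gamma$-modules; $\mathcal{T}(T,X)$ is a right $\Gamma$-module by precomposition. The essential image $\mathcal{D}$ is the full subcategory of modules isomorphic to some $\mathcal{T}(T,X)$, $X\in\mathcal{T}$. $\operatorname{add}T$ is the full subcategory of direct summands of finite direct sums of copies of $T$. $[\operatorname{add}\Sigma^dT]$ is the ideal of morphisms of $\mathcal{T}$ factoring through an object of $\operatorname{add}\Sigma^dT$, and $\mathcal{T}/[\operatorname{add}\Sigma^dT]$ is the quotient category. **Cluster tilting in the sense of Oppermann–Thomas.** $T$ is cluster tilting in this sense if: (i) $\mathcal{T}(T,\Sigma^dT)=0$; and (ii) each $X\in\mathcal{T}$ occurs in a $(d+2)$-angle $T_d\to T_{d-1}\to\cdots\to T_1\to T_0\to X\to\Sigma^dT_d$ with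 $T_i\in\operatorname{add}T$ for $0\leqslant i\leqslant d$. **$d$-cluster tilting subcategory.** A full subcategory $\mathcal{X}\subseteq\operatorname{mod}\Gamma$ is $d$-cluster tilting if it is functorially finite in $\operatorname{mod}\Gamma$ and $\mathcal{X}=\{X\in\operatorname{mod}\Gamma\mid\operatorname{Ext}^i_\Gamma(X,\mathcal{X})=0\text{ for }1\leqslant i\leqslant d-1\}=\{X\in\operatorname{mod}\Gamma\mid\operatorname{Ext}^i_\Gamma(\mathcal{X},X)=0\text{ for }1\leqslant i\leqslant d-1\}$. *)

(* Defs.v *)
From HB Require Import structures.
From mathcomp Require Import all_boot all_order all_algebra.
From mathcomp Require Import boolp.
Set Implicit Arguments.
Unset Strict Implicit.
Unset Printing Implicit Defensive.
Import GRing.Theory.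
Local Open Scope ring_scope.
Local Open Scope quotient_scope.

Record category := Category {
  ob :> Type;
  hom : ob -> ob -> Type;
  idm : forall X, hom X X;
  comp : forall X Y Z, hom Y Z -> hom X Y -> hom X Z;
  comp1m : forall X Y (f : hom X Y), comp (idm Y) f = f;
  compm1 : forall X Y (f : hom X Y), comp f (idm X) = f;
  compmA : forall X Y Z W (h : hom Z W) (g : hom Y Z) (f : hom X Y),
    comp h (comp g f) = comp (comp h g) f }.

Definition is_iso (C : category) (X Y : C) (f : hom X Y) : Prop :=
  exists g : hom Y X, comp g f = idm X /\ comp f g = idm Y.

Definition isomorphic (C : category) (X Y : C) : Prop :=
  exists f : hom X Y, is_iso f.

Record functor (A B : category) := Functor {
  fobj :> A -> B;
  fmap : forall X Y, hom X Y -> hom (fobj X) (fobj Y);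
  fmap1 : forall X, fmap (idm X) = idm (fobj X);
  fmapM : forall X Y Z (g : hom Y Z) (f : hom X Y),
    fmap (comp g f) = comp (fmap g) (fmap f) }.

Definition functor_id (A : category) : functor A A :=
  @Functor A A id (fun _ _ => id) (fun _ => erefl) (fun _ _ _ _ _ => erefl).

Section FunctorComp.
Variables (A B D : category) (G : functor B D) (F : functor A B).

Fact functor_comp1 X : fmap G (fmap F (idm X)) = idm (G (F X)).
Proof. by rewrite !fmap1. Qed.

Fact functor_compM X Y Z (g : hom Y Z) (f : hom X Y) :
  fmap G (fmap F (comp g f)) = comp (fmap G (fmap F g)) (fmap G (fmap F f)).
Proof. by rewrite !fmapM. Qed.

Definition functor_comp : functor A D :=
  @Functor A D (fun X => G (F X)) (fun X Y f => fmap G (fmap F f))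
    functor_comp1 functor_compM.
End FunctorComp.

Definition naturally_isomorphic (A B : category) (F G : functor A B) : Prop :=
  exists eta : forall X, hom (F X) (G X),
    (forall X, is_iso (eta X)) /\
    (forall X Y (f : hom X Y), comp (fmap G f) (eta X) = comp (eta Y) (fmap F f)).

Definition is_equivalence (A B : category) (F : functor A B) : Prop :=
  exists G : functor B A,
    naturally_isomorphic (functor_comp G F) (functor_id A) /\
    naturally_isomorphic (functor_comp F G) (functor_id B).

(* Strict invertibility: these are Leibniz equalities of functors. *)
Definition is_automorphism (A : category) (F : functor A A) : Prop :=
  exists G : functor A A,
    functor_comp G F = functor_id A /\ functor_comp F G = functor_id A.

Definition ess_image (A B : category) (F : functor A B) (Y : B) : Prop :=
  exists X : A, isomorphic (F X) Y.

Definition full_sub (C : category) (P : C -> Prop) : category :=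
  @Category {X : C | P X} (fun X Y => hom (sval X) (sval Y))
    (fun X => idm (sval X)) (fun X Y Z => @comp C (sval X) (sval Y) (sval Z))
    (fun X Y => @comp1m C (sval X) (sval Y))
    (fun X Y => @compm1 C (sval X) (sval Y))
    (fun X Y Z W => @compmA C (sval X) (sval Y) (sval Z) (sval W)).

Lemma ess_image_obj (A B : category) (F : functor A B) (X : A) :
  ess_image F (F X).
Proof.
by exists X; exists (idm (F X)); exists (idm (F X)); rewrite comp1m.
Qed.

Definition to_ess_image (A B : category) (F : functor A B) :
    functor A (full_sub (ess_image F)) :=
  @Functor A (full_sub (ess_image F))
    (fun X => exist _ (F X) (ess_image_obj F X))
    (fun X Y f => fmap F f) (fun X => fmap1 F X)
    (fun X Y Z g f => fmapM F g f).

Definition functorially_finite (C : category) (P : C -> Prop) : Prop :=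
  (forall M : C, exists X (f : hom X M), P X /\
     forall X' (f' : hom X' M), P X' -> exists h, f' = comp f h) /\
  (forall M : C, exists X (f : hom M X), P X /\
     forall X' (f' : hom M X'), P X' -> exists h, f' = comp h f).

(* Hom-finite k-linear categories: the morphism spaces are vectTypes, hence   *)
(* finite dimensional.                                                        *)
Record lincat (k : fieldType) := LinCat {
  lob :> Type;
  lhom : lob -> lob -> vectType k;
  lid : forall X, lhom X X;
  lcomp : forall X Y Z, lhom Y Z -> lhom X Y -> lhom X Z;
  lcomp1m : forall X Y (f : lhom X Y), lcomp (lid Y) f = f;
  lcompm1 : forall X Y (f : lhom X Y), lcomp f (lid X) = f;
  lcompA : forall X Y Z W (h : lhom Z W) (g : lhom Y Z) (f : lhom X Y),
    lcomp h (lcomp g f) = lcomp (lcomp h g) f;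
  lcomp_linearl : forall X Y Z (f : lhom X Y),
    linear (fun g : lhom Y Z => lcomp g f);
  lcomp_linearr : forall X Y Z (g : lhom Y Z),
    linear (fun f : lhom X Y => lcomp g f) }.

Notation "X ~> Y" := (lhom X Y) (at level 51, no associativity) : type_scope.
Notation "g ∘ f" := (lcomp g f) (at level 40, left associativity).

Definition ucat (k : fieldType) (C : lincat k) : category :=
  @Category C (fun X Y => X ~> Y) (@lid k C) (@lcomp k C)
    (@lcomp1m k C) (@lcompm1 k C) (@lcompA k C).

Definition linear_functor (k : fieldType) (C : lincat k)
    (F : functor (ucat C) (ucat C)) : Prop :=
  forall X Y : C, linear (fun f : X ~> Y => (fmap F f : F X ~> F Y)).

Definition split_idempotents (k : fieldType) (C : lincat k) : Prop :=
  forall (X : C) (e : X ~> X), e ∘ e = e ->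
    exists (Y : C) (r : X ~> Y) (s : Y ~> X), s ∘ r = e /\ r ∘ s = lid Y.

Section LinCatTheory.
Variables (k : fieldType) (C : lincat k).
Implicit Types X Y Z : C.

Lemma lcompDl X Y Z (g g' : Y ~> Z) (f : X ~> Y) :
  (g + g') ∘ f = g ∘ f + g' ∘ f.
Proof. by have := lcomp_linearl f 1 g g'; rewrite !scale1r. Qed.

Lemma lcompDr X Y Z (g : Y ~> Z) (f f' : X ~> Y) :
  g ∘ (f + f') = g ∘ f + g ∘ f'.
Proof. by have := lcomp_linearr g 1 f f'; rewrite !scale1r. Qed.

Lemma lcomp0m X Y Z (f : X ~> Y) : (0 : Y ~> Z) ∘ f = 0.
Proof. by apply: (addrI ((0 : Y ~> Z) ∘ f)); rewrite -lcompDl !addr0. Qed.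

Lemma lcompm0 X Y Z (g : Y ~> Z) : g ∘ (0 : X ~> Y) = 0.
Proof. by apply: (addrI (g ∘ (0 : X ~> Y))); rewrite -lcompDr !addr0. Qed.

Lemma lcompNl X Y Z (g : Y ~> Z) (f : X ~> Y) : (- g) ∘ f = - (g ∘ f).
Proof. by apply/eqP; rewrite -addr_eq0 -lcompDl addNr lcomp0m. Qed.

Lemma lcompNr X Y Z (g : Y ~> Z) (f : X ~> Y) : g ∘ (- f) = - (g ∘ f).
Proof. by apply/eqP; rewrite -addr_eq0 -lcompDr addNr lcompm0. Qed.

Lemma lcompBl X Y Z (g g' : Y ~> Z) (f : X ~> Y) :
  (g - g') ∘ f = g ∘ f - g' ∘ f.
Proof. by rewrite lcompDl lcompNl. Qed.

Lemma lcompBr X Y Z (g : Y ~> Z) (f f' : X ~> Y) :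
  g ∘ (f - f') = g ∘ f - g ∘ f'.
Proof. by rewrite lcompDr lcompNr. Qed.
End LinCatTheory.

(* D T(X, Y) = 'Hom(X ~> Y, k^o); the two naturality conditions are those of  *)
(* the bifunctors D T(X, Y) and T(Y, S X) in Y and in X.                      *)
Definition serre_functor (k : fieldType) (C : lincat k)
    (S : functor (ucat C) (ucat C)) : Prop :=
  is_equivalence S /\
  exists eta : forall X Y : C, 'Hom(X ~> Y, k^o) -> (Y ~> S X),
    [/\ forall X Y, linear (@eta X Y),
        forall X Y, bijective (@eta X Y),
        forall (X Y Y' : C) (g : Y ~> Y') (xi : 'Hom(X ~> Y', k^o))
               (xi' : 'Hom(X ~> Y, k^o)),
          (forall u, xi' u = xi (g ∘ u)) -> eta X Y xi' = eta X Y' xi ∘ g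
      & forall (X X' Y : C) (f : X ~> X') (xi : 'Hom(X ~> Y, k^o))
               (xi' : 'Hom(X' ~> Y, k^o)),
          (forall u, xi' u = xi (u ∘ f)) ->
          eta X' Y xi' = (fmap S (f : hom (c := ucat C) X X') : S X ~> S X') ∘ eta X Y xi].

Record addcat (k : fieldType) := AddCat {
  addbase :> lincat k;
  zob : addbase;
  zobP : lid zob = 0;
  bip : addbase -> addbase -> addbase;
  in1 : forall X Y, X ~> bip X Y;
  in2 : forall X Y, Y ~> bip X Y;
  pr1 : forall X Y, bip X Y ~> X;
  pr2 : forall X Y, bip X Y ~> Y;
  pr1_in1 : forall X Y, pr1 X Y ∘ in1 X Y = lid X;
  pr2_in2 : forall X Y, pr2 X Y ∘ in2 X Y = lid Y;
  pr1_in2 : forall X Y, pr1 X Y ∘ in2 X Y = 0;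
  pr2_in1 : forall X Y, pr2 X Y ∘ in1 X Y = 0;
  bip_id : forall X Y,
    in1 X Y ∘ pr1 X Y + in2 X Y ∘ pr2 X Y = lid (bip X Y) }.

Notation "X ⊕ Y" := (bip X Y) (at level 50, left associativity).

Section Additive.
Variables (k : fieldType) (C : addcat k).
Implicit Types X Y Z W : C.

(* The matrix (a b; c d), acting on columns. *)
Definition mat X Y X' Y' (a : X ~> X') (b : Y ~> X') (c : X ~> Y') (d : Y ~> Y') :
    X ⊕ Y ~> X' ⊕ Y' :=
  in1 X' Y' ∘ (a ∘ pr1 X Y + b ∘ pr2 X Y) +
  in2 X' Y' ∘ (c ∘ pr1 X Y + d ∘ pr2 X Y).

Inductive sum_of_copies (T : C) : C -> Prop :=
| sum_of_copies0 : sum_of_copies T (zob C)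
| sum_of_copies1 : sum_of_copies T T
| sum_of_copiesD X Y :
    sum_of_copies T X -> sum_of_copies T Y -> sum_of_copies T (X ⊕ Y).

Definition in_add (T X : C) : Prop :=
  exists Y W : C, sum_of_copies T W /\ isomorphic (C := ucat C) (X ⊕ Y) W.

Definition factors_through_add (T X Y : C) (f : X ~> Y) : Prop :=
  exists (Z : C) (g : X ~> Z) (h : Z ~> Y), in_add T Z /\ f = h ∘ g.

Lemma mat1 X Y : mat (lid X) 0 0 (lid Y) = lid (X ⊕ Y).
Proof. by rewrite /mat !lcomp0m addr0 add0r !lcomp1m bip_id. Qed.

Lemma pr1_mat X Y X' Y' (a : X ~> X') (b : Y ~> X') (c : X ~> Y') (d : Y ~> Y') :
  pr1 X' Y' ∘ mat a b c d = a ∘ pr1 X Y + b ∘ pr2 X Y.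
Proof.
by rewrite /mat lcompDr !(lcompA (pr1 X' Y')) pr1_in1 pr1_in2 lcomp1m lcomp0m addr0.
Qed.

Lemma pr2_mat X Y X' Y' (a : X ~> X') (b : Y ~> X') (c : X ~> Y') (d : Y ~> Y') :
  pr2 X' Y' ∘ mat a b c d = c ∘ pr1 X Y + d ∘ pr2 X Y.
Proof.
by rewrite /mat lcompDr !(lcompA (pr2 X' Y')) pr2_in1 pr2_in2 lcomp1m lcomp0m add0r.
Qed.

Lemma matM X Y X' Y' X'' Y''
  (a : X' ~> X'') (b : Y' ~> X'') (c : X' ~> Y'') (d : Y' ~> Y'')
  (a' : X ~> X') (b' : Y ~> X') (c' : X ~> Y') (d' : Y ~> Y') :
  mat a b c d ∘ mat a' b' c' d' =
  mat (a ∘ a' + b ∘ c') (a ∘ b' + b ∘ d') (c ∘ a' + d ∘ c') (c ∘ b' + d ∘ d').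
Proof.
rewrite {1}/mat lcompDl -!lcompA !lcompDl -!lcompA !pr1_mat !pr2_mat.
rewrite /mat !lcompDl !lcompDr !lcompA.
by congr (_ + _); apply: addrACA.
Qed.

Definition swap X1 X2 Y1 Y2 : (X1 ⊕ X2) ⊕ (Y1 ⊕ Y2) ~> (X1 ⊕ Y1) ⊕ (X2 ⊕ Y2) :=
  mat (in1 X1 Y1 ∘ pr1 X1 X2) (in2 X1 Y1 ∘ pr1 Y1 Y2)
      (in1 X2 Y2 ∘ pr2 X1 X2) (in2 X2 Y2 ∘ pr2 Y1 Y2).

Lemma swapK X1 X2 Y1 Y2 : swap X1 Y1 X2 Y2 ∘ swap X1 X2 Y1 Y2 = lid _.
Proof.
have E W1 W2 W3 W4 W5 (a : W4 ~> W5) (b : W3 ~> W4) (c : W2 ~> W3) (f : W1 ~> W2) :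
  (a ∘ b) ∘ (c ∘ f) = a ∘ (b ∘ c) ∘ f by rewrite !lcompA.
rewrite /swap matM !E !pr1_in1 !pr1_in2 !pr2_in1 !pr2_in2.
by rewrite !lcompm1 !lcompm0 !lcomp0m !addr0 !bip_id; apply: mat1.
Qed.

Lemma in_add_bip (T X Y : C) : in_add T X -> in_add T Y -> in_add T (X ⊕ Y).
Proof.
move=> [X' [V [sV [f [g [gf fg]]]]]] [Y' [W [sW [f' [g' [gf' fg']]]]]].
exists (X' ⊕ Y'), (V ⊕ W); split; first exact: sum_of_copiesD.
rewrite /= in f g gf fg f' g' gf' fg' *.
have E W1 W2 W3 W4 W5 (a : W4 ~> W5) (b : W3 ~> W4) (c : W2 ~> W3) (h : W1 ~> W2) :
  (a ∘ b) ∘ (c ∘ h) = a ∘ (b ∘ c) ∘ h by rewrite !lcompA.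
exists (mat f 0 0 f' ∘ swap X Y X' Y'), (swap X X' Y Y' ∘ mat g 0 0 g') => /=.
rewrite !E matM gf gf' swapK !lcompm0 !lcomp0m !addr0 !add0r mat1 !lcompm1 swapK.
by rewrite matM fg fg' !lcompm0 !lcomp0m !addr0 !add0r mat1.
Qed.

Lemma zob_in_add (T : C) : in_add T (zob C).
Proof.
exists (zob C), (zob C ⊕ zob C); split.
  by apply: sum_of_copiesD; apply: sum_of_copies0.
by exists (lid _), (lid _); rewrite /= lcomp1m.
Qed.

Lemma factors0 T X Y : factors_through_add T (0 : X ~> Y).
Proof. by exists (zob C), 0, 0; rewrite lcomp0m; split=> //; apply: zob_in_add. Qed.

Lemma factorsD T X Y (f f' : X ~> Y) :
  factors_through_add T f -> factors_through_add T f' ->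
  factors_through_add T (f + f').
Proof.
move=> [Z [g [h [aZ ->]]]] [Z' [g' [h' [aZ' ->]]]].
exists (Z ⊕ Z'), (in1 Z Z' ∘ g + in2 Z Z' ∘ g'), (h ∘ pr1 Z Z' + h' ∘ pr2 Z Z').
split; first exact: in_add_bip.
rewrite lcompDl !lcompDr -!lcompA ![pr1 _ _ ∘ (_ ∘ _)]lcompA ![pr2 _ _ ∘ (_ ∘ _)]lcompA.
by rewrite pr1_in1 pr1_in2 pr2_in1 pr2_in2 !lcomp1m !lcomp0m !lcompm0 addr0 add0r.
Qed.

Lemma factorsMl T X Y Z (g : Y ~> Z) (f : X ~> Y) :
  factors_through_add T f -> factors_through_add T (g ∘ f).
Proof. by move=> [W [a [b [aW ->]]]]; exists W, a, (g ∘ b); rewrite lcompA. Qed.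

Lemma factorsMr T X Y Z (g : Y ~> Z) (f : X ~> Y) :
  factors_through_add T g -> factors_through_add T (g ∘ f).
Proof. by move=> [W [a [b [aW ->]]]]; exists W, (a ∘ f), b; rewrite lcompA. Qed.
End Additive.

Record ideal (k : fieldType) (C : lincat k) := Ideal {
  imem : forall X Y : C, X ~> Y -> Prop;
  ideal0 : forall X Y, imem (0 : X ~> Y);
  idealD : forall X Y (f g : X ~> Y), imem f -> imem g -> imem (f + g);
  idealMl : forall X Y Z (g : Y ~> Z) (f : X ~> Y), imem f -> imem (g ∘ f);
  idealMr : forall X Y Z (g : Y ~> Z) (f : X ~> Y), imem g -> imem (g ∘ f) }.

Definition add_ideal (k : fieldType) (C : addcat k) (T : C) : ideal C :=
  Ideal (@factors0 k C T) (@factorsD k C T) (@factorsMl k C T) (@factorsMr k C T).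

Section Quotient.
Variables (k : fieldType) (C : lincat k) (I : ideal C).
Implicit Types X Y Z : C.

Lemma idealN X Y (f : X ~> Y) : imem I f -> imem I (- f).
Proof. by move=> If; rewrite -(lcomp1m (- f)) lcompNr -lcompNl; apply: idealMl. Qed.

Definition icong X Y : rel (X ~> Y) := fun f g => `[< imem I (f - g) >].

Fact icong_refl X Y : reflexive (@icong X Y).
Proof. by move=> f; apply/asboolP; rewrite subrr; apply: ideal0. Qed.

Fact icong_sym X Y : symmetric (@icong X Y).
Proof.
by move=> f g; apply/asboolP/asboolP => /idealN; rewrite opprB.
Qed.

Fact icong_trans X Y : transitive (@icong X Y).
Proof.
move=> g f h /asboolP fg /asboolP gh; apply/asboolP.
by have := idealD fg gh; rewrite addrA subrK.
Qed.

Definition icong_equiv X Y :=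
  EquivRel (@icong X Y) (@icong_refl X Y) (@icong_sym X Y) (@icong_trans X Y).

Definition qhom X Y : Type := {eq_quot (icong_equiv X Y)}.
Definition qclass X Y (f : X ~> Y) : qhom X Y := \pi_({eq_quot (icong_equiv X Y)}) f.
Definition qrepr X Y (f : qhom X Y) : X ~> Y :=
  repr (f : {eq_quot (icong_equiv X Y)}).

Lemma qreprK X Y (f : qhom X Y) : qclass (qrepr f) = f.
Proof. exact: reprK. Qed.

Lemma qclassP X Y (f g : X ~> Y) : qclass f = qclass g <-> imem I (f - g).
Proof.
split; first by move/eqquotP => /asboolP.
by move=> h; apply/eqquotP/asboolP.
Qed.

Lemma qreprP X Y (f : X ~> Y) : imem I (qrepr (qclass f) - f).
Proof. by apply/qclassP; rewrite qreprK. Qed.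

Definition qcomp X Y Z (g : qhom Y Z) (f : qhom X Y) : qhom X Z :=
  qclass (qrepr g ∘ qrepr f).

Lemma qclassM X Y Z (g : Y ~> Z) (f : X ~> Y) :
  qclass (g ∘ f) = qcomp (qclass g) (qclass f).
Proof.
apply/esym/qclassP; rewrite -(subrK (g ∘ qrepr (qclass f)) (_ ∘ _)) -addrA.
rewrite -lcompBl -lcompBr.
by apply: idealD; [apply: idealMr | apply: idealMl]; apply: qreprP.
Qed.

Fact qcomp1m X Y (f : qhom X Y) : qcomp (qclass (lid Y)) f = f.
Proof. by rewrite -(qreprK f) -qclassM lcomp1m. Qed.

Fact qcompm1 X Y (f : qhom X Y) : qcomp f (qclass (lid X)) = f.
Proof. by rewrite -(qreprK f) -qclassM lcompm1. Qed.

Fact qcompA X Y Z W (h : qhom Z W) (g : qhom Y Z) (f : qhom X Y) :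
  qcomp h (qcomp g f) = qcomp (qcomp h g) f.
Proof.
by rewrite -(qreprK f) -(qreprK g) -(qreprK h) -!qclassM lcompA.
Qed.

Definition quotcat : category :=
  @Category C qhom (fun X => qclass (lid X)) qcomp qcomp1m qcompm1 qcompA.

Variables (B : category) (F : functor (ucat C) B).

Definition respects_ideal : Prop :=
  forall (X Y : C) (f g : X ~> Y),
    imem I (f - g) -> fmap F (f : hom (c := ucat C) X Y) = fmap F g.

Hypothesis FI : respects_ideal.

Definition quot_map (X Y : quotcat) (f : hom X Y) : hom (F X) (F Y) :=
  fmap F (qrepr f : hom (c := ucat C) X Y).

Lemma quot_mapE (X Y : C) (f : X ~> Y) :
  quot_map (qclass f) = fmap F (f : hom (c := ucat C) X Y).
Proof. exact/FI/qreprP. Qed.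

Fact quot_map1 (X : quotcat) : quot_map (idm X) = idm (F X).
Proof. by rewrite quot_mapE (fmap1 F X). Qed.

Fact quot_mapM (X Y Z : quotcat) (g : hom Y Z) (f : hom X Y) :
  quot_map (comp g f) = comp (quot_map g) (quot_map f).
Proof. by rewrite quot_mapE (fmapM F). Qed.

Definition quot_functor : functor quotcat B := Functor quot_map1 quot_mapM.
End Quotient.

Section Chains.
Variables (k : fieldType) (C : lincat k).

(* chain n X Z is the type of composable X -> Y_1 -> ... -> Y_n -> Z, so it   *)
(* has n intermediate objects and n + 1 arrows.                               *)
Fixpoint chain (n : nat) (X Z : C) : Type :=
  if n is m.+1 then {Y : C & (X ~> Y) * chain m Y Z}%type else X ~> Z.

Definition ccons n X Y Z (f : X ~> Y) (c : chain n Y Z) : chain n.+1 X Z :=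
  existT _ Y (f, c).
Definition cob n X Z (c : chain n.+1 X Z) : C := projT1 c.
Definition chd n X Z (c : chain n.+1 X Z) : X ~> cob c := (projT2 c).1.
Definition ctl n X Z (c : chain n.+1 X Z) : chain n (cob c) Z := (projT2 c).2.

Fixpoint crcons n X Z W : chain n X Z -> (Z ~> W) -> chain n.+1 X W :=
  if n is m.+1 then fun c f => ccons (chd c) (crcons (ctl c) f)
  else fun a f => @ccons 0 X Z W a f.

(* Post-composes the last arrow. *)
Fixpoint cpost n X Z W : chain n X Z -> (Z ~> W) -> chain n X W :=
  if n is m.+1 then fun c f => @ccons m X _ W (chd c) (cpost (ctl c) f)
  else fun a f => f ∘ a.

Fixpoint call (P : C -> Prop) n X Z : chain n X Z -> Prop :=
  if n is m.+1 then fun c => P (cob c) /\ call P (ctl c) else fun=> True.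

(* A morphism of chains is given by its components at the two ends and at    *)
(* the n intermediate objects; chmor is the type of the latter.              *)
Fixpoint chmor n X Z X' Z' : chain n X Z -> chain n X' Z' -> Type :=
  if n is m.+1 then fun c c' => ((cob c ~> cob c') * chmor (ctl c) (ctl c'))%type
  else fun _ _ => unit.

Fixpoint chcomm n X Z X' Z' : forall (c : chain n X Z) (c' : chain n X' Z'),
    (X ~> X') -> chmor c c' -> (Z ~> Z') -> Prop :=
  if n is m.+1 then fun c c' phi p psi =>
    p.1 ∘ chd c = chd c' ∘ phi /\ chcomm p.1 p.2 psi
  else fun a a' phi _ psi => psi ∘ a = a' ∘ phi.

Fixpoint chiso n X Z X' Z' : forall (c : chain n X Z) (c' : chain n X' Z'),
    chmor c c' -> Prop :=
  if n is m.+1 then fun c c' p =>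
    is_iso (C := ucat C) (p.1 : hom (c := ucat C) _ _) /\ chiso p.2
  else fun _ _ _ => True.
End Chains.

Section AddChains.
Variables (k : fieldType) (C : addcat k).

Fixpoint czero n (X Z : C) : chain n X Z :=
  if n is m.+1 then ccons (0 : X ~> zob C) (czero m (zob C) Z) else (0 : X ~> Z).

Fixpoint csum n (X Z X' Z' : C) :
    chain n X Z -> chain n X' Z' -> chain n (X ⊕ X') (Z ⊕ Z') :=
  if n is m.+1 then fun c c' =>
    @ccons k C m _ _ _ (mat (chd c) 0 0 (chd c')) (csum (ctl c) (ctl c'))
  else fun a a' => mat a 0 0 a'.

(* With X = X_i, V = Y_(i-1), Y = Y_i, beta = beta_(i-1) and phi = phi_i:    *)
(* the part X_i + Y_(i-1) -> X_(i+1) + Y_i -> ... -> Z' + W of a cone, where *)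
(* sa : Z -> Z' and psi : Z -> W are Sigma alpha_1 and Sigma phi_1.          *)
Fixpoint ccone n (X Z Y W V Z' : C) : forall (a : chain n X Z) (b : chain n Y W),
    (V ~> Y) -> (X ~> Y) -> chmor a b -> (Z ~> Z') -> (Z ~> W) ->
    chain n.+1 (X ⊕ V) (Z' ⊕ W) :=
  if n is m.+1 then fun a b beta phi p sa psi =>
    @ccons k C m.+1 _ _ _ (mat (- chd a) 0 phi beta)
      (ccone (chd b) p.1 p.2 sa psi)
  else fun a b beta phi _ sa psi =>
    @ccons k C 0 _ _ _ (mat (- a) 0 phi beta) (mat (- sa) 0 psi b).
End AddChains.

Section Angulated.
Variables (k : fieldType) (C : addcat k) (Sg : functor (ucat C) (ucat C)) (d : nat).

Definition sobj (X : C) : C := Sg X.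
Definition smap (X Y : C) (f : X ~> Y) : sobj X ~> sobj Y :=
  fmap Sg (f : hom (c := ucat C) X Y).

(* The objects are sfst and the d + 1 intermediate ones of schain. *)
Record nseq := NSeq { sfst : C; schain : chain d.+1 sfst (sobj sfst) }.

(* The canonical comparison Sigma X + Sigma Y -> Sigma (X + Y). *)
Definition susp_sum (X Y : C) : sobj X ⊕ sobj Y ~> sobj (X ⊕ Y) :=
  smap (in1 X Y) ∘ pr1 _ _ + smap (in2 X Y) ∘ pr2 _ _.

Definition seq_iso (s t : nseq) : Prop :=
  exists (phi : sfst s ~> sfst t) (p : chmor (schain s) (schain t)),
    [/\ is_iso (C := ucat C) (phi : hom (c := ucat C) _ _), chiso p
      & chcomm phi p (smap phi)].

Definition seq_sum (s t : nseq) : nseq :=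
  NSeq (cpost (csum (schain s) (schain t)) (susp_sum (sfst s) (sfst t))).

Definition trivial_seq (X : C) : nseq := NSeq (ccons (lid X) (czero d X (sobj X))).

Definition rotation (s : nseq) : nseq :=
  NSeq (crcons (ctl (schain s)) ((-1) ^+ d.+2 *: smap (chd (schain s)))).

Definition cone (s t : nseq) (phi1 : sfst s ~> sfst t)
    (phi2 : cob (schain s) ~> cob (schain t))
    (p : chmor (ctl (schain s)) (ctl (schain t))) : nseq :=
  NSeq (cpost (ccone (chd (schain t)) phi2 p (smap (chd (schain s))) (smap phi1))
          (susp_sum (cob (schain s)) (sfst t))).
End Angulated.

Record angulated (k : fieldType) (C : addcat k) (d : nat) := Angulated {
  susp : functor (ucat C) (ucat C);
  susp_linear : linear_functor susp;
  susp_auto : is_automorphism susp;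
  angle : nseq susp d -> Prop;
  angle_iso : forall s t, seq_iso s t -> angle s -> angle t;
  angle_F1a : forall s t, angle (seq_sum s t) <-> angle s /\ angle t;
  angle_F1b : forall X : C, angle (trivial_seq susp d X);
  angle_F1c : forall (X Y : C) (f : X ~> Y),
    exists c : chain d Y (susp X), angle (@NSeq k C susp d X (ccons f c));
  angle_F2 : forall s, angle s <-> angle (rotation s);
  angle_F3 : forall s t, angle s -> angle t ->
    forall (phi1 : sfst s ~> sfst t) (phi2 : cob (schain s) ~> cob (schain t)),
    phi2 ∘ chd (schain s) = chd (schain t) ∘ phi1 ->
    exists p : chmor (ctl (schain s)) (ctl (schain t)),
      chcomm phi2 p (smap susp phi1);
  angle_F4 : forall s t, angle s -> angle t ->
    forall (phi1 : sfst s ~> sfst t) (phi2 : cob (schain s) ~> cob (schain t)),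
    phi2 ∘ chd (schain s) = chd (schain t) ∘ phi1 ->
    exists p : chmor (ctl (schain s)) (ctl (schain t)),
      chcomm phi2 p (smap susp phi1) /\ angle (cone phi1 phi2 p) }.

(* The chain c is T_d -> ... -> T_0 -> X. *)
Definition cluster_tilting (k : fieldType) (C : addcat k) (d : nat)
    (A : angulated C d) (T : C) : Prop :=
  (forall f : T ~> susp A T, f = 0) /\
  (forall X : C, exists (Td : C) (c : chain d Td X) (delta : X ~> susp A Td),
     [/\ in_add T Td, call (in_add T) c
       & angle (@NSeq k C (susp A) d Td (crcons c delta))]).

(* Unlike falgType, this allows the zero algebra. *)
Record fdalg (k : fieldType) := FdAlg {
  fa_sort :> vectType k;
  fa_one : fa_sort;
  fa_mul : fa_sort -> fa_sort -> fa_sort;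
  fa_mul1 : forall a, fa_mul fa_one a = a;
  fa_mulr1 : forall a, fa_mul a fa_one = a;
  fa_mulA : forall a b c, fa_mul a (fa_mul b c) = fa_mul (fa_mul a b) c;
  fa_linearl : forall b, linear (fun a => fa_mul a b);
  fa_linearr : forall a, linear (fa_mul a) }.

Definition End_alg (k : fieldType) (C : lincat k) (T : C) : fdalg k :=
  @FdAlg k (T ~> T) (lid T) (@lcomp k C T T T) (@lcomp1m k C T T)
    (@lcompm1 k C T T) (@lcompA k C T T T T) (@lcomp_linearl k C T T T)
    (@lcomp_linearr k C T T T).

Record rmod (k : fieldType) (G : fdalg k) := RMod {
  rm_sort :> vectType k;
  ract : rm_sort -> G -> rm_sort;
  ract1 : forall x, ract x (fa_one G) = x;
  ractM : forall x a b, ract x (fa_mul a b) = ract (ract x a) b;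
  ract_linearl : forall a, linear (fun x => ract x a);
  ract_linearr : forall x, linear (ract x) }.

Record rmod_hom (k : fieldType) (G : fdalg k) (M N : rmod G) := RModHom {
  rh_fun :> 'Hom(M, N);
  rh_act : forall x a, rh_fun (ract x a) = ract (rh_fun x) a }.

Section ModCat.
Variables (k : fieldType) (G : fdalg k).
Implicit Types M N P : rmod G.

Lemma rmod_homP M N (f g : rmod_hom M N) : (forall x, f x = g x) -> f = g.
Proof.
case: f g => [f fa] [g ga] /= fg; have E : f = g by apply/lfunP.
by case: _ / E ga => ga; congr RModHom; apply: Prop_irrelevance.
Qed.

Fact rmod_id_act M x a : (\1%VF : 'End(M)) (ract x a) = ract ((\1%VF : 'End(M)) x) a.
Proof. by rewrite !id_lfunE. Qed.

Fact rmod_comp_act M N P (g : rmod_hom N P) (f : rmod_hom M N) x a :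
  (g \o f)%VF (ract x a) = ract ((g \o f)%VF x) a.
Proof. by rewrite !comp_lfunE !rh_act. Qed.

Definition rmod_id M : rmod_hom M M := RModHom (@rmod_id_act M).
Definition rmod_comp M N P (g : rmod_hom N P) (f : rmod_hom M N) : rmod_hom M P :=
  RModHom (rmod_comp_act g f).

Fact rmod_comp1m M N (f : rmod_hom M N) : rmod_comp (rmod_id N) f = f.
Proof. by apply: rmod_homP => x; rewrite /= comp_lfunE id_lfunE. Qed.

Fact rmod_compm1 M N (f : rmod_hom M N) : rmod_comp f (rmod_id M) = f.
Proof. by apply: rmod_homP => x; rewrite /= comp_lfunE id_lfunE. Qed.

Fact rmod_compA M N P Q (h : rmod_hom P Q) (g : rmod_hom N P) (f : rmod_hom M N) :
  rmod_comp h (rmod_comp g f) = rmod_comp (rmod_comp h g) f.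
Proof. by apply: rmod_homP => x; rewrite /= !comp_lfunE. Qed.

Definition modcat : category :=
  Category rmod_comp1m rmod_compm1 rmod_compA.

Definition surjective_hom M N (f : rmod_hom M N) : Prop := forall y, exists x, f x = y.
Definition exact_at M N P (f : rmod_hom M N) (g : rmod_hom N P) : Prop :=
  forall y, g y = 0 <-> exists x, f x = y.

(* Everything below takes place in mod G, i.e. among the finite dimensional   *)
(* right modules, where the epimorphisms and monomorphisms are the surjective *)
(* and the injective homomorphisms.                                           *)
Definition projective P : Prop :=
  forall M N (g : rmod_hom M N) (f : rmod_hom P N),
    surjective_hom g -> exists h : rmod_hom P M, rmod_comp g h = f.

Definition injective_mod (J : rmod G) : Prop :=
  forall M N (g : rmod_hom M N) (f : rmod_hom M J),
    injective g -> exists h : rmod_hom N J, rmod_comp h g = f.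

Definition zero_mod M : Prop := forall x : M, x = 0.

(* ... -> res 1 -> res 0 -> M -> 0 *)
Record proj_resolution M := ProjResolution {
  res : nat -> rmod G;
  res_d : forall i, rmod_hom (res i.+1) (res i);
  res_aug : rmod_hom (res 0%N) M;
  res_proj : forall i, projective (res i);
  res_surj : surjective_hom res_aug;
  res_exact0 : exact_at (res_d 0%N) res_aug;
  res_exact : forall i, exact_at (res_d i.+1) (res_d i) }.

(* 0 -> M -> cores 0 -> cores 1 -> ... *)
Record inj_coresolution M := InjCoresolution {
  cores : nat -> rmod G;
  cores_d : forall i, rmod_hom (cores i) (cores i.+1);
  cores_aug : rmod_hom M (cores 0%N);
  cores_inj : forall i, injective_mod (cores i);
  cores_mono : injective cores_aug;
  cores_exact0 : exact_at cores_aug (cores_d 0%N);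
  cores_exact : forall i, exact_at (cores_d i) (cores_d i.+1) }.

Definition pd_le M (n : nat) : Prop :=
  exists R : proj_resolution M, forall i, (n < i)%N -> zero_mod (res R i).

Definition id_le M (n : nat) : Prop :=
  exists R : inj_coresolution M, forall i, (n < i)%N -> zero_mod (cores R i).

(* The i-th cohomology of the complex Hom(R, N) vanishes. *)
Definition coh_zero M (R : proj_resolution M) (N : rmod G) (i : nat) : Prop :=
  forall phi : rmod_hom (res R i) N,
    (forall x, rmod_comp phi (res_d R i) x = 0) ->
    match i return rmod_hom (res R i) N -> Prop with
    | 0 => fun phi => forall x, phi x = 0
    | j.+1 => fun phi => exists psi : rmod_hom (res R j) N,
                phi = rmod_comp psi (res_d R j)
    end phi.

(* Ext^i(M, N) = 0.  Ext^i(M, N) is the i-th cohomology of Hom(R, N), and    *)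
(* does not depend on the resolution R of M.                                 *)
Definition ext_zero (i : nat) M N : Prop :=
  exists R : proj_resolution M, coh_zero R N i.

Definition gldim_le (n : nat) : Prop := forall M, pd_le M n.

Definition gorenstein (d : nat) : Prop :=
  (forall M, injective_mod M -> pd_le M d) /\ (forall M, projective M -> id_le M d).

Definition d_cluster_tilting (d : nat) (P : modcat -> Prop) : Prop :=
  [/\ functorially_finite P,
      forall M : rmod G, P M <->
        (forall i N, (0 < i < d)%N -> P N -> ext_zero i M N)
    & forall M : rmod G, P M <->
        (forall i N, (0 < i < d)%N -> P N -> ext_zero i N M)].
End ModCat.

Section HomFunctor.
Variables (k : fieldType) (C : lincat k) (T : C).

Fact hom_ractM (X : C) (x : T ~> X) (a b : End_alg T) :
  x ∘ fa_mul a b = x ∘ a ∘ b.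
Proof. exact: lcompA. Qed.

Definition hom_rmod (X : C) : rmod (End_alg T) :=
  @RMod k (End_alg T) (T ~> X) (fun x a => x ∘ a) (@lcompm1 k C T X)
    (@hom_ractM X) (fun a => @lcomp_linearl k C T T X a)
    (fun x => @lcomp_linearr k C T T X x).

Section Map.
Variables (X Y : C) (f : X ~> Y).
Let post (x : T ~> X) : T ~> Y := f ∘ x.
Let post_linear : linear post. Proof. exact: lcomp_linearr. Qed.
HB.instance Definition _ := GRing.isLinear.Build k (T ~> X) (T ~> Y) *:%R post post_linear.

Definition hom_post : 'Hom(hom_rmod X, hom_rmod Y) := linfun post.

Lemma hom_postE (x : T ~> X) : hom_post x = f ∘ x.
Proof. exact: lfunE. Qed.

Fact hom_post_act (x : hom_rmod X) (a : End_alg T) :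
  hom_post (ract x a) = ract (hom_post x) a.
Proof. by rewrite !hom_postE /= lcompA. Qed.

Definition hom_map : rmod_hom (hom_rmod X) (hom_rmod Y) := RModHom hom_post_act.
End Map.

Fact hom_map1 (X : C) : hom_map (lid X) = rmod_id (hom_rmod X).
Proof. by apply: rmod_homP => x; rewrite /= hom_postE id_lfunE lcomp1m. Qed.

Fact hom_mapM (X Y Z : C) (g : Y ~> Z) (f : X ~> Y) :
  hom_map (g ∘ f) = rmod_comp (hom_map g) (hom_map f).
Proof. by apply: rmod_homP => x; rewrite /= comp_lfunE !hom_postE lcompA. Qed.

Definition hom_functor : functor (ucat C) (modcat (End_alg T)) :=
  @Functor (ucat C) (modcat (End_alg T)) hom_rmod hom_map hom_map1 hom_mapM.
End HomFunctor.

(* Main.v *)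
(* Write F = T(T, -) and D for its essential image.  Comparing an angle with    *)

(* Three facts about F carry the proof. By [angle_wexact], each arrow of an angle is a weak kernel
   of the next one and a weak cokernel of the previous one, so F turns angles into exact sequences
   ([wexact_Fexact]), and Serre duality turns them into exact sequences of modules F(S Y)
   ([wexact_Sexact]). Next, F T is Gamma and F(S T) is D Gamma, so add T supplies enough projectives
   and S T enough injectives ([cover_exists], [cogenerating_embedding]). Finally, F is full and its
   kernel is [add Sigma T] ([hom_full], [hom_zero_factors]), which gives (ii) and, with
   [idempotent_lifting], closure of D under summands.

   For (i), [ext_vanish_hom] is rigidity, [left_coresolution] and [right_approximation] give the
   approximations, and [in_image_maximal_left] and [in_image_maximal_right] give maximality. Part
   (iii) combines [injective_respath] with [projective_injpath], and (iv) follows from the latter by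
   [gldim_le_injpath].

   Ext groups are never formed. Vanishing is a statement about cocycles on a resolution, the long
   exact sequence enters only through [coh_step_quo] and [coh_step_sub], and [chain_kernels] cuts
   longer exact sequences into short ones. *)
(* trivial angles by (F3) shows that T(W, -) and T(-, W) are exact along angles. *)
(* Hence an angle T_d -> ... -> T_0 -> X -> Sigma T_d with T_i in add T makes F  *)
(* full with kernel [add Sigma T], and gives the first d + 1 terms of a          *)
(* projective resolution of F X, whence Ext^i(F X, F Y) = 0 for 0 < i < d.       *)
(*                                                                               *)
(* A module M is the cokernel of some F T_1 -> F T_0; completing T_1 -> T_0 to   *)
(* an angle yields a coresolution of M by d modules of D.  By Serre duality M is *)
(* also the kernel of a map between injectives F(S T_0) -> F(S T_1), which       *)
(* yields a resolution of M by d modules of D.  If the relevant Ext groups       *)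
(* vanish, dimension shifting splits these sequences, so M is a summand of a     *)
(* module of D.  D is closed under summands because F is full, endomorphism      *)
(* algebras are finite dimensional, and so idempotents lift along F.             *)
(*                                                                               *)
(* An injective module is F X with T(Sigma T, X) = 0, so its resolution by the   *)
(* F T_i stops after F T_d.  For projective F T', Serre duality turns the angle  *)
(* of S^-1 Sigma T' into an injective coresolution of length d.  Finally, if all *)
(* projectives have injective dimension at most d, then Ext^i(-, P) = 0 for      *)
(* i > d, and a finite projective resolution can be shortened to length d.       *)
From HB Require Import structures.
From mathcomp Require Import all_boot all_algebra.
From mathcomp Require Import boolp ring.
Require Import Defs.
Set Implicit Arguments.
Unset Strict Implicit.
Unset Printing Implicit Defensive.
Import GRing.Theory.
Local Open Scope ring_scope.

(** * Finite dimensional modules *)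

Section Modules.
Variables (k : fieldType) (G : fdalg k).
Implicit Types M N P A B : rmod G.

Lemma ractD M (x y : M) a : ract (x + y) a = ract x a + ract y a.
Proof. by have := ract_linearl a 1 x y; rewrite !scale1r. Qed.

Lemma ract0 M a : ract (0 : M) a = 0.
Proof. by apply: (addrI (ract (0 : M) a)); rewrite -ractD !addr0. Qed.

Lemma ractN M (x : M) a : ract (- x) a = - ract x a.
Proof. by apply/eqP; rewrite -addr_eq0 -ractD addNr ract0. Qed.

Lemma rmod_hom_exists M N (f : M -> N) :
  linear f -> (forall x a, f (ract x a) = ract (f x) a) ->
  exists h : rmod_hom M N, forall x, h x = f x.
Proof.
move=> fl fa.
pose L := GRing.isLinear.Build k M N *:%R f fl.
pose g : {linear M -> N} := HB.pack f L.
have gE x : linfun g x = f x by exact: (lfunE g).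
have ha x a : linfun g (ract x a) = ract (linfun g x) a by rewrite !gE.
by exists (RModHom ha) => x; apply: gE.
Qed.

Lemma rh_linear M N (f : rmod_hom M N) : linear f.
Proof. exact: linearP. Qed.

Lemma rhD M N (f : rmod_hom M N) x y : f (x + y) = f x + f y.
Proof. exact: linearD. Qed.

Lemma rhB M N (f : rmod_hom M N) x y : f (x - y) = f x - f y.
Proof. exact: linearB. Qed.

Lemma rh0 M N (f : rmod_hom M N) : f 0 = 0.
Proof. exact: linear0. Qed.

Lemma rmod_homD M N (f g : rmod_hom M N) :
  exists h : rmod_hom M N, forall x, h x = f x + g x.
Proof.
apply: rmod_hom_exists => [c x y|x a]; last by rewrite !rh_act ractD.
by rewrite !linearP scalerDr addrACA.
Qed.

Lemma rmod_homB M N (f g : rmod_hom M N) :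
  exists h : rmod_hom M N, forall x, h x = f x - g x.
Proof.
apply: rmod_hom_exists => [c x y|x a]; last by rewrite !rh_act ractD ractN.
by rewrite !linearP scalerDr addrACA.
Qed.

Lemma rmod_hom0 M N : exists h : rmod_hom M N, forall x, h x = 0.
Proof.
by apply: rmod_hom_exists => [c x y|x a]; rewrite ?scaler0 ?addr0 ?ract0.
Qed.

Lemma rmod_compE M N P (g : rmod_hom N P) (f : rmod_hom M N) x :
  rmod_comp g f x = g (f x).
Proof. by rewrite /= comp_lfunE. Qed.

Lemma rmod_idE M (x : M) : rmod_id M x = x.
Proof. by rewrite /= id_lfunE. Qed.

Lemma eq_rmod_comp M N P (g : rmod_hom N P) (f : rmod_hom M N) (h : rmod_hom M P) :
  rmod_comp g f = h -> forall x, g (f x) = h x.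
Proof. by move=> <- x; rewrite rmod_compE. Qed.

Lemma factor_surj M N P (g : rmod_hom M N) (f : rmod_hom M P) :
  surjective_hom g -> (forall x, g x = 0 -> f x = 0) ->
  exists h : rmod_hom N P, forall x, h (g x) = f x.
Proof.
move=> gs gf.
pose s y := projT1 (cid (gs y)).
have sK y : g (s y) = y by rewrite /s; case: cid.
have fE x y : g x = g y -> f x = f y.
  by move=> e; apply/eqP; rewrite -subr_eq0 -linearB; apply/eqP/gf; rewrite linearB /= e subrr.
have [||h hE] := @rmod_hom_exists N P (fun y => f (s y)).
- move=> c x y; rewrite -(rh_linear f c (s x) (s y)); apply: fE.
  by rewrite (rh_linear g) !sK.
- by move=> x a; rewrite -rh_act; apply: fE; rewrite rh_act !sK.
by exists h => x; rewrite hE; apply: fE; rewrite sK.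
Qed.

Lemma factor_inj M A B (i : rmod_hom A B) (f : rmod_hom M B) :
  injective i -> (forall x, exists y, i y = f x) ->
  exists h : rmod_hom M A, forall x, i (h x) = f x.
Proof.
move=> ii ex.
pose s x := projT1 (cid (ex x)).
have sK x : i (s x) = f x by rewrite /s; case: cid.
have [||h hE] := @rmod_hom_exists M A s.
- by move=> c x y; apply: ii; rewrite (rh_linear i) !sK (rh_linear f).
- by move=> x a; apply: ii; rewrite rh_act !sK rh_act.
by exists h => x; rewrite hE sK.
Qed.

Lemma proj_lift P M N (g : rmod_hom M N) (f : rmod_hom P N) :
  projective P -> surjective_hom g ->
  exists h : rmod_hom P M, forall x, g (h x) = f x.
Proof.
by move=> pP gs; have [h e] := pP _ _ _ f gs; exists h; apply: eq_rmod_comp.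
Qed.

(** * Submodules, quotients, kernels and cokernels *)

Section Submodule.
Variables (M : rmod G) (U : {vspace M}) (UG : forall x a, x \in U -> ract x a \in U).

Definition sub_act (x : subvs_of U) (a : G) : subvs_of U :=
  Subvs (UG a (subvsP x)).

Fact sub_act1 x : sub_act x (fa_one G) = x.
Proof. by apply: val_inj; rewrite /= ract1. Qed.
Fact sub_actM x a b : sub_act x (fa_mul a b) = sub_act (sub_act x a) b.
Proof. by apply: val_inj; rewrite /= ractM. Qed.
Fact sub_act_linearl a : linear (fun x => sub_act x a).
Proof. by move=> c x y; apply: val_inj; rewrite /= ract_linearl. Qed.
Fact sub_act_linearr x : linear (sub_act x).
Proof. by move=> c a b; apply: val_inj; rewrite /= ract_linearr. Qed.

Definition submod : rmod G :=
  RMod sub_act1 sub_actM sub_act_linearl sub_act_linearr.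

Lemma submod_incl : exists i : rmod_hom submod M,
  injective i /\ forall y, y \in U <-> exists x, i x = y.
Proof.
have [//|//|i iE] := @rmod_hom_exists submod M (@vsval _ _ U).
exists i; split=> [x y|y]; first by rewrite !iE; apply: val_inj.
split=> [Uy|[x <-]]; last by rewrite iE subvsP.
by exists (Subvs Uy); rewrite iE.
Qed.
End Submodule.

Lemma ker_exists M N (f : rmod_hom M N) : exists A (i : rmod_hom A M),
  injective i /\ exact_at i f.
Proof.
have UG x a : x \in lker f -> ract x a \in lker f.
  by rewrite !memv_ker rh_act => /eqP ->; rewrite ract0.
have [i [ii iP]] := submod_incl UG; exists (submod UG), i; split=> // y.
by rewrite -iP memv_ker; split=> /eqP.
Qed.

Section Quotient.
Variables (M : rmod G) (U : {vspace M}) (UG : forall x a, x \in U -> ract x a \in U).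
(** The quotient M/U is carried by a linear complement [W] of [U]; [p] is the projection onto [W]
    along [U], and the action is transported through it. *)
Let W : {vspace M} := (U^C)%VS.
Let p (x : M) : subvs_of W := vsproj W (daddv_pi W U x).

Let WU : (W :&: U = 0)%VS. Proof. by rewrite capvC capv_compl. Qed.

Let val_p x : vsval (p x) = daddv_pi W U x.
Proof. by rewrite vsprojK // memv_pi. Qed.

Let p_linear : linear p.
Proof. by move=> c x y; rewrite /p !linearP. Qed.

Let pB x : x - vsval (p x) \in U.
Proof.
have E : daddv_pi W U x + daddv_pi U W x = x.
  by apply: daddv_pi_add => //; rewrite addvC addv_complf memvf.
suff -> : x - vsval (p x) = daddv_pi U W x by apply: memv_pi.
by apply/eqP; rewrite val_p subr_eq addrC E.
Qed.

Let p_ker x : x \in U -> p x = 0.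
Proof.
move=> Ux; have := pB x => h; apply: val_inj => /=.
have : vsval (p x) \in (W :&: U)%VS.
  by rewrite memv_cap subvsP -[vsval _](subKr x) rpredB.
by rewrite WU memv0 => /eqP.
Qed.

Let p0 : p 0 = 0.
Proof. exact/p_ker/mem0v. Qed.
Let pD x y : p (x + y) = p x + p y.
Proof. by have := p_linear 1 x y; rewrite !scale1r. Qed.
Let pN x : p (- x) = - p x.
Proof. by apply/eqP; rewrite -addr_eq0 -pD addNr p0. Qed.

Let pE x y : x - y \in U -> p x = p y.
Proof. by move=> /p_ker; rewrite pD pN => /eqP; rewrite subr_eq0 => /eqP. Qed.

Let pK (x : subvs_of W) : p (vsval x) = x.
Proof. by rewrite /p daddv_pi_id ?vsvalK // subvsP. Qed.

Let qact (x : subvs_of W) (a : G) : subvs_of W := p (ract (vsval x) a).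

Let p_act x a : p (ract x a) = qact (p x) a.
Proof. by apply: pE; rewrite -ractN -ractD UG. Qed.

Fact qact1 x : qact x (fa_one G) = x.
Proof. by rewrite /qact ract1 pK. Qed.
Fact qactM x a b : qact x (fa_mul a b) = qact (qact x a) b.
Proof. by rewrite {1}/qact ractM p_act. Qed.
Fact qact_linearl a : linear (fun x => qact x a).
Proof. by move=> c x y; rewrite /qact /= ract_linearl p_linear. Qed.
Fact qact_linearr x : linear (qact x).
Proof. by move=> c a b; rewrite /qact /= ract_linearr p_linear. Qed.

Definition quomod : rmod G := RMod qact1 qactM qact_linearl qact_linearr.

Lemma quomod_proj : exists q : rmod_hom M quomod,
  surjective_hom q /\ forall x, q x = 0 <-> x \in U.
Proof.
have [//|//|q qE] := @rmod_hom_exists M quomod p.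
exists q; split=> [y|x]; first by exists (vsval (y : subvs_of W)); rewrite qE pK.
rewrite qE; split=> [e|/p_ker //].
have V : vsval (p x) = 0 by rewrite e.
by have := pB x; rewrite V subr0.
Qed.
End Quotient.

Lemma coker_exists M N (f : rmod_hom M N) : exists B (q : rmod_hom N B),
  surjective_hom q /\ exact_at f q.
Proof.
have UG x a : x \in limg f -> ract x a \in limg f.
  by move=> /memv_imgP[y _ ->]; rewrite -rh_act memv_img ?memvf.
have [q [qs qP]] := quomod_proj UG; exists (quomod UG), q; split=> // y.
rewrite qP; split=> [/memv_imgP[x _ ->]|[x <-]]; first by exists x.
by rewrite memv_img ?memvf.
Qed.

Definition rzero_act (x : 'rV[k]_0) (a : G) : 'rV[k]_0 := x.
Fact rzero_act_linearr x : linear (rzero_act x).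
Proof. by move=> c a b; rewrite !thinmx0. Qed.
Definition rzero : rmod G :=
  @RMod k G 'rV[k]_0 rzero_act (fun=> erefl) (fun _ _ _ => erefl)
    (fun _ _ _ _ => erefl) rzero_act_linearr.

Lemma rzero_zero : zero_mod rzero.
Proof. by move=> x; apply: thinmx0. Qed.

Lemma rzero_projective : projective rzero.
Proof.
move=> M N g f _; have [h hE] := rmod_hom0 rzero M; exists h.
by apply: rmod_homP => x; rewrite rmod_compE hE (rzero_zero x) !linear0.
Qed.

Lemma rzero_injective : injective_mod rzero.
Proof.
move=> M N g f _; have [h hE] := rmod_hom0 N rzero; exists h.
by apply: rmod_homP => x; rewrite rmod_compE hE (rzero_zero (f x)).
Qed.

Definition ses A E B := exists (i : rmod_hom A E) (p : rmod_hom E B),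
  [/\ injective i, surjective_hom p & exact_at i p].

Definition rmod_retract A E := exists (i : rmod_hom A E) (p : rmod_hom E A),
  forall x, p (i x) = x.

Definition rmod_iso A B := exists (i : rmod_hom A B) (p : rmod_hom B A),
  (forall x, p (i x) = x) /\ (forall x, i (p x) = x).

Lemma rmod_isoP A B : isomorphic (C := modcat G) A B <-> rmod_iso A B.
Proof.
split=> [[i [p [e e']]]|[i [p [e e']]]]; exists i, p.
  split=> x; first by rewrite (eq_rmod_comp e) rmod_idE.
  by rewrite (eq_rmod_comp e') rmod_idE.
by split; apply: rmod_homP => x; rewrite rmod_compE rmod_idE.
Qed.

Lemma rmod_iso_refl A : rmod_iso A A.
Proof. by exists (rmod_id A), (rmod_id A); split=> x; rewrite !rmod_idE. Qed.

Lemma rmod_iso_sym A B : rmod_iso A B -> rmod_iso B A.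
Proof. by move=> [i [p [h h']]]; exists p, i. Qed.

Lemma rmod_iso_trans A B E : rmod_iso A B -> rmod_iso B E -> rmod_iso A E.
Proof.
move=> [i [p [h h']]] [j [q [g g']]]; exists (rmod_comp j i), (rmod_comp p q).
by split=> x; rewrite !rmod_compE ?g ?h ?h' ?g'.
Qed.

Lemma rmod_iso_bij A B (f : rmod_hom A B) :
  injective f -> surjective_hom f -> rmod_iso A B.
Proof.
move=> fi fs.
have [|g gE] := @factor_inj B A B f (rmod_id B) fi.
  by move=> x; have [y e] := fs x; exists y; rewrite rmod_idE.
exists f, g; split=> x; last by rewrite gE rmod_idE.
by apply: fi; rewrite gE rmod_idE.
Qed.

Lemma ker_unique A A' M N (f : rmod_hom M N) (i : rmod_hom A M) (i' : rmod_hom A' M) :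
  injective i -> injective i' -> exact_at i f -> exact_at i' f -> rmod_iso A A'.
Proof.
move=> ii ii' e e'.
have [|g gE] := factor_inj (f := i) ii'.
  by move=> x; apply/e'/e; exists x.
have [|h hE] := factor_inj (f := i') ii.
  by move=> x; apply/e/e'; exists x.
by exists g, h; split=> x; [apply: ii | apply: ii']; rewrite ?gE ?hE ?gE.
Qed.

Lemma retract_projective A E : projective E -> rmod_retract A E -> projective A.
Proof.
move=> pE [i [p ip]] M N g f gs.
have [h /eq_rmod_comp hE] := pE _ _ g (rmod_comp f p) gs.
exists (rmod_comp h i); apply: rmod_homP => x.
by rewrite !rmod_compE hE rmod_compE ip.
Qed.

Lemma retract_injective A E : injective_mod E -> rmod_retract A E -> injective_mod A.
Proof.
move=> iE [i [p ip]] M N g f gi.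
have [h /eq_rmod_comp hE] := iE _ _ g (rmod_comp i f) gi.
exists (rmod_comp p h); apply: rmod_homP => x.
by rewrite !rmod_compE hE rmod_compE ip.
Qed.

Lemma rmod_iso_retract A B : rmod_iso A B -> rmod_retract A B.
Proof. by move=> [i [p [h _]]]; exists i, p. Qed.

Lemma zero_mod_iso A : zero_mod A -> rmod_iso A rzero.
Proof.
move=> A0; have [f fE] := rmod_hom0 A rzero; have [g gE] := rmod_hom0 rzero A.
by exists f, g; split=> x; rewrite ?fE ?gE ?(A0 x) // (rzero_zero x).
Qed.

Lemma zero_mod_projective A : zero_mod A -> projective A.
Proof.
by move=> /zero_mod_iso/rmod_iso_retract; apply: retract_projective; apply: rzero_projective.
Qed.

(** Since [f] kills the kernel of [h], it descends to N / ker h, which embeds in [P]; injectivity of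
    [J] then extends it. *)
Lemma inj_extend M N P J (g : rmod_hom M N) (h : rmod_hom N P) (f : rmod_hom N J) :
  injective_mod J -> exact_at g h -> (forall x, f (g x) = 0) ->
  exists f' : rmod_hom P J, forall x, f' (h x) = f x.
Proof.
move=> iJ gh fg.
have [K [i [ii ik]]] := ker_exists h.
have [B [q [qs qk]]] := coker_exists i.
have [h1 h1E] : exists h1 : rmod_hom B P, forall x, h1 (q x) = h x.
  by apply: factor_surj => // x /qk /ik.
have [f1 f1E] : exists f1 : rmod_hom B J, forall x, f1 (q x) = f x.
  by apply: factor_surj => // x /qk /ik /gh [y <-].
have h1i : injective h1.
  move=> y y' e; apply/eqP; rewrite -subr_eq0; have [x xE] := qs (y - y').
  rewrite -xE; apply/eqP/qk/ik; rewrite -h1E xE linearB /= e subrr //.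
have [f2 /eq_rmod_comp f2E] := iJ _ _ h1 f1 h1i.
by exists f2 => x; rewrite -h1E f2E f1E.
Qed.

(** Here [f] lands in the kernel of [h], and [M] surjects onto that kernel. *)
Lemma proj_extend P M N L (g : rmod_hom M N) (h : rmod_hom N L) (f : rmod_hom P N) :
  projective P -> exact_at g h -> (forall x, h (f x) = 0) ->
  exists f' : rmod_hom P M, forall x, g (f' x) = f x.
Proof.
move=> pP gh hf.
have [K [i [ii ik]]] := ker_exists h.
have [g1 g1E] : exists g1 : rmod_hom M K, forall x, i (g1 x) = g x.
  by apply: factor_inj => // x; apply/ik/gh; exists x.
have [f1 f1E] : exists f1 : rmod_hom P K, forall x, i (f1 x) = f x.
  by apply: factor_inj => // x; apply/ik/hf.
have [|f2 /eq_rmod_comp f2E] := pP _ _ g1 f1.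
  move=> y; have [|x xE] := (gh (i y)).1; first by apply/ik; exists y.
  by exists x; apply: ii; rewrite g1E.
by exists f2 => x; rewrite -g1E f2E f1E.
Qed.

Section Splice.
Variables (A P B : rmod G) (i : rmod_hom A P) (p : rmod_hom P B).
Hypotheses (ii : injective i) (ps : surjective_hom p) (ip : exact_at i p).
Hypothesis pP : projective P.
Variable R : proj_resolution A.

Definition spl_res (j : nat) : rmod G := if j is j'.+1 then res R j' else P.
Definition spl_d (j : nat) : rmod_hom (spl_res j.+1) (spl_res j) :=
  match j with
  | 0 => rmod_comp i (res_aug R)
  | j'.+1 => res_d R j'
  end.

Fact spl_proj j : projective (spl_res j).
Proof. by case: j => [|j] //; apply: res_proj. Qed.

Fact spl_exact0 : exact_at (spl_d 0) p.
Proof.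
move=> y; split=> [/ip [x <-]|[x <-]]; last by apply/ip; rewrite rmod_compE; exists (res_aug R x).
by have [z <-] := res_surj R x; exists z; rewrite /= -rmod_compE.
Qed.

Fact spl_exact j : exact_at (spl_d j.+1) (spl_d j).
Proof.
case: j => [|j]; last exact: res_exact.
move=> y; rewrite [spl_d 0 y]rmod_compE -(res_exact0 (p := R) y).
by split=> [|->]; [rewrite -(linear0 i) => /ii | rewrite linear0].
Qed.

(** Prepending [P] to a resolution of its syzygy [A] shifts degrees definitionally, so Ext^(j+1) of
    [A] and Ext^(j+2) of [B] are computed by the same cocycles. *)
Definition splice : proj_resolution B :=
  @ProjResolution k G B spl_res spl_d p spl_proj ps spl_exact0 spl_exact.
End Splice.

End Modules.

(** * Cohomology of resolutions and dimension shifting *)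

Section Ext.
Variables (k : fieldType) (G : fdalg k).
Implicit Types M N P A B E : rmod G.

Lemma ses_exact_comp A E B (i : rmod_hom A E) (p : rmod_hom E B) :
  exact_at i p -> forall x, p (i x) = 0.
Proof. by move=> ip x; apply/ip; exists x. Qed.

Lemma res_dd M (R : proj_resolution M) j x : res_d R j (res_d R j.+1 x) = 0.
Proof. by apply/res_exact; exists x. Qed.

Lemma res_augd M (R : proj_resolution M) x : res_aug R (res_d R 0 x) = 0.
Proof. by apply/res_exact0; exists x. Qed.

Lemma cohP M (R : proj_resolution M) N i :
  coh_zero R N i.+1 <->
  forall phi : rmod_hom (res R i.+1) N, (forall x, phi (res_d R i.+1 x) = 0) ->
    exists psi : rmod_hom (res R i) N, forall x, phi x = psi (res_d R i x).
Proof.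
split=> h phi phid.
  have [|psi ->] := h phi; first by move=> x; rewrite rmod_compE phid.
  by exists psi => x; rewrite rmod_compE.
have [|psi psiE] := h phi; first by move=> x; rewrite -rmod_compE phid.
by exists psi; apply: rmod_homP => x; rewrite rmod_compE psiE.
Qed.

(** The stretch Ext^(i+1)(M, E) -> Ext^(i+1)(M, B) -> Ext^(i+2)(M, A) of the long exact sequence,
    chased on cocycles of a fixed resolution. *)
Lemma coh_step_quo M (R : proj_resolution M) A E B i : ses A E B ->
  coh_zero R E i.+1 -> coh_zero R A i.+2 -> coh_zero R B i.+1.
Proof.
move=> [u [p [ui ps up]]] /cohP hE /cohP hA; apply/cohP => phi phid.
have [f fE] := proj_lift phi (@res_proj _ _ _ R i.+1) ps.
have [g gE] : exists g : rmod_hom (res R i.+2) A, forall x, u (g x) = f (res_d R _ x).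
  have [|g gE] := factor_inj (f := rmod_comp f (res_d R _)) ui.
    by move=> x; apply/up; rewrite rmod_compE fE phid.
  by exists g => x; rewrite gE rmod_compE.
have [|s sE] := hA g.
  by move=> x; apply: ui; rewrite gE res_dd !linear0.
have [f' f'E] := rmod_homB f (rmod_comp u s).
have [|t tE] := hE f'.
  by move=> x; rewrite f'E rmod_compE -sE gE subrr.
exists (rmod_comp p t) => x.
by rewrite rmod_compE -tE f'E linearB /= rmod_compE fE (ses_exact_comp up) subr0.
Qed.

(** The stretch Ext^(i+1)(M, B) -> Ext^(i+2)(M, A) -> Ext^(i+2)(M, E). *)
Lemma coh_step_sub M (R : proj_resolution M) A E B i : ses A E B ->
  coh_zero R B i.+1 -> coh_zero R E i.+2 -> coh_zero R A i.+2.
Proof.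
move=> [u [p [ui ps up]]] /cohP hB /cohP hE; apply/cohP => phi phid.
have [|t tE] := hE (rmod_comp u phi).
  by move=> x; rewrite rmod_compE phid linear0.
have [|s sE] := hB (rmod_comp p t).
  by move=> x; rewrite rmod_compE -tE rmod_compE (ses_exact_comp up).
have [s' s'E] := proj_lift s (@res_proj _ _ _ R i) ps.
have [t' t'E] := rmod_homB t (rmod_comp s' (res_d R i)).
have [|psi psiE] := factor_inj (f := t') ui.
  move=> x; apply/up; rewrite t'E linearB /= rmod_compE s'E -sE rmod_compE subrr //.
exists psi => x; apply: ui.
by rewrite psiE t'E rmod_compE res_dd linear0 subr0 -tE rmod_compE.
Qed.

Lemma coh_injective M (R : proj_resolution M) J i :
  injective_mod J -> coh_zero R J i.+1.
Proof.
move=> iJ; apply/cohP => phi phid.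
case: i phi phid => [|i] phi phid.
  have [psi psiE] := inj_extend (h := res_d R 0) iJ (@res_exact _ _ _ R 0) phid.
  by exists psi.
have [psi psiE] := inj_extend (h := res_d R i.+1) iJ (@res_exact _ _ _ R i.+1) phid.
by exists psi.
Qed.

Lemma coh_zero_mod M (R : proj_resolution M) N i : zero_mod N -> coh_zero R N i.+1.
Proof.
move=> N0; apply: coh_injective.
apply: retract_injective (@rzero_injective k G) _.
exact/rmod_iso_retract/zero_mod_iso.
Qed.

(** A lift of the augmentation to [E] restricts on [res R 1] to a cocycle with values in [A].
    Subtracting a cochain that bounds it makes the lift descend to a section [s], and id - s p gives
    the retraction. *)
Lemma ses_split M (R : proj_resolution M) A E :
  coh_zero R A 1 -> ses A E M ->
  exists (p : rmod_hom E M) (s : rmod_hom M E) (u : rmod_hom A E) (r : rmod_hom E A),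
    [/\ forall x, p (s x) = x & forall x, r (u x) = x].
Proof.
move=> /cohP hA [u [p [ui ps up]]].
have [f fE] := proj_lift (res_aug R) (@res_proj _ _ _ R 0) ps.
have [g gE] : exists g : rmod_hom (res R 1) A, forall x, u (g x) = f (res_d R 0 x).
  have [|g gE] := factor_inj (f := rmod_comp f (res_d R 0)) ui.
    by move=> x; apply/up; rewrite rmod_compE fE res_augd.
  by exists g => x; rewrite gE rmod_compE.
have [|t tE] := hA g.
  by move=> x; apply: ui; rewrite gE res_dd !linear0.
have [f' f'E] := rmod_homB f (rmod_comp u t).
have [|s sE] := factor_surj (f := f') (@res_surj _ _ _ R).
  by move=> x /(@res_exact0 _ _ _ R x) [y <-]; rewrite f'E rmod_compE -tE gE subrr.
have ps1 x : p (s x) = x.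
  have [y <-] := res_surj R x.
  by rewrite sE f'E linearB /= rmod_compE fE (ses_exact_comp up) subr0.
have [q qE] := rmod_homB (rmod_id E) (rmod_comp s p).
have [|r rE] := factor_inj (f := q) ui.
  by move=> x; apply/up; rewrite qE linearB /= rmod_idE rmod_compE ps1 subrr.
exists p, s, u, r; split=> // x; apply: ui.
by rewrite rE qE rmod_idE rmod_compE (ses_exact_comp up) linear0 subr0.
Qed.

Lemma ses_split_retract M (R : proj_resolution M) A E :
  coh_zero R A 1 -> ses A E M -> rmod_retract A E /\ rmod_retract M E.
Proof.
by move=> h /(ses_split h) [p [s [u [r [ps ru]]]]]; split; [exists u, r | exists s, p].
Qed.

Definition enough_injectives := forall N, exists J (i : rmod_hom N J),
  injective_mod J /\ injective i.

Definition enough_projectives := forall M, exists P (p : rmod_hom P M),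
  projective P /\ surjective_hom p.

(** Comparison maps are needed only in degrees 0 and 1. The composite t0 s0 is homotopic to the
    identity through [hh], so t1 s1 - hh d - id takes values in the kernel of the differential,
    where the cocycle [phi] vanishes. *)
Lemma coh1_indep M (R R' : proj_resolution M) N : coh_zero R N 1 -> coh_zero R' N 1.
Proof.
move=> /cohP h; apply/cohP => phi phid.
have lift0 (Q Q' : proj_resolution M) : exists s0 : rmod_hom (res Q 0) (res Q' 0),
    forall x, res_aug Q' (s0 x) = res_aug Q x.
  by apply: proj_lift; [apply: res_proj | apply: res_surj].
have lift1 (Q Q' : proj_resolution M) (s0 : rmod_hom (res Q 0) (res Q' 0)) :
    (forall x, res_aug Q' (s0 x) = res_aug Q x) ->
    exists s1 : rmod_hom (res Q 1) (res Q' 1),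
      forall x, res_d Q' 0 (s1 x) = s0 (res_d Q 0 x).
  move=> e; have [|s1 s1E] :=
    proj_extend (f := rmod_comp s0 (res_d Q 0)) (@res_proj _ _ _ Q 1) (@res_exact0 _ _ _ Q').
    by move=> x; rewrite rmod_compE e res_augd.
  by exists s1 => x; rewrite s1E rmod_compE.
have [s0 s0E] := lift0 R' R; have [s1 s1E] := lift1 _ _ _ s0E.
have [t0 t0E] := lift0 R R'; have [t1 t1E] := lift1 _ _ _ t0E.
have phi_ker x : res_d R' 0 x = 0 -> phi x = 0.
  by move=> /(@res_exact _ _ _ R' 0 x) [y <-].
have [|psi psiE] := h (rmod_comp phi t1).
  move=> x; rewrite rmod_compE; apply: phi_ker.
  by rewrite t1E res_dd linear0.
have [v vE] := rmod_homB (rmod_comp t0 s0) (rmod_id _).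
have [|hh hE] := proj_extend (f := v) (@res_proj _ _ _ R' 0) (@res_exact0 _ _ _ R').
  by move=> x; rewrite vE linearB /= rmod_compE t0E s0E rmod_idE subrr.
have [w wE] := rmod_homB (rmod_comp psi s0) (rmod_comp phi hh).
exists w => x; rewrite wE !rmod_compE -s1E -psiE rmod_compE.
have e : res_d R' 0 (t1 (s1 x) - hh (res_d R' 0 x) - x) = 0.
  rewrite linearB /= linearB /= t1E s1E hE vE rmod_compE rmod_idE.
  by rewrite subKr subrr.
by have /eqP := phi_ker _ e; rewrite linearB /= linearB /= subr_eq0 => /eqP.
Qed.

(* Dimension shifting along 0 -> N -> J -> B -> 0 with J injective. *)
Lemma coh_indep (ei : enough_injectives) M (R R' : proj_resolution M) N i :
  coh_zero R N i.+1 -> coh_zero R' N i.+1.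
Proof.
elim: i N => [|i IH] N; first exact: coh1_indep.
move=> h; have [J [u [iJ ui]]] := ei N; have [B [p [ps up]]] := coker_exists u.
have s : ses N J B by exists u, p.
apply: (coh_step_sub s); last exact: coh_injective.
by apply: IH; apply: coh_step_quo s _ h; apply: coh_injective.
Qed.

Lemma ext_zero_coh (ei : enough_injectives) i M N (R : proj_resolution M) :
  ext_zero i.+1 M N -> coh_zero R N i.+1.
Proof. by move=> [R']; apply: coh_indep. Qed.

(** An exact sequence 0 -> K -> E_n -> ... -> E_1 -> B -> 0 with the E_j in [P] and K in [Q], stored
    as nested short exact sequences. With [Q] the zero modules it is a finite resolution of [B];
    with [Q] the modules isomorphic to M it is a coresolution of M ending in [B]. *)
Fixpoint respath (P Q : rmod G -> Prop) (n : nat) (B : rmod G) : Prop :=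
  if n is m.+1 then exists A E, [/\ ses A E B, P E & respath P Q m A] else Q B.

Lemma ses_iso A E B B' : rmod_iso B B' -> ses A E B -> ses A E B'.
Proof.
move=> [f [g [gf fg]]] [u [p [ui ps up]]]; exists u, (rmod_comp f p); split=> //.
  by move=> y; have [x xE] := ps (g y); exists x; rewrite rmod_compE xE fg.
move=> y; rewrite rmod_compE -(up y); split=> [|->]; last by rewrite linear0.
by move=> /(congr1 g); rewrite gf linear0.
Qed.

Lemma respath_iso (P Q : rmod G -> Prop) n B B' :
  (forall A A', rmod_iso A A' -> Q A -> Q A') ->
  rmod_iso B B' -> respath P Q n B -> respath P Q n B'.
Proof.
case: n => [|n] QI BB' /=; first exact: QI.
by move=> [A [E [s PE h]]]; exists A, E; split=> //; apply: ses_iso s.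
Qed.

(** Each step trades Ext^(i+1) of the quotient for Ext^(i+2) of the kernel. The far end is thus
    tested in a higher degree than any middle term, hence the bound r + 1 for [Q] against r for
    [P]. *)
Lemma respath_coh M (R : proj_resolution M) (P Q : rmod G -> Prop) r n B :
  (forall E i, P E -> (i < r)%N -> coh_zero R E i.+1) ->
  (forall E i, Q E -> (i < r.+1)%N -> coh_zero R E i.+1) ->
  respath P Q n B -> forall i, (i + n < r.+1)%N -> coh_zero R B i.+1.
Proof.
move=> hP hQ; elim: n B => [|n IH] B /=; first by move=> QB i; rewrite addn0; apply: hQ.
move=> [A [E [s PE hA]]] i; rewrite addnS ltnS => hi.
apply: (coh_step_quo s); first by apply: hP => //; apply: leq_ltn_trans hi; apply: leq_addr.
exact: IH.
Qed.

Fixpoint injpath (n : nat) (A : rmod G) : Prop :=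
  if n is m.+1 then exists E B, [/\ ses A E B, injective_mod E & injpath m B]
  else injective_mod A.

Lemma injpath_coh M (R : proj_resolution M) n A i :
  injpath n A -> (n <= i)%N -> coh_zero R A i.+1.
Proof.
elim: n A i => [|n IH] A i /=; first by move=> iA _; apply: coh_injective.
move=> [E [B [s iE hB]]]; case: i => // i hi.
by apply: coh_step_sub s _ _; [apply: IH | apply: coh_injective].
Qed.

Definition rzero_resolution A (A0 : zero_mod A) : proj_resolution A.
Proof.
refine (@ProjResolution k G A (fun=> A) (fun=> rmod_id A) (rmod_id A) _ _ _ _).
- by move=> _; apply: zero_mod_projective.
- by move=> y; exists y; rewrite rmod_idE.
- by move=> y; split=> _; rewrite ?rmod_idE // (A0 y); exists 0; rewrite linear0.
- by move=> i y; split=> _; rewrite ?rmod_idE // (A0 y); exists 0; rewrite linear0.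
Defined.

Lemma respath_pd n M : respath (@projective k G) (@zero_mod k G) n M ->
  exists R : proj_resolution M, forall i, (n <= i)%N -> zero_mod (res R i).
Proof.
elim: n M => [|n IH] M /=.
  by move=> M0; exists (rzero_resolution M0).
move=> [A [E [[u [p [ui ps up]]] pE /IH [R hR]]]].
by exists (splice ui ps up pE R) => -[|i] //; apply: hR.
Qed.

(** Length n + 1 matches projective dimension n, because the terms are numbered 0 to n. *)
Lemma respath_pd_le n M :
  respath (@projective k G) (@zero_mod k G) n.+1 M -> pd_le M n.
Proof. by move=> /respath_pd [R hR]; exists R. Qed.

Lemma shift_resolution M (R : proj_resolution M) : exists A (R' : proj_resolution A),
  ses A (res R 0) M /\ res R' = (fun j => res R j.+1).
Proof.
have [A [u [ui uk]]] := ker_exists (res_aug R).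
have [|g gE] := factor_inj (f := res_d R 0) ui.
  by move=> x; apply/uk; rewrite res_augd.
have gs : surjective_hom g.
  move=> y; have /(res_exact0 (p := R)) [x xE] : res_aug R (u y) = 0.
    by apply/uk; exists y.
  by exists x; apply: ui; rewrite gE.
have e0 : exact_at (res_d R 1) g.
  move=> y; rewrite -(@res_exact _ _ _ R 0 y) -gE.
  by split=> [->|]; rewrite ?linear0 // -(linear0 u) => /ui.
pose R' := @ProjResolution k G A (fun j => res R j.+1) (fun j => res_d R j.+1) g
  (fun j => @res_proj _ _ _ R j.+1) gs e0 (fun j => @res_exact _ _ _ R j.+1).
by exists A, R'; split=> //; exists u, (res_aug R); split=> //; apply: res_surj.
Qed.

Lemma pd_le_respath n M :
  pd_le M n -> respath (@projective k G) (@zero_mod k G) n.+1 M.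
Proof.
move=> [R hR].
have {hR} hR i : (n.+1 <= i)%N -> zero_mod (res R i) by apply: hR.
elim: {n}n.+1 M R hR => [|n IH] M R hR /=.
  by move=> x; have [y <-] := res_surj R x; rewrite (hR 0 _ y) // linear0.
have [A [R' [s RE]]] := shift_resolution R.
exists A, (res R 0); split=> //; first exact: res_proj.
by apply: (IH _ R') => i hi; rewrite RE; apply: hR.
Qed.

(** Syzygies are iterated with chosen covers; [True] only turns inhabitation of the type into a
    proposition. *)
Lemma resolution_exists (ep : enough_projectives) M :
  exists R : proj_resolution M, True.
Proof.
have H (N : rmod G) :
    exists t : {P : rmod G & {K : rmod G & (rmod_hom P N * rmod_hom K P)%type}},
    [/\ projective (projT1 t), surjective_hom (projT2 (projT2 t)).1,
        injective (projT2 (projT2 t)).2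
      & exact_at (projT2 (projT2 t)).2 (projT2 (projT2 t)).1].
  have [P [p [pP ps]]] := ep N; have [K [i [ii ip]]] := ker_exists p.
  by exists (existT _ P (existT _ K (p, i))).
pose t N := sval (cid (H N)); pose tP N := svalP (cid (H N)).
pose syz j := iter j (fun N => projT1 (projT2 (t N))) M.
pose p j : rmod_hom (projT1 (t (syz j))) (syz j) := (projT2 (projT2 (t (syz j)))).1.
pose i j : rmod_hom (syz j.+1) (projT1 (t (syz j))) := (projT2 (projT2 (t (syz j)))).2.
have pP j : projective (projT1 (t (syz j))) by case: (tP (syz j)).
have ps j : surjective_hom (p j) by case: (tP (syz j)).
have ii j : injective (i j) by case: (tP (syz j)).
have ip j : exact_at (i j) (p j) by case: (tP (syz j)).
have e0 j : exact_at (rmod_comp (i j) (p j.+1)) (p j).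
  move=> y; rewrite (ip j y); split=> -[x <-].
    by have [z <-] := ps j.+1 x; exists z; rewrite rmod_compE.
  by exists (p j.+1 x); rewrite rmod_compE.
have e1 j : exact_at (rmod_comp (i j.+1) (p j.+2)) (rmod_comp (i j) (p j.+1)).
  move=> y; rewrite -(e0 j.+1 y) rmod_compE.
  by split=> [|->]; rewrite ?linear0 // -(linear0 (i j)) => /ii.
by exists (@ProjResolution k G M (fun j => projT1 (t (syz j))) _ (p 0) pP (ps 0) (e0 0) e1).
Qed.

Lemma respath1_projective A :
  respath (@projective k G) (@zero_mod k G) 1 A <-> projective A.
Proof.
split=> [[A' [E [[u [p [ui ps up]]] pE A'0]]]|pA].
  apply: (retract_projective pE); apply: rmod_iso_retract; apply: rmod_iso_sym.
  apply: (@rmod_iso_bij _ _ _ _ p) ps => x y e.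
  apply/eqP; rewrite -subr_eq0; apply/eqP.
  have /up [z <-] : p (x - y) = 0 by rewrite linearB /= e subrr.
  by rewrite (A'0 z) linear0.
have [u uE] := rmod_hom0 (rzero G) A.
exists (rzero G), A; split=> //; last exact: rzero_zero.
exists u, (rmod_id A); split=> [x y _|y|y]; first by rewrite (rzero_zero x) (rzero_zero y).
  by exists y; rewrite rmod_idE.
by rewrite rmod_idE; split=> [->|[x <-]]; [exists 0; rewrite uE | rewrite uE].
Qed.

(** For n = 0 the last syzygy A is projective, so Ext^1(M, A) = 0 splits the sequence and M is
    projective. Otherwise pass to the first syzygy, where the hypothesis drops by one degree through
    [splice]. *)
Lemma respath_shrink (ep : enough_projectives) M n :
  (forall (R : proj_resolution M) P, projective P -> coh_zero R P n.+1) ->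
  respath (@projective k G) (@zero_mod k G) n.+2 M ->
  respath (@projective k G) (@zero_mod k G) n.+1 M.
Proof.
elim: n M => [|n IH] M hM.
  move=> [A [E [s pE /respath1_projective pA]]].
  have [R _] := resolution_exists ep M.
  apply/respath1_projective; apply: (retract_projective pE).
  by have [_] := ses_split_retract (hM R A pA) s.
move=> [A [E [s pE hA]]]; exists A, E; split=> //; apply: IH hA => R P pP.
have [u [p [ui ps up]]] := s.
exact: (hM (splice ui ps up pE R) P pP).
Qed.
End Ext.

(** * Injective dimension and global dimension *)

Section Dimension.
Variables (k : fieldType) (G : fdalg k).
Implicit Types M N P A B E : rmod G.

Definition rzero_coresolution A (A0 : zero_mod A) : inj_coresolution A.
Proof.
refine (@InjCoresolution k G A (fun=> A) (fun=> rmod_id A) (rmod_id A) _ _ _ _).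
- move=> _; apply: retract_injective (@rzero_injective k G) _.
  exact/rmod_iso_retract/zero_mod_iso.
- by move=> x y _; rewrite (A0 x) (A0 y).
- by move=> y; split=> _; rewrite ?rmod_idE // (A0 y); exists 0; rewrite linear0.
- by move=> i y; split=> _; rewrite ?rmod_idE // (A0 y); exists 0; rewrite linear0.
Defined.

Section Cosplice.
Variables (A J B : rmod G) (i : rmod_hom A J) (p : rmod_hom J B).
Hypotheses (ii : injective i) (ps : surjective_hom p) (ip : exact_at i p).
Hypothesis iJ : injective_mod J.
Variable R : inj_coresolution B.

Definition cospl_res (j : nat) : rmod G := if j is j'.+1 then cores R j' else J.
Definition cospl_d (j : nat) : rmod_hom (cospl_res j) (cospl_res j.+1) :=
  match j with
  | 0 => rmod_comp (cores_aug R) p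
  | j'.+1 => cores_d R j'
  end.

Fact cospl_inj j : injective_mod (cospl_res j).
Proof. by case: j => [|j] //; apply: cores_inj. Qed.

Fact cospl_exact0 : exact_at i (cospl_d 0).
Proof.
move=> y; rewrite [cospl_d 0 y]rmod_compE -(ip y); split=> [|->]; last by rewrite linear0.
by rewrite -(linear0 (cores_aug R)) => /(@cores_mono _ _ _ R).
Qed.

Fact cospl_exact j : exact_at (cospl_d j) (cospl_d j.+1).
Proof.
case: j => [|j]; last exact: cores_exact.
move=> y; rewrite [X in X <-> _](@cores_exact0 _ _ _ R y); split=> -[x <-].
  by have [z <-] := ps x; exists z; rewrite /= -rmod_compE.
by exists (p x); rewrite [cospl_d 0 x]rmod_compE.
Qed.

Definition cosplice : inj_coresolution A :=
  @InjCoresolution k G A cospl_res cospl_d i cospl_inj ii cospl_exact0 cospl_exact.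
End Cosplice.

Lemma injpath_id_le n A : injpath n A -> id_le A n.
Proof.
elim: n A => [|n IH] A /=.
  move=> iA; have R : inj_coresolution (rzero G) by apply/rzero_coresolution/rzero_zero.
  have [q qE] := rmod_hom0 A (rzero G).
  have qs : surjective_hom q by move=> y; exists 0; rewrite qE (rzero_zero y).
  have ie : exact_at (rmod_id A) q.
    by move=> y; rewrite qE; split=> // _; exists y; rewrite rmod_idE.
  have ii : injective (rmod_id A) by move=> x y; rewrite !rmod_idE.
  exists (cosplice ii qs ie iA (rzero_coresolution (@rzero_zero k G))) => -[|i] // _.
  exact: rzero_zero.
move=> [E [B [[u [p [ui ps up]]] iE /IH [R hR]]]].
by exists (cosplice ui ps up iE R) => -[|i] // hi; apply: hR.
Qed.

Lemma gldim_le_injpath (ep : @enough_projectives k G) d :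
  (forall P, projective P -> injpath d P) ->
  (exists n, gldim_le G n) -> gldim_le G d.
Proof.
move=> hd [n hn] M; apply: respath_pd_le.
have [R hR] := hn M.
(* The bound is padded to d + n so that [respath_shrink] can remove one term at a time; the degrees
   it needs are all above d, where Ext into projectives vanishes. *)
have : pd_le M (d + n).
  by exists R => i hi; apply: hR; apply: leq_ltn_trans hi; apply: leq_addl.
move/pd_le_respath; elim: {hn R hR} n => [|n IH]; first by rewrite addn0.
rewrite addnS => h; apply: IH; apply: respath_shrink h => // R P /hd hP.
by apply: injpath_coh hP _; apply: leq_addr.
Qed.
End Dimension.

(** * Equivalences of categories and chains *)

Lemma automorphism_equivalence (B : category) (F : functor B B) :
  is_automorphism F -> is_equivalence F.
Proof.
have natid (H : functor B B) : H = functor_id B -> naturally_isomorphic H (functor_id B).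
  move=> ->; exists (fun X => idm X); split=> [X|X Y f]; last by rewrite comp1m compm1.
  by exists (idm X); rewrite comp1m.
by move=> [H [e e']]; exists H; split; apply: natid.
Qed.

Section Equivalence.
Variables (A B : category) (F : functor A B).

Lemma nat_iso_faithful (H : functor A A) : naturally_isomorphic H (functor_id A) ->
  forall X Y (f g : hom X Y), fmap H f = fmap H g -> f = g.
Proof.
move=> [eta [ei en]] X Y f g e.
have [th [h1 h2]] := ei X.
have nE u : comp (u : hom X Y) (eta X) = comp (eta Y) (fmap H u) by apply: (en X Y u).
have : comp (comp f (eta X)) th = comp (comp g (eta X)) th by rewrite !nE e.
by rewrite -!compmA h2 !compm1.
Qed.

Lemma equivalence_faithful : is_equivalence F ->
  forall X Y (f g : hom X Y), fmap F f = fmap F g -> f = g.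
Proof.
move=> [H [n _]] X Y f g e.
by apply: (nat_iso_faithful n); rewrite /= e.
Qed.
End Equivalence.

Lemma nat_iso_full (A : category) (H : functor A A) :
  naturally_isomorphic H (functor_id A) ->
  forall X Y (f : hom (H X) (H Y)), exists g : hom X Y, fmap H g = f.
Proof.
move=> n; have [eta [ei en]] := n => X Y f.
have [th [h1 h2]] := ei X; have [th' [h1' h2']] := ei Y.
pose g : hom X Y := comp (comp (eta Y) f) th.
exists g; have e : comp g (eta X) = comp (eta Y) (fmap H g) by apply: (en X Y g).
have : comp th' (comp (eta Y) (fmap H g)) = comp th' (comp (eta Y) f).
  by rewrite -e /g -!compmA h1 compm1.
by rewrite !compmA h1' !comp1m.
Qed.

Lemma equivalence_full (A B : category) (F : functor A B) : is_equivalence F ->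
  forall X Y (f : hom (F X) (F Y)), exists g : hom X Y, fmap F g = f.
Proof.
move=> [H [n m]] X Y f.
have [g gE] := nat_iso_full n (fmap H f : hom (functor_comp H F X) (functor_comp H F Y)).
exists g; have /= := @nat_iso_faithful B _ m _ _ (fmap F g) f.
by apply; congr (fmap F _); apply: gE.
Qed.

Lemma equivalence_ess_surj (A B : category) (F : functor A B) : is_equivalence F ->
  forall Y : B, exists X : A, isomorphic (F X) Y.
Proof. by move=> [H [_ [th [thi _]]]] Y; exists (H Y), (th Y); apply: thi. Qed.

Lemma full_faithful_equivalence (A B : category) (F : functor A B) :
  (forall X Y (f g : hom X Y), fmap F f = fmap F g -> f = g) ->
  (forall X Y (f : hom (F X) (F Y)), exists g : hom X Y, fmap F g = f) ->
  (forall Y : B, exists X : A, isomorphic (F X) Y) -> is_equivalence F.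
Proof.
move=> ff fu es.
have H Y : exists t : {X : A & (hom (F X) Y * hom Y (F X))%type},
    comp (projT2 t).2 (projT2 t).1 = idm _ /\ comp (projT2 t).1 (projT2 t).2 = idm _.
  by have [X [f [g [e e']]]] := es Y; exists (existT _ X (f, g)).
pose t Y := sval (cid (H Y)); pose tP Y := svalP (cid (H Y)).
pose o Y := projT1 (t Y).
pose u Y : hom (F (o Y)) Y := (projT2 (t Y)).1.
pose v Y : hom Y (F (o Y)) := (projT2 (t Y)).2.
have vu Y : comp (v Y) (u Y) = idm _ := (tP Y).1.
have uv Y : comp (u Y) (v Y) = idm _ := (tP Y).2.
pose m Y Y' (f : hom Y Y') : hom (o Y) (o Y') := sval (cid (fu _ _ (comp (comp (v Y') f) (u Y)))).
have mE Y Y' (f : hom Y Y') : fmap F (m _ _ f) = comp (comp (v Y') f) (u Y).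
  exact: (svalP (cid (fu _ _ (comp (comp (v Y') f) (u Y))))).
have m1 Y : m _ _ (idm Y) = idm (o Y).
  by apply: ff; rewrite mE compm1 vu fmap1.
have mM Y Y' Y'' (g : hom Y' Y'') (f : hom Y Y') : m _ _ (comp g f) = comp (m _ _ g) (m _ _ f).
  apply: ff; rewrite fmapM !mE -!compmA; congr (comp _ (comp _ _)).
  by rewrite [RHS]compmA uv comp1m.
exists (@Functor B A o m m1 mM); split.
  pose w X : hom (o (F X)) X := sval (cid (fu _ _ (u (F X)))).
  have wE X : fmap F (w X) = u (F X) by exact: (svalP (cid (fu _ _ (u (F X))))).
  pose w' X : hom X (o (F X)) := sval (cid (fu _ _ (v (F X)))).
  have w'E X : fmap F (w' X) = v (F X) by exact: (svalP (cid (fu _ _ (v (F X))))).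
  have w'w X : comp (w' X) (w X) = idm (o (F X)).
    by apply: ff; rewrite fmapM wE w'E fmap1 vu.
  have ww' X : comp (w X) (w' X) = idm X.
    by apply: ff; rewrite fmapM wE w'E fmap1 uv.
  exists w; split=> [X|X Y f]; first by exists (w' X); split; [apply: w'w | apply: ww'].
  by apply: ff; rewrite /= !fmapM /= mE !wE !compmA uv comp1m.
exists u; split=> [X|X Y f]; first by exists (v X); split; [apply: vu | apply: uv].
by rewrite /= mE !compmA uv comp1m.
Qed.

(** * Chains of morphisms and weak exactness *)

Section Chain.
Variables (k : fieldType) (C : lincat k).

Lemma scale_compr (X Y Z : C) c (g : Y ~> Z) (f : X ~> Y) : g ∘ (c *: f) = c *: (g ∘ f).
Proof. by have := lcomp_linearr g c f 0; rewrite lcompm0 !addr0. Qed.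

Lemma scale_compl (X Y Z : C) c (g : Y ~> Z) (f : X ~> Y) : (c *: g) ∘ f = c *: (g ∘ f).
Proof. by have := lcomp_linearl f c g 0; rewrite lcomp0m !addr0. Qed.

(** The arrow [f] is a weak kernel of [g], and [g] is a weak cokernel of [f]. *)
Definition wexact (X Y Z : C) (f : X ~> Y) (g : Y ~> Z) : Prop :=
  (forall W (u : W ~> Y), g ∘ u = 0 <-> exists v, u = f ∘ v) /\
  (forall W (u : Y ~> W), u ∘ f = 0 <-> exists v, u = v ∘ g).

Section Adjacent.
Variable Q : forall X Y Z : C, (X ~> Y) -> (Y ~> Z) -> Prop.

(* [Q] holds for all pairs of consecutive arrows of the chain [f, c]. *)
Fixpoint cadj n V X Z : (V ~> X) -> chain n X Z -> Prop :=
  if n is m.+1 then fun f c => Q f (chd c) /\ cadj (chd c) (ctl c)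
  else fun f c => Q f c.

(** Only the first [j] pairs are constrained, since exactness along an angle is gained one pair per
    rotation. *)
Fixpoint cadjn j n V X Z : (V ~> X) -> chain n X Z -> Prop :=
  if j is j'.+1 then
    if n is m.+1 then fun f c => Q f (chd c) /\ cadjn j' (chd c) (ctl c)
    else fun f c => Q f c
  else fun _ _ => True.

Lemma cadjn_cadj n V X Z (f : V ~> X) (c : chain n X Z) : cadjn n.+1 f c -> cadj f c.
Proof.
elim: n V X f c => [|n IH] V X f c //= [h1 h2]; split=> //; exact: IH.
Qed.

Lemma cadjn_crcons j n V X Z W (f : V ~> X) (c : chain n X Z) (h : Z ~> W) :
  (j <= n.+1)%N -> cadjn j f (crcons c h) -> cadjn j f c.
Proof.
elim: n V X f c j => [|n IH] V X f c [|j] //=; first by move=> _ [].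
by rewrite ltnS => hj [h1 h2]; split=> //; apply: IH h2.
Qed.

Lemma cadj_crcons n V X Z W (f : V ~> X) (c : chain n X Z) (h : Z ~> W) :
  cadj f (crcons c h) -> cadj f c.
Proof.
elim: n V X f c => [|n IH] V X f c /= [h1 h2] //; split=> //; exact: IH h2.
Qed.

Lemma cadj_crcons_last n V X Y Z W (f : V ~> X) (c : chain n X Y) (g : Y ~> Z)
    (h : Z ~> W) : cadj f (crcons (crcons c g) h) -> Q g h.
Proof.
elim: n V X f c => [|n IH] V X f c /=; first by move=> [_ []].
by move=> [_]; apply: IH.
Qed.

(** Reaches the end T_1 -> T_0 -> X of an angle of arbitrary length. *)
Lemma cadj_last (P : C -> Prop) n V X Z W (f : V ~> X) (c : chain n X Z) (h : Z ~> W) :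
  cadj f (crcons c h) -> P V -> P X -> call P c ->
  exists V' X' (f' : V' ~> X') (g' : X' ~> Z), [/\ P V', P X', Q f' g' & Q g' h].
Proof.
elim: n V X f c => [|n IH] V X f c /= [h1 h2]; first by exists V, X, f, c.
by move=> PV PX [PY Pc]; apply: (IH _ _ (chd c) (ctl c)).
Qed.
End Adjacent.

Lemma chmor_last n (X Z W X' Z' W' : C) (c : chain n X Z) (h : Z ~> W)
    (c' : chain n X' Z') (h' : Z' ~> W') (phi : X ~> X') (psi : W ~> W')
    (p : chmor (crcons c h) (crcons c' h')) :
  chcomm phi p psi -> exists q : Z ~> Z', psi ∘ h = h' ∘ q.
Proof.
elim: n X X' c c' phi p => [|n IH] X X' c c' phi p /=.
  by case: p => q t /= [_ e]; exists q.
by move=> [_ e]; apply: IH e.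
Qed.

Lemma callT (P : C -> Prop) n (X Z : C) (c : chain n X Z) : (forall Y, P Y) -> call P c.
Proof. by move=> hP; elim: n X c => [|n IH] X c //=; split. Qed.

Lemma sub_call (P Q : C -> Prop) n (X Z : C) (c : chain n X Z) :
  (forall Y, P Y -> Q Y) -> call P c -> call Q c.
Proof.
by move=> PQ; elim: n X c => [|n IH] X c //= [PY Pc]; split; [apply: PQ | apply: IH].
Qed.

Definition zero_ob (X : C) := lid X = 0.

Lemma zero_ob_to (X Y : C) (f : X ~> Y) : zero_ob Y -> f = 0.
Proof. by move=> e; rewrite -(lcomp1m f) e lcomp0m. Qed.

Lemma zero_ob_from (X Y : C) (f : X ~> Y) : zero_ob X -> f = 0.
Proof. by move=> e; rewrite -(lcompm1 f) e lcompm0. Qed.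

Lemma zero_ob_iso (X Y : C) : zero_ob X -> zero_ob Y ->
  is_iso (C := ucat C) (0 : X ~> Y).
Proof.
by move=> x0 y0; exists 0; split; rewrite /= lcompm0; [rewrite x0 | rewrite y0].
Qed.

Lemma zero_chain_mor n (X Z X' Z' : C) (c : chain n X Z) (c' : chain n X' Z') phi psi :
  zero_ob X -> zero_ob X' -> call zero_ob c -> call zero_ob c' ->
  exists p : chmor c c', chiso p /\ chcomm phi p psi.
Proof.
elim: n X X' c c' phi => [|n IH] X X' c c' phi x0 x0' /=.
  by move=> _ _; exists tt; split=> //; rewrite [LHS]zero_ob_from // [RHS]zero_ob_from.
move=> [y0 hc] [y0' hc'].
have [p [pi pc]] := IH _ _ (ctl c) (ctl c') 0 y0 y0' hc hc'.
exists (0, p); split; split=> //; first exact: zero_ob_iso.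
by rewrite /= [LHS]zero_ob_from // [RHS]zero_ob_from.
Qed.

Lemma call_crcons (P : C -> Prop) n X Z W (c : chain n X Z) (h : Z ~> W) :
  call P c -> P Z -> call P (crcons c h).
Proof.
elim: n X c => [|n IH] X c //= [h1 h2] PZ; split=> //; exact: IH.
Qed.

End Chain.

Lemma call_czero (k : fieldType) (C : addcat k) n (X Z : C) : call (@zero_ob k C) (czero n X Z).
Proof. by elim: n X => [|n IH] X //=; split; [apply: zobP | apply: IH]. Qed.

(** * Exactness of angles *)

(** The rotation of [cotrivial_seq] ends in the suspension of [zob C], a zero object but not [zob C]
    itself; this isomorphism absorbs the difference. *)
Lemma czero_crcons_iso (k : fieldType) (C : addcat k) n (W Z0 Z : C) (h : Z0 ~> Z) :
  zero_ob Z0 -> exists p : chmor (czero n.+1 W Z) (crcons (czero n W Z0) h),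
    chiso p /\ chcomm (lid W) p (lid Z).
Proof.
move=> z0; case: n => [|n].
  exists (0, tt); split; split=> //=; first exact: zero_ob_iso (zobP C) z0.
    by rewrite !lcomp0m.
  by rewrite lcompm0 lcompm0.
have [p [pi pc]] := @zero_chain_mor k C n.+1 (zob C) Z (zob C) Z
  (czero n.+1 (zob C) Z) (crcons (czero n (zob C) Z0) h)
  0 (lid Z) (zobP C) (zobP C) (call_czero _ _ _) (call_crcons _ (call_czero _ _ _) z0).
exists (0, p); split; split=> //=; first by apply: zero_ob_iso; apply: zobP.
by rewrite !lcomp0m.
Qed.

Section AngleExact.
Variables (k : fieldType) (C : addcat k) (d : nat) (A : angulated C d.+1).
Implicit Types X Y Z W : C.
Local Notation sg := (smap (susp A)).
Local Notation so := (sobj (susp A)).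

Lemma sg1 X : sg (lid X) = lid (so X).
Proof. exact: (fmap1 (susp A)). Qed.

Lemma sgM X Y Z (g : Y ~> Z) (f : X ~> Y) : sg (g ∘ f) = sg g ∘ sg f.
Proof. exact: (fmapM (susp A)). Qed.

Lemma sgP X Y : linear (@smap k C (susp A) X Y).
Proof. exact: susp_linear. Qed.

Lemma sgD X Y (f g : X ~> Y) : sg (f + g) = sg f + sg g.
Proof. by have := sgP 1 f g; rewrite !scale1r. Qed.

Lemma sg0 X Y : sg (0 : X ~> Y) = 0.
Proof. by apply: (addrI (sg (0 : X ~> Y))); rewrite -sgD !addr0. Qed.

Lemma sg_inj X Y (f g : X ~> Y) : sg f = sg g -> f = g.
Proof.
exact: (equivalence_faithful (automorphism_equivalence (susp_auto A))).
Qed.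

Lemma sg_full X Y (f : so X ~> so Y) : exists g, sg g = f.
Proof.
exact: (equivalence_full (automorphism_equivalence (susp_auto A)) f).
Qed.

Lemma sg_ess_surj Y : exists X (f : so X ~> Y) (g : Y ~> so X),
  g ∘ f = lid (so X) /\ f ∘ g = lid Y.
Proof.
exact: (equivalence_ess_surj (automorphism_equivalence (susp_auto A)) Y).
Qed.

Lemma sg_zero_ob X : zero_ob X -> zero_ob (so X).
Proof. by rewrite /zero_ob -sg1 => ->; rewrite sg0. Qed.

(** The rotation sign (-1)^n with n = d + 3, because the d of the theorem is written [d.+1] here. *)
Definition csgn : k := (-1) ^+ d.+3.

Lemma csgn_neq0 : csgn != 0.
Proof. by rewrite expf_neq0 // oppr_eq0 oner_neq0. Qed.

(* The angle 0 -> W -> W -> 0 -> ... -> 0: its rotation is a trivial sequence. *)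
Definition cotrivial_seq W : nseq (susp A) d.+1 :=
  @NSeq k C (susp A) d.+1 (zob C)
    (ccons (0 : zob C ~> W) (ccons (lid W) (czero d W (so (zob C))))).

Lemma cotrivial_angle W : angle (a := A) (cotrivial_seq W).
Proof.
apply/(@angle_F2 _ _ _ A); apply: angle_iso (@angle_F1b _ _ _ A W).
have [p [pi pc]] := czero_crcons_iso d W (csgn *: sg (0 : zob C ~> W)) (sg_zero_ob (zobP C)).
exists (lid W), (lid W, p); split=> /=.
- by exists (lid W); rewrite /= lcomp1m.
- by split=> //; exists (lid W); rewrite /= lcomp1m.
- by split=> //; rewrite sg1.
Qed.

Lemma angle_wexact (s : nseq (susp A) d.+1) :
  angle (a := A) s -> wexact (chd (schain s)) (chd (ctl (schain s))).
Proof.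
move=> sA; set a1 := chd _; set a2 := chd _.
have a21 : a2 ∘ a1 = 0.
  have [|p] := angle_F3 (@angle_F1b _ _ _ A (sfst s)) sA (phi1 := lid _) (phi2 := a1).
    by rewrite /= !lcompm1.
  by case: p => p1 p /= [e _]; rewrite -e lcompm0.
split=> W u; split.
- move=> e.
  (* Complete (u, 0) from the rotated trivial angle of W to the rotation of [s]. The last component
     is a map Sigma W -> Sigma X_1, hence some Sigma v; the two rotation signs cancel and leave u =
     a1 v. *)
  have tA : angle (a := A) (rotation (trivial_seq (susp A) d.+1 W)).
    exact: (@angle_F2 _ _ _ A _).1 (@angle_F1b _ _ _ A W).
  have [|p pE] := angle_F3 tA ((@angle_F2 _ _ _ A s).1 sA) (phi1 := u) (phi2 := 0).
    by rewrite /= lcomp0m; symmetry.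
  have [q] := chmor_last pE; rewrite /= sg1 => qE.
  have [v vE] := sg_full q; exists v; apply: sg_inj.
  rewrite sgM vE; apply: (scalerI csgn_neq0).
  by move: qE; rewrite scale_compr lcompm1 scale_compl.
- by move=> [v ->]; rewrite lcompA a21 lcomp0m.
- move=> e; have [|p] := angle_F3 sA (cotrivial_angle W) (phi1 := 0) (phi2 := u).
    by rewrite /= lcomp0m.
  by case: p => p1 p /= [h _]; exists p1; rewrite h lcomp1m.
- by move=> [v ->]; rewrite -lcompA a21 lcompm0.
Qed.

(* The (j+1)-st pair of arrows of an angle is the j-th pair of its rotation. *)
Lemma angle_cadjn j (s : nseq (susp A) d.+1) : (j <= d.+2)%N ->
  angle (a := A) s -> cadjn (@wexact k C) j (chd (schain s)) (ctl (schain s)).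
Proof.
elim: j s => [|j IH] s //= hj sA; split; first exact: angle_wexact.
have := IH _ (ltnW hj) ((@angle_F2 _ _ _ A s).1 sA); apply: cadjn_crcons.
by rewrite -ltnS.
Qed.

(** Appending the rotated arrow also records exactness at the last object of the angle and at Sigma
    X. *)
Lemma angle_cadj (X Y : C) (f : X ~> Y) (c : chain d.+1 Y (so X)) :
  angle (a := A) (@NSeq k C (susp A) d.+1 X (ccons f c)) ->
  cadj (@wexact k C) f (crcons c (csgn *: sg f)).
Proof.
move=> sA; split; first exact: (angle_wexact sA).
have := (@angle_F2 _ _ _ A _).1 sA => rA.
exact/cadjn_cadj/(angle_cadjn _ rA).
Qed.

Lemma angle_exists (X Y : C) (f : X ~> Y) :
  exists Z (g : Y ~> Z) (c : chain d Z (so X)),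
    wexact f g /\ cadj (@wexact k C) g (crcons c (csgn *: sg f)).
Proof.
have [c /angle_cadj [h1 h2]] := @angle_F1c _ _ _ A _ _ f.
by exists (cob c), (chd c), (ctl c).
Qed.
End AngleExact.

(** * Lifting idempotents *)

Section Idempotent.
Variables (k : fieldType) (C : lincat k) (X : C) (e : X ~> X).
Implicit Types p q : {poly k}.

Fixpoint epow (n : nat) : X ~> X := if n is m.+1 then e ∘ epow m else lid X.

Lemma epowSr n : epow n.+1 = epow n ∘ e.
Proof.
by elim: n => [|n IH] /=; rewrite ?lcomp1m ?lcompm1 // -lcompA -IH.
Qed.

(** The value p(e) of the algebra map from k[x] to End X that sends x to e. *)
Definition pev (p : {poly k}) : X ~> X := \sum_(i < size p) p`_i *: epow i.

Lemma pevE n p : (size p <= n)%N -> pev p = \sum_(i < n) p`_i *: epow i.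
Proof.
move=> pn; rewrite /pev (big_ord_widen n (fun i => p`_i *: epow i) pn) big_mkcond.
by apply: eq_bigr => i _; case: ltnP => // h; rewrite nth_default ?scale0r.
Qed.

Lemma pevD p q : pev (p + q) = pev p + pev q.
Proof.
have h := size_polyD p q.
rewrite (pevE h) (pevE (leq_maxl _ _ : (size p <= maxn (size p) (size q))%N)).
rewrite (pevE (leq_maxr _ _ : (size q <= maxn (size p) (size q))%N)).
by rewrite -big_split; apply: eq_bigr => i _; rewrite coefD scalerDl.
Qed.

Lemma pevZ c p : pev (c *: p) = c *: pev p.
Proof.
rewrite (pevE (size_scale_leq c p)) /pev scaler_sumr.
by apply: eq_bigr => i _; rewrite coefZ scalerA.
Qed.

Lemma comp_suml Y (I : Type) (r : seq I) (F : I -> (X ~> Y)) (g : X ~> X) :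
  (\sum_(i <- r) F i) ∘ g = \sum_(i <- r) F i ∘ g.
Proof.
by elim/big_rec2: _ => [|i y z _ <-]; rewrite ?lcomp0m ?lcompDl.
Qed.

Lemma comp_sumr Y (I : Type) (r : seq I) (F : I -> (X ~> X)) (g : X ~> Y) :
  g ∘ (\sum_(i <- r) F i) = \sum_(i <- r) g ∘ F i.
Proof.
by elim/big_rec2: _ => [|i y z _ <-]; rewrite ?lcompm0 ?lcompDr.
Qed.

Lemma pevMX p : pev (p * 'X) = e ∘ pev p.
Proof.
have h : (size (p * 'X)%R <= (size p).+1)%N.
  by apply: leq_trans (size_polyMleq _ _) _; rewrite size_polyX addn2.
rewrite (pevE h) big_ord_recl coefMX eqxx scale0r add0r comp_sumr.
by apply: eq_bigr => i _; rewrite lift0 coefMX /= scale_compr.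
Qed.

Lemma pev_comm p : e ∘ pev p = pev p ∘ e.
Proof.
rewrite /pev comp_suml comp_sumr; apply: eq_bigr => i _.
by rewrite scale_compr scale_compl -epowSr.
Qed.

Lemma pevM p q : pev (p * q) = pev p ∘ pev q.
Proof.
elim/poly_ind: p q => [|p c IH] q.
  by rewrite mul0r /pev size_poly0 !big_ord0 lcomp0m.
have pevC : pev c%:P = c *: lid X.
  by rewrite (pevE (size_polyC_leq1 c)) big_ord1 coefC.
rewrite mulrDl -mulrA (mulrC 'X) pevD IH !pevMX mul_polyC pevZ pevD lcompDl.
by rewrite pevMX pevC scale_compl lcomp1m lcompA pev_comm.
Qed.

(** The first dim End X + 1 powers of [e] are linearly dependent; a row in the kernel of their
    coordinate matrix supplies the coefficients. *)
Lemma annihilating_poly : exists2 p, p != 0 & pev p = 0.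
Proof.
pose b := vbasis {:X ~> X}; have bb : basis_of {:X ~> X} b := vbasisP _.
pose M := \matrix_(i < (\dim {:X ~> X}).+1, j < \dim {:X ~> X}) coord b j (epow i).
have : kermx M != 0.
  rewrite -mxrank_eq0 mxrank_ker subn_eq0 -ltnNge ltnS; exact: rank_leq_col.
set u := nz_row (kermx M); rewrite -nz_row_eq0 -/u => u0.
have uM : u *m M = 0 by apply/sub_kermxP/nz_row_sub.
exists (rVpoly u).
  by apply: contraNneq u0 => e0; rewrite -(rVpolyK u) e0 linear0.
rewrite (pevE (size_poly _ _)) [LHS](coord_basis bb) ?memvf // big1 // => j _.
suff -> : coord b j (\sum_(i < (\dim {:X ~> X}).+1) (rVpoly u)`_i *: epow i) = (u *m M) 0 j.
  by rewrite uM mxE scale0r.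
rewrite linear_sum mxE; apply: eq_bigr => i _.
by rewrite linearZ /= !mxE coef_rVpoly_ord.
Qed.

(* Write an annihilating polynomial as q X^a (X - 1)^b with q(1) <> 0 and take  *)
(* the idempotent pi(e), where pi is congruent to 0 modulo q X^(a+1) and to 1   *)
(* modulo (X - 1)^(b+1); then pi - X is divisible by X^2 - X.                   *)
Lemma idempotent_lifting (J : ideal C) : imem J (e ∘ e - e) ->
  exists f : X ~> X, f ∘ f = f /\ imem J (f - e).
Proof.
move=> He; have [p p0 pe] := annihilating_poly.
have [a [q1]] := multiplicity_XsubC p 0; rewrite p0 /= => q1r pE.
have [b [q2]] := multiplicity_XsubC q1 1.
have -> /= : q1 != 0 by apply: contraNneq p0 => e0; rewrite pE e0 mul0r.
move=> q2r q1E.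
pose u := q2 * ('X - 0%:P) ^+ a.+1; pose v := ('X - 1%:P : {poly k}) ^+ b.+1.
have /Bezout_eq1_coprimepP[[r s] /= rs] : coprimep u v.
  apply: coprimep_expr; rewrite coprimep_XsubC /u rootM negb_or q2r.
  by rewrite rootE horner_exp hornerXsubC subr0 expr1n oner_neq0.
pose w := r * u.
have w0 : w.[0] = 0.
  by rewrite /w /u !hornerM horner_exp hornerXsubC subrr expr0n !mulr0.
have w1 : w.[1] = 1.
  have := congr1 (horner^~ 1) rs; rewrite hornerD -/w [X in _ + X]hornerM.
  by rewrite /v horner_exp hornerXsubC subrr expr0n mulr0 addr0 hornerC.
have ww : pev (w * w) = pev w.
  (* The product [u * v] is [p] times X (X - 1), and w - w^2 = w s v = r s u v. *)
  have -> : w * w = p * (- ('X * ('X - 1%:P) * r * s)) + w.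
    have vs : s * v = 1 - w by rewrite -rs addrC addKr.
    have -> : w * w = w - w * (s * v) by rewrite vs mulrBr mulr1 opprB addrC subrK.
    rewrite addrC; congr (_ + _); rewrite mulrN; congr (- _).
    rewrite /w /u /v pE q1E subr0 !exprS; ring.
  by rewrite pevD pevM pe lcomp0m add0r.
exists (pev w); rewrite -pevM; split=> //.
have /factor_theorem[w2 w2E] : root (w - 'X) 0.
  by rewrite rootE hornerD hornerN hornerX w0 subrr.
have /factor_theorem[w3 w3E] : root w2 1.
  have : root (w - 'X) 1 by rewrite rootE hornerD hornerN hornerX w1 subrr.
  by rewrite w2E rootM root_XsubC oner_eq0 orbF.
have -> : pev w - e = (e ∘ e - e) ∘ pev w3.
  have pevX : pev 'X = e.
    rewrite -[X in pev X]mul1r pevMX -[1]/(1%:P) (pevE (size_polyC_leq1 1)).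
    by rewrite big_ord1 coefC scale1r lcompm1.
  have : w - 'X = 'X * ('X * w3) - 'X * w3.
    rewrite w2E w3E subr0; ring.
  move/(congr1 pev); rewrite -!scaleN1r !pevD !pevZ !pevM pevX !scaleN1r => ->.
  by rewrite lcompBl lcompA.
exact: idealMr.
Qed.
End Idempotent.

(** * The functor T(T, -) and add T *)

Section Retract.
Variables (k : fieldType) (C : addcat k).
Implicit Types X Y Z W : C.

Definition retract X W := exists (s : X ~> W) (r : W ~> X), r ∘ s = lid X.

Lemma retract_trans X Y Z : retract X Y -> retract Y Z -> retract X Z.
Proof.
move=> [s [r rs]] [s' [r' rs']]; exists (s' ∘ s), (r ∘ r').
by rewrite -lcompA (lcompA r') rs' lcomp1m.
Qed.

Lemma in_add_retract (T X : C) : in_add T X -> exists2 W, sum_of_copies T W & retract X W.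
Proof.
move=> [Y [W [sW [f [g [/= gf fg]]]]]]; exists W => //.
exists (f ∘ in1 X Y), (pr1 X Y ∘ g).
by rewrite -lcompA (lcompA g) gf lcomp1m pr1_in1.
Qed.

(** Membership in add T asks for an actual complement; it comes from splitting the idempotent 1 - s
    r. *)
Lemma retract_in_add (hC : split_idempotents C) (T X W : C) :
  sum_of_copies T W -> retract X W -> in_add T X.
Proof.
move=> sW [s [r rs]].
pose e := lid W - s ∘ r.
have re : r ∘ e = 0 by rewrite lcompBr lcompm1 lcompA rs lcomp1m subrr.
have es : e ∘ s = 0 by rewrite lcompBl lcomp1m -lcompA rs lcompm1 subrr.
have ee : e ∘ e = e by rewrite {2}/e lcompBr lcompm1 lcompA es lcomp0m subr0.
have [Y [r' [s' [sr rs']]]] := hC _ _ ee.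
have r's : r' ∘ s = 0.
  by rewrite -[r']lcomp1m -rs' -!lcompA (lcompA s') sr es lcompm0.
have rs'0 : r ∘ s' = 0.
  by rewrite -[s']lcompm1 -rs' (lcompA s') sr lcompA re lcomp0m.
exists Y, W; split=> //=.
exists (s ∘ pr1 X Y + s' ∘ pr2 X Y), (in1 X Y ∘ r + in2 X Y ∘ r'); split=> /=.
  rewrite lcompDr !lcompDl -!lcompA !(lcompA r) !(lcompA r') rs rs' r's rs'0.
  by rewrite !lcomp1m !lcomp0m !lcompm0 addr0 add0r bip_id.
rewrite lcompDr !lcompDl -!lcompA !(lcompA (pr1 X Y)) !(lcompA (pr2 X Y)).
rewrite pr1_in1 pr1_in2 pr2_in1 pr2_in2 !lcomp1m !lcomp0m !lcompm0 addr0 add0r sr.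
by rewrite addrC subrK.
Qed.

Lemma add_ind (T : C) (Q : C -> Prop) :
  Q (zob C) -> Q T -> (forall X Y, Q X -> Q Y -> Q (X ⊕ Y)) ->
  (forall X W, retract X W -> Q W -> Q X) -> forall X, in_add T X -> Q X.
Proof.
move=> Q0 QT QD QR X /in_add_retract [W sW /QR]; apply.
by elim: sW => // Y Z _ QY _ QZ; apply: QD.
Qed.

Lemma sum_in_add (hC : split_idempotents C) (T W : C) : sum_of_copies T W -> in_add T W.
Proof.
move=> sW; apply: (retract_in_add hC sW).
by exists (lid W), (lid W); rewrite lcomp1m.
Qed.

Lemma bip_from_eq X Y Z (u : X ⊕ Y ~> Z) :
  u = (u ∘ in1 X Y) ∘ pr1 X Y + (u ∘ in2 X Y) ∘ pr2 X Y.
Proof. by rewrite -!lcompA -lcompDr bip_id lcompm1. Qed.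

Lemma bip_to_eq X Y Z (u : Z ~> X ⊕ Y) :
  u = in1 X Y ∘ (pr1 X Y ∘ u) + in2 X Y ∘ (pr2 X Y ∘ u).
Proof. by rewrite !lcompA -lcompDl bip_id lcomp1m. Qed.
End Retract.

Section HomFunctor.
Variables (k : fieldType) (C : addcat k) (T : C).
Implicit Types X Y Z W : C.
Local Notation G := (End_alg T).
Local Notation F := (hom_rmod T).
Local Notation Fm := (hom_map T).

Lemma hom_mapE X Y (f : X ~> Y) (x : T ~> X) : Fm f x = f ∘ x.
Proof. exact: hom_postE. Qed.

(** Bijectivity of T(T', X) -> Hom(F T', F X): injectivity, then surjectivity. For T' = T this is
    evaluation at the identity, and it passes to sums and retracts. *)
Definition hom_rep (T' : C) := forall X,
  (forall u : T' ~> X, (forall x : T ~> T', u ∘ x = 0) -> u = 0) /\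
  (forall phi : rmod_hom (F T') (F X), exists u : T' ~> X, forall x, phi x = u ∘ x).

Lemma in_add_hom_rep T' : in_add T T' -> hom_rep T'.
Proof.
apply: add_ind => {T'}.
- move=> X; split=> [u _|phi]; first exact: zero_ob_from (zobP C).
  by exists 0 => x; rewrite (zero_ob_to x (zobP C)) lcompm0 linear0.
- move=> X; split=> [u /(_ (lid T))|phi]; first by rewrite lcompm1.
  by exists (phi (lid T)) => x; rewrite -{1}(lcomp1m x); apply: (rh_act phi (lid T) x).
- move=> X Y hX hY Z; split=> [u uE|phi].
    have e1 : u ∘ in1 X Y = 0 by apply: (hX Z).1 => x; rewrite -lcompA uE.
    have e2 : u ∘ in2 X Y = 0 by apply: (hY Z).1 => x; rewrite -lcompA uE.
    by rewrite (bip_from_eq u) e1 e2 !lcomp0m addr0.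
  have [u uE] := (hX Z).2 (rmod_comp phi (Fm (in1 X Y))).
  have [v vE] := (hY Z).2 (rmod_comp phi (Fm (in2 X Y))).
  exists (u ∘ pr1 X Y + v ∘ pr2 X Y) => x.
  rewrite {1}(bip_to_eq x) (rhD phi) lcompDl -!lcompA -uE -vE.
  by rewrite !rmod_compE !hom_mapE.
- move=> X W [s [r rs]] hW Z; split=> [u uE|phi].
    have e : u ∘ r = 0 by apply: (hW Z).1 => x; rewrite -lcompA uE.
    by rewrite -[u]lcompm1 -rs lcompA e lcomp0m.
  have [u uE] := (hW Z).2 (rmod_comp phi (Fm r)).
  exists (u ∘ s) => x; rewrite -lcompA -uE rmod_compE hom_mapE lcompA rs.
  by rewrite lcomp1m.
Qed.

Lemma in_add_projective T' : in_add T T' -> projective (F T').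
Proof.
apply: (add_ind (Q := fun X => projective (F X))) => {T'}.
- by apply: zero_mod_projective => x; apply: zero_ob_to (zobP C).
- move=> M N g f gs; have [m mE] := gs (f (lid T)).
  have [c a b|x a|h hE] := @rmod_hom_exists k G (F T) M (fun a => ract m (a : G)).
  + exact: ract_linearr.
  + exact: ractM.
  exists h; apply: rmod_homP => x; rewrite rmod_compE hE rh_act mE -rh_act.
  by congr (f _); apply: lcomp1m.
- move=> X Y pX pY M N g f gs.
  have [h1 h1E] := proj_lift (rmod_comp f (Fm (in1 X Y))) pX gs.
  have [h2 h2E] := proj_lift (rmod_comp f (Fm (in2 X Y))) pY gs.
  have [h hE] := rmod_homD (rmod_comp h1 (Fm (pr1 X Y))) (rmod_comp h2 (Fm (pr2 X Y))).
  exists h; apply: rmod_homP => x; rewrite rmod_compE hE rhD !rmod_compE h1E h2E.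
  by rewrite !rmod_compE !hom_mapE -(rhD f) -bip_to_eq.
- move=> X W [s [r rs]] pW; apply: (retract_projective pW).
  by exists (Fm s), (Fm r) => x; rewrite !hom_mapE lcompA rs lcomp1m.
Qed.

(** One copy of T for each vector of a k-basis of [M]. *)
Lemma cover_exists (M : rmod G) : exists (V : C) (p : rmod_hom (F V) M),
  sum_of_copies T V /\ surjective_hom p.
Proof.
have H (s : seq M) : exists (V : C) (p : rmod_hom (F V) M),
    sum_of_copies T V /\ forall m, m \in s -> exists x, p x = m.
  elim: s => [|m s [V [p [sV pE]]]].
    have [p _] := rmod_hom0 (F (zob C)) M; exists (zob C), p; split=> //.
    exact: sum_of_copies0.
  have [c a b|x a|h hE] := @rmod_hom_exists k G (F T) M (fun a => ract m (a : G)).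
  - exact: ract_linearr.
  - exact: ractM.
  have [q qE] := rmod_homD (rmod_comp h (Fm (pr1 T V))) (rmod_comp p (Fm (pr2 T V))).
  exists (T ⊕ V), q; split.
    by apply: sum_of_copiesD => //; apply: sum_of_copies1.
  move=> m'; rewrite inE => /orP[/eqP ->|/pE [x <-]].
    exists (in1 T V); rewrite qE !rmod_compE !hom_mapE pr1_in1 pr2_in1 linear0 addr0 hE.
    exact: ract1.
  exists (in2 T V ∘ x); rewrite qE !rmod_compE !hom_mapE !lcompA pr1_in2 pr2_in2.
  by rewrite lcomp0m lcomp1m linear0 add0r.
have [V [p [sV pE]]] := H (vbasis {:M}); exists V, p; split=> // m.
have : m \in limg p.
  have -> : limg p = fullv.
    apply/eqP; rewrite eqEsubv subvf /= -(span_basis (vbasisP fullv)).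
    by apply/span_subvP => y /pE [x <-]; apply/memv_img/memvf.
  exact: memvf.
by move=> /memv_imgP [x _ ->]; exists x.
Qed.

Lemma End_enough_projectives (hC : split_idempotents C) : @enough_projectives k G.
Proof.
move=> M; have [V [p [sV ps]]] := cover_exists M; exists (F V), p; split=> //.
exact/in_add_projective/sum_in_add.
Qed.

Definition Fexact X Y Z (f : X ~> Y) (g : Y ~> Z) := exact_at (Fm f) (Fm g).

Lemma wexact_Fexact X Y Z (f : X ~> Y) (g : Y ~> Z) : wexact f g -> Fexact f g.
Proof.
move=> [h _] y; rewrite hom_mapE h; split=> -[x e]; exists x.
  by rewrite hom_mapE.
by rewrite -e hom_mapE.
Qed.
End HomFunctor.

(** * Kernels along exact chains *)

Section ChainEnds.
Variables (k : fieldType) (C : lincat k).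

Fixpoint cpen n (X Z : C) : chain n X Z -> C :=
  if n is m.+1 then fun c => cpen (ctl c) else fun=> X.

Fixpoint clast n (X Z : C) : forall c : chain n X Z, cpen c ~> Z :=
  if n is m.+1 then fun c => clast (ctl c) else fun c => c.

(** Stated through a predicate because the source of [clast (crcons c h)] equals that of [h] only
    propositionally. *)
Lemma clast_crcons (Q : forall Y W : C, (Y ~> W) -> Prop) n (X Z W : C)
    (c : chain n X Z) (h : Z ~> W) : Q _ _ h -> Q _ _ (clast (crcons c h)).
Proof. by elim: n X c => [|n IH] X c //= Qh; apply: IH. Qed.

(* [P] holds for the source of every arrow but the last one. *)
Fixpoint csrc (P : C -> Prop) n (X Z : C) : chain n X Z -> Prop :=
  if n is m.+1 then fun c => P X /\ csrc P (ctl c) else fun=> True.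

Lemma csrc_crcons (P : C -> Prop) n (X Z W : C) (c : chain n X Z) (h : Z ~> W) :
  P X -> call P c -> csrc P (crcons c h).
Proof. by elim: n X c => [|n IH] X c //= PX [PY hc]; split=> //; apply: IH. Qed.

Lemma csrcT (P : C -> Prop) n (X Z : C) (c : chain n X Z) :
  (forall Y, P Y) -> csrc P c.
Proof. by move=> hP; elim: n X c => [|n IH] X c //=; split. Qed.

Lemma sub_cadj (Q Q' : forall X Y Z : C, (X ~> Y) -> (Y ~> Z) -> Prop) :
  (forall X Y Z f g, Q X Y Z f g -> Q' X Y Z f g) ->
  forall n (V X Z : C) (f : V ~> X) (c : chain n X Z), cadj Q f c -> cadj Q' f c.
Proof.
move=> QQ'; elim=> [|n IH] V X Z f c /=; first exact: QQ'.
by move=> [h1 h2]; split; [apply: QQ' | apply: IH].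
Qed.
Definition cfirst n (X Z : C) (P : forall Y, (X ~> Y) -> Prop) : chain n X Z -> Prop :=
  if n is m.+1 then fun c => P _ (chd c) else fun c => P _ c.

Lemma cadj_cfirst Q n (V X Z : C) (f : V ~> X) (c : chain n X Z)
    (P : forall Y, (X ~> Y) -> Prop) :
  cadj Q f c -> (forall Y (g : X ~> Y), Q _ _ _ f g -> P _ g) -> cfirst P c.
Proof. by case: n c => [|n] c /= => [h|[h _]]; apply. Qed.

Definition cpairs (Q : forall X Y Z : C, (X ~> Y) -> (Y ~> Z) -> Prop) n (X Z : C) :
    chain n X Z -> Prop :=
  if n is m.+1 then fun c => cadj Q (chd c) (ctl c) else fun=> True.

Lemma cadj_cpairs Q n (V X Z : C) (f : V ~> X) (c : chain n X Z) :
  cadj Q f c -> cpairs Q c.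
Proof. by case: n c => [|n] c //= []. Qed.
End ChainEnds.

Section Kernels.
Variables (k : fieldType) (C : addcat k) (T : C).
Implicit Types X Y Z W : C.
Local Notation G := (End_alg T).
Implicit Types B N : rmod (End_alg T).
Local Notation F := (hom_rmod T).
Local Notation Fm := (hom_map T).

Definition kerof (B : rmod G) X Y (f : X ~> Y) :=
  exists i : rmod_hom B (F X), injective i /\ exact_at i (Fm f).

Definition kfirst (B : rmod G) n X Z : chain n X Z -> Prop :=
  if n is m.+1 then fun c => kerof B (chd c) else fun c => kerof B c.

Lemma kerof_iso B B' X Y (f : X ~> Y) : kerof B f -> kerof B' f -> rmod_iso B B'.
Proof. by move=> [i [ii ie]] [i' [ii' ie']]; apply: ker_unique ie ie'. Qed.

Lemma kfirst_exists n X Z (c : chain n X Z) : exists B, kfirst B c.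
Proof.
by case: n c => [|n] c /=;
  [have [B [i]] := ker_exists (Fm c) | have [B [i]] := ker_exists (Fm (chd c))];
  move=> h; exists B, i.
Qed.

Lemma cadj_kfirst n X Y W (g : X ~> Y) (c : chain n Y W) B' :
  cadj (@Fexact k C T) g c -> kfirst B' c ->
  exists i' : rmod_hom B' (F Y), injective i' /\
    forall y, (exists b, i' b = y) <-> exists x, Fm g x = y.
Proof.
case: n c => [|n] c /=; [move=> ge | move=> [ge _]]; move=> [i' [ii' ie']];
  by exists i'; split=> // y; rewrite -(ge y) (ie' y).
Qed.

Lemma kfirst_image n X Y W (g : X ~> Y) (c : chain n Y W) B (i : rmod_hom B (F Y)) :
  cadj (@Fexact k C T) g c -> injective i ->
  (forall y, (exists b, i b = y) <-> exists x, Fm g x = y) -> kfirst B c.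
Proof.
move=> gc ii ie; case: n c gc => [|n] c /=; [move=> ge | move=> [ge _]];
  by exists i; split=> // y; rewrite (ge y) -(ie y).
Qed.

Lemma chain_ses n X Y W (g : X ~> Y) (c : chain n Y W) B B' :
  cadj (@Fexact k C T) g c -> kerof B g -> kfirst B' c ->
  exists (i : rmod_hom B (F X)) (p : rmod_hom (F X) B') (i' : rmod_hom B' (F Y)),
  [/\ injective i, surjective_hom p, exact_at i p, exact_at i (Fm g)
    & injective i' /\ forall x, i' (p x) = Fm g x].
Proof.
move=> gc [i [ii ie]] /(cadj_kfirst gc) [i' [ii' ie']].
have [|p pE] := factor_inj (f := Fm g) ii'.
  by move=> x; apply/ie'; exists x.
exists i, p, i'; split=> //.
  move=> b; have [x xE] : exists x, Fm g x = i' b by apply/ie'; exists b.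
  by exists x; apply: ii'; rewrite pE.
move=> y; rewrite -(ie y) -pE; split=> [->|]; first exact: rh0.
by rewrite -(rh0 i') => /ii'.
Qed.

(** An exact chain is cut at its successive kernels, each sequence 0 -> ker -> F X -> next kernel ->
    0 raising the index of [Phi] by one. *)
Lemma chain_kernels (Phi : nat -> rmod G -> Prop) (P : C -> Prop) :
  (forall r B B', rmod_iso B B' -> Phi r B -> Phi r B') ->
  (forall r X B B', P X -> ses B (F X) B' -> Phi r B -> Phi r.+1 B') ->
  forall n r X W (c : chain n X W) B N,
  cpairs (@Fexact k C T) c ->
  csrc P c -> kfirst B c -> kerof N (clast c) -> Phi r B -> Phi (r + n)%N N.
Proof.
move=> Pi Ps; elim=> [|n IH] r X W c B N.
  by move=> _ _ /= hB hN; rewrite addn0; apply/Pi/(kerof_iso hB hN).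
move=> ec [PX Pc] /= hB hN hr.
have [B' hB'] := kfirst_exists (ctl c).
have [i [p [i' [ii ps ip ig [ii' i'E]]]]] := chain_ses ec hB hB'.
rewrite addnS -addSn; apply: (IH r.+1 _ _ (ctl c) B') => //.
  exact: cadj_cpairs ec.
by apply: (Ps _ _ _ _ PX _ hr); exists i, p.
Qed.

Lemma resolution_along_iso B B' (h : rmod_iso B B') (R : proj_resolution B) :
  exists R' : proj_resolution B', forall N i, coh_zero R N i -> coh_zero R' N i.
Proof.
have [f [g [gf fg]]] := h.
have s : surjective_hom (rmod_comp f (res_aug R)).
  move=> y; have [x xE] := res_surj R (g y).
  by exists x; rewrite rmod_compE xE fg.
have e : exact_at (res_d R 0) (rmod_comp f (res_aug R)).
  move=> y; rewrite rmod_compE -(@res_exact0 _ _ _ R y).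
  by split=> [/(congr1 g)|->]; rewrite ?gf rh0.
by exists (@ProjResolution k G B' (res R) (res_d R) _ (@res_proj _ _ _ R) s e
  (@res_exact _ _ _ R)).
Qed.

(** Ext^1, ..., Ext^r from [B] to D vanish. A single resolution serves all degrees and all Y, so
    that it can be spliced. *)
Definition ext_vanish (r : nat) (B : rmod G) := exists R : proj_resolution B,
  forall Y i, (i < r)%N -> coh_zero R (F Y) i.+1.

Lemma ext_vanish_iso r B B' : rmod_iso B B' -> ext_vanish r B -> ext_vanish r B'.
Proof.
move=> BB' [R hR]; have [R' RR'] := resolution_along_iso BB' R.
by exists R' => Y i ir; apply/RR'/hR.
Qed.

Lemma ext_vanish_chain n r U V X W (e : U ~> V) (f : V ~> X) (c : chain n X W) B N :
  in_add T U -> in_add T V -> csrc (in_add T) c ->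
  wexact e f -> cadj (@wexact k C) f c -> kfirst B c -> kerof N (clast c) ->
  ext_vanish r B -> ext_vanish (r + n)%N N.
Proof.
elim: n r U V X e f c B => [|n IH] r U V X e f c B aU aV.
  by move=> _ _ _ /= hB hN; rewrite addn0; apply/ext_vanish_iso/(kerof_iso hB hN).
move=> [aX ac] ef [fg gc] /= hB hN [R hR].
have [B' hB'] := kfirst_exists (ctl c).
have gc' := sub_cadj (@wexact_Fexact k C T) gc.
have [i [p [i' [ii ps ip ig [ii' i'E]]]]] := chain_ses gc' hB hB'.
rewrite addnS -addSn; apply: (IH _ _ _ _ f (chd c) (ctl c) B') => //.
(* Higher degrees are inherited from [R]. For Ext^1(B', F Y), a map phi' from B to F Y must extend
   to F X: its pullback to F V is F u with u e = 0, so u = v f by the weak cokernel property, and F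
   v is the extension. *)
exists (splice ii ps ip (in_add_projective aX) R) => Y [|j] hj; last exact: hR.
apply/cohP => phi phid.
have [|phi' phi'E] := factor_surj (f := phi) (@res_surj _ _ _ R).
  by move=> x /(@res_exact0 _ _ _ R x) [y <-]; apply: phid.
have Ffg := wexact_Fexact (T := T) fg.
have [a aE] : exists a : rmod_hom (F V) B, forall x, i (a x) = Fm f x.
  by apply: factor_inj => // x; apply/ig/Ffg; exists x.
have [u uE] := (in_add_hom_rep aV Y).2 (rmod_comp phi' a).
have ue : u ∘ e = 0.
  apply: (in_add_hom_rep aU Y).1 => x.
  rewrite -lcompA -uE rmod_compE.
  have -> : a (e ∘ x) = 0.
    apply: (ii _ _); rewrite aE rh0 hom_mapE lcompA.
    have -> : f ∘ e = 0 by apply/(ef.1 _ e); exists (lid _); rewrite lcompm1.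
    exact: lcomp0m.
  by move: (rh0 phi') => h; apply: h.
have [v vE] := (ef.2 _ u).1 ue.
exists (Fm v) => x; rewrite -phi'E [X in Fm v X](rmod_compE i (res_aug R)).
set b := res_aug R x.
have [y yE] : exists y, Fm f y = i b by apply/Ffg/ig; exists b.
have <- : a y = b by apply: (ii _ _); rewrite aE.
by rewrite -(rmod_compE phi' a) uE aE !hom_mapE vE lcompA.
Qed.
End Kernels.

(** * The quotient category and the essential image *)

Lemma coh_iso (k : fieldType) (G : fdalg k) (M : rmod G) (R : proj_resolution M)
    (N N' : rmod G) i : rmod_iso N N' -> coh_zero R N i.+1 -> coh_zero R N' i.+1.
Proof.
move=> [f [g [gf fg]]] /cohP h; apply/cohP => phi phid.
have [|psi psiE] := h (rmod_comp g phi).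
  by move=> x; rewrite rmod_compE phid rh0.
by exists (rmod_comp f psi) => x; rewrite rmod_compE -psiE rmod_compE fg.
Qed.

Section ClusterTilting.
Variables (k : fieldType) (C : addcat k) (d : nat) (A : angulated C d.+1).
Hypothesis hC : split_idempotents C.
Variable T : C.
Hypothesis hT : cluster_tilting A T.
Implicit Types X Y Z W : C.
Local Notation G := (End_alg T).
Implicit Types M N B : rmod G.
Local Notation F := (hom_rmod T).
Local Notation Fm := (hom_map T).
Local Notation sg := (smap (susp A)).
Local Notation so := (sobj (susp A)).

Lemma no_map_susp_add T' : in_add T T' -> forall x : T ~> so T', x = 0.
Proof.
apply: (add_ind (Q := fun X => forall x : T ~> so X, x = 0)).
- by move=> x; apply/zero_ob_to/sg_zero_ob/zobP.
- exact: hT.1.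
- move=> X Y hX hY x; rewrite -[x]lcomp1m -sg1 -bip_id sgD lcompDl !sgM -!lcompA.
  by rewrite (hX (sg _ ∘ x)) (hY (sg _ ∘ x)) !lcompm0 addr0.
- move=> X W [s [r rs]] hW x.
  by rewrite -[x]lcomp1m -sg1 -rs sgM -lcompA (hW (sg s ∘ x)) lcompm0.
Qed.

Lemma no_map_add_susp Z : in_add (so T) Z -> forall x : T ~> Z, x = 0.
Proof.
apply: (add_ind (Q := fun X => forall x : T ~> X, x = 0)).
- by move=> x; apply/zero_ob_to/zobP.
- exact: hT.1.
- move=> X Y hX hY x; rewrite (bip_to_eq x).
  by rewrite (hX (pr1 _ _ ∘ x)) (hY (pr2 _ _ ∘ x)) !lcompm0 addr0.
- move=> X W [s [r rs]] hW x.
  by rewrite -[x]lcomp1m -rs -lcompA (hW (s ∘ x)) lcompm0.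
Qed.

(** Sigma preserves sums only up to [susp_sum], so retracts are tracked instead of sums of
    copies. *)
Lemma susp_in_add T' : in_add T T' -> in_add (so T) (so T').
Proof.
have rD X Y V W : retract X V -> retract Y W -> retract (X ⊕ Y) (V ⊕ W).
  move=> [s [r rs]] [s' [r' rs']]; exists (mat s 0 0 s'), (mat r 0 0 r').
  by rewrite matM rs rs' !lcompm0 !lcomp0m !addr0 !add0r mat1.
move=> /in_add_retract [W sW [s [r rs]]].
have [W' sW' rW'] : exists2 W', sum_of_copies (so T) W' & retract (so W) W'.
  elim: sW {s r rs} => [||X Y sX [X' sX' rX] sY [Y' sY' rY]].
  - exists (zob C); first exact: sum_of_copies0.
    by exists 0, 0; rewrite lcompm0 (sg_zero_ob A (zobP C)).
  - exists (so T); first exact: sum_of_copies1.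
    by exists (lid _), (lid _); rewrite lcomp1m.
  - exists (X' ⊕ Y'); first exact: sum_of_copiesD.
    apply: retract_trans (rD _ _ _ _ rX rY).
    exists (in1 _ _ ∘ sg (pr1 X Y) + in2 _ _ ∘ sg (pr2 X Y)), (susp_sum (susp A) X Y).
    rewrite /susp_sum lcompDr !lcompDl -!lcompA !(lcompA (pr1 _ _)) !(lcompA (pr2 _ _)).
    rewrite pr1_in1 pr1_in2 pr2_in1 pr2_in2 !lcomp1m !lcomp0m !lcompm0 addr0 add0r.
    by rewrite -!sgM -sgD bip_id sg1.
apply: (retract_in_add hC sW'); apply: retract_trans rW'.
by exists (sg s), (sg r); rewrite -sgM rs sg1.
Qed.

Lemma tilting_chain X : exists Td (c : chain d.+1 Td X) (delta : X ~> so Td),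
  [/\ in_add T Td, call (in_add T) c, cadj (@wexact k C) (chd c) (crcons (ctl c) delta),
      wexact delta (csgn k d *: sg (chd c)) & forall x : T ~> X, delta ∘ x = 0].
Proof.
have [Td [c [delta [aT ac /angle_cadj h]]]] := hT.2 X.
exists Td, c, delta; split=> //.
- exact: cadj_crcons h.
- exact: cadj_crcons_last h.
- by move=> x; apply: no_map_susp_add.
Qed.

Lemma tilting_presentation X : exists T1 T0 Td (f : T1 ~> T0) (g : T0 ~> X) (delta : X ~> so Td),
  [/\ [/\ in_add T T1, in_add T T0 & in_add T Td], wexact f g, wexact g delta
    & forall x : T ~> X, exists y, x = g ∘ y].
Proof.
have [Td [c [delta [aT [aY ac] h _ h0]]]] := tilting_chain X.
have [T1 [T0 [f [g [a1 a0 fg gd]]]]] := cadj_last h aT aY ac.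
by exists T1, T0, Td, f, g, delta; split=> // x; apply/(gd.1 _ x).
Qed.

(** Lift phi along F T_0 -> F X to a map u : T_0 -> Y. It kills T_1, hence factors through X, a weak
    cokernel of T_1 -> T_0. *)
Lemma hom_full X Y (phi : rmod_hom (F X) (F Y)) : exists u : X ~> Y, forall x, phi x = u ∘ x.
Proof.
have [T1 [T0 [Td [f [g [delta [[a1 a0 _] fg _ gs]]]]]]] := tilting_presentation X.
have [u uE] := (in_add_hom_rep a0 Y).2 (rmod_comp phi (Fm g)).
have [|v vE] := (fg.2 _ u).1.
  apply: (in_add_hom_rep a1 Y).1 => x; rewrite -lcompA -uE rmod_compE hom_mapE lcompA.
  have -> : g ∘ f = 0 by apply/(fg.1 _ f); exists (lid _); rewrite lcompm1.
  by rewrite lcomp0m; apply: (rh0 phi).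
exists v => x; have [y ->] := gs x.
by rewrite lcompA -vE -uE rmod_compE hom_mapE.
Qed.

(** A map killed by F vanishes on T_0, hence factors through X -> Sigma T_d. *)
Lemma hom_zero_factors X Y (f : X ~> Y) :
  (forall x : T ~> X, f ∘ x = 0) <-> factors_through_add (so T) f.
Proof.
split=> [h|[Z [g [h [aZ ->]]]] x]; last first.
  by rewrite -lcompA (no_map_add_susp aZ (g ∘ x)) lcompm0.
have [T1 [T0 [Td [f' [g [delta [[a1 a0 aT] _ gd gs]]]]]]] := tilting_presentation X.
have [|v ->] := (gd.2 _ f).1.
  by apply: (in_add_hom_rep a0 Y).1 => x; rewrite -lcompA.
by exists (so Td), delta, v; split=> //; apply: susp_in_add.
Qed.

Lemma hom_functor_respects :
  respects_ideal (add_ideal (so T)) (to_ess_image (hom_functor T)).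
Proof.
move=> X Y f g /hom_zero_factors h; apply: rmod_homP => x /=.
rewrite !hom_postE; apply/eqP; rewrite -subr_eq0 -lcompBl; apply/eqP; exact: h.
Qed.

Lemma quotient_equivalence : is_equivalence (quot_functor hom_functor_respects).
Proof.
apply: full_faithful_equivalence => [X Y f g|X Y f|[M [X XM]]].
- move=> e; rewrite -(qreprK f) -(qreprK g); apply/qclassP/hom_zero_factors => x.
  have : Fm (qrepr f) x = Fm (qrepr g) x := congr1 (fun h : rmod_hom (F X) (F Y) => h x) e.
  by rewrite !hom_mapE lcompBl => ->; rewrite subrr.
- have [u uE] := hom_full (f : rmod_hom (F X) (F Y)).
  exists (qclass (add_ideal (so T)) u).
  etransitivity; first exact: (quot_mapE hom_functor_respects u).
  by apply: rmod_homP => x; rewrite /= hom_postE uE.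
- by exists X; have [f [g [e e']]] := XM; exists f; exists g; split; [apply: e | apply: e'].
Qed.

Definition in_image M := exists X, rmod_iso (F X) M.

Lemma in_imageP M : ess_image (hom_functor T) M <-> in_image M.
Proof. by split=> -[X h]; exists X; move: h => /rmod_isoP. Qed.

Lemma in_image_hom X : in_image (F X).
Proof. by exists X; apply: rmod_iso_refl. Qed.

Lemma in_image_iso M N : rmod_iso M N -> in_image M -> in_image N.
Proof. by move=> MN [X XM]; exists X; apply: rmod_iso_trans MN. Qed.

Fact hom_zero_ideal0 X Y : forall x : T ~> X, (0 : X ~> Y) ∘ x = 0.
Proof. by move=> x; rewrite lcomp0m. Qed.
Fact hom_zero_idealD X Y (f g : X ~> Y) : (forall x : T ~> X, f ∘ x = 0) ->
  (forall x : T ~> X, g ∘ x = 0) -> forall x : T ~> X, (f + g) ∘ x = 0.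
Proof. by move=> hf hg x; rewrite lcompDl hf hg addr0. Qed.
Fact hom_zero_idealMl X Y Z (g : Y ~> Z) (f : X ~> Y) :
  (forall x : T ~> X, f ∘ x = 0) -> forall x : T ~> X, (g ∘ f) ∘ x = 0.
Proof. by move=> hf x; rewrite -lcompA hf lcompm0. Qed.
Fact hom_zero_idealMr X Y Z (g : Y ~> Z) (f : X ~> Y) :
  (forall x : T ~> Y, g ∘ x = 0) -> forall x : T ~> X, (g ∘ f) ∘ x = 0.
Proof. by move=> hg x; rewrite -lcompA hg. Qed.

(** The kernel of F, which [hom_zero_factors] identifies with [add Sigma T]. *)
Definition hom_zero_ideal : ideal C :=
  Ideal hom_zero_ideal0 hom_zero_idealD hom_zero_idealMl hom_zero_idealMr.

Lemma retract_hom M X : rmod_retract M (F X) ->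
  exists2 X', retract X' X & rmod_iso (F X') M.
Proof.
move=> [i [p pi]].
have [e eE] := hom_full (rmod_comp i p).
have [f [ff fe]] : exists f : X ~> X, f ∘ f = f /\ imem hom_zero_ideal (f - e).
  apply: idempotent_lifting => x /=.
  by rewrite lcompBl -lcompA -!eE !rmod_compE pi subrr.
have {fe} fE x : f ∘ x = i (p x).
  rewrite -(rmod_compE i p) eE; apply/eqP; rewrite -subr_eq0 -lcompBl; apply/eqP; exact: fe.
have [X' [r [s [sr rs]]]] := hC ff.
exists X'; first by exists s, r.
exists (rmod_comp p (Fm s)), (rmod_comp (Fm r) i); split=> x.
  rewrite !rmod_compE !hom_mapE -fE -sr -!lcompA (lcompA r s).
  by rewrite rs lcomp1m lcompA rs lcomp1m.
by rewrite !rmod_compE !hom_mapE lcompA sr fE !pi.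
Qed.

Lemma in_image_retract M N : rmod_retract M N -> in_image N -> in_image M.
Proof.
move=> [i [p pi]] [X [f [g [gf fg]]]].
have [|X' _ h] := @retract_hom M X; last by exists X'.
exists (rmod_comp g i), (rmod_comp p f) => x.
by rewrite !rmod_compE fg pi.
Qed.

Lemma ext_vanish_hom X : ext_vanish d (F X).
Proof.
have ep := End_enough_projectives (T := T) hC.
(* The length is generalised so that the chain can be destructed. Its first two arrows serve as [e]
   and [f] in [ext_vanish_chain], and the remaining steps up to F X contribute one Ext degree
   each. *)
suff gen n (W Td : C) (c : chain n.+1 Td X) (delta : X ~> W) : in_add T Td ->
    call (in_add T) c -> cadj (@wexact k C) (chd c) (crcons (ctl c) delta) ->
    (forall x : T ~> X, delta ∘ x = 0) -> ext_vanish n (F X).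
  have [Td [c [delta [aT ac h _ h0]]]] := tilting_chain X.
  exact: gen aT ac h h0.
case: n c => [|n] c aT ac h h0.
  by have [R _] := resolution_exists ep (F X); exists R.
move: ac h => /= [aV [aX ac]] [ef h].
have [B hB] := kfirst_exists T (crcons (ctl (ctl c)) delta).
have [R _] := resolution_exists ep B.
apply: (ext_vanish_chain (r := 0) aT aV (csrc_crcons delta aX ac) ef h hB).
  apply: (clast_crcons (Q := fun Y W h => kerof (F X) h)).
  exists (rmod_id (F X)); split=> [x y|y]; first by rewrite !rmod_idE.
  by rewrite hom_mapE h0; split=> // _; exists y; rewrite rmod_idE.
by exists R.
Qed.
End ClusterTilting.

(** * Resolutions by the essential image *)

Section Maximality.
Variables (k : fieldType) (C : addcat k) (d : nat) (A : angulated C d.+1).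
Hypothesis hC : split_idempotents C.
Variable T : C.
Hypothesis hT : cluster_tilting A T.
Hypothesis ei : @enough_injectives k (End_alg T).
Implicit Types X Y Z W : C.
Local Notation G := (End_alg T).
Implicit Types M N B : rmod G.
Local Notation F := (hom_rmod T).
Local Notation Fm := (hom_map T).
Local Notation sg := (smap (susp A)).
Local Notation so := (sobj (susp A)).
Local Notation Z0 := (@zero_mod k G).

Let ep : @enough_projectives k G := End_enough_projectives (T := T) hC.

(* T(T, -) maps the angle V -> V' -> Y_3 -> ... -> Y_n -> Sigma V to an exact  *)
(* sequence 0 -> T(T, Y_3) -> ... -> T(T, Y_n) -> M -> 0.                      *)
Lemma right_resolution V V' (g : V ~> V') M :
  (forall x : T ~> V', x = 0) -> kerof M (sg g) -> respath (@in_image k C T) Z0 d.+1 M.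
Proof.
move=> hV' [i [ii ie]]; have [Y [a [c [_ gc]]]] := angle_exists A g.
have [B hB] := kfirst_exists T (crcons c (csgn k d *: sg g)).
have gc' := sub_cadj (@wexact_Fexact k C T) gc.
have B0 : zero_mod B.
  have [i' [ii' ie']] := cadj_kfirst gc' hB.
  move=> b; have [x xE] : exists x, Fm a x = i' b by apply/ie'; exists b.
  by apply: ii'; rewrite -xE (hV' x) !rh0.
apply: (@chain_kernels k C T (respath (@in_image k C T) Z0) (fun=> True) _ _ d.+1 0
  _ _ (crcons c (csgn k d *: sg g)) B M _ _ hB _ B0).
- move=> r N N'; apply: respath_iso => D D' [f [f' [ff' f'f]]] D0 x.
  by rewrite -(f'f x) (D0 (f' x)) rh0.
- by move=> r X D D' _ s hD; exists D, (F X); split=> //; apply: in_image_hom.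
- exact: cadj_cpairs gc'.
- exact: csrcT.
- apply: (clast_crcons (Q := fun Y W h => kerof M h)).
  exists i; split=> // y; rewrite -(ie y) !hom_mapE scale_compl.
  split=> [/eqP|->]; last by rewrite scaler0.
  by rewrite scaler_eq0 (negPf (csgn_neq0 k d)) => /eqP.
Qed.

(** The approximation is F of the last object of the angle on [g], whose arrow p to Sigma V is a
    weak kernel of Sigma g. A map from F Y to M lifts by fullness to u : Y -> Sigma V, and (Sigma g)
    u = 0 by the hypothesis on V', so u factors through p. *)
Lemma right_approximation V V' (g : V ~> V') M :
  (forall Y (u : Y ~> so V'), (forall x : T ~> Y, u ∘ x = 0) -> u = 0) ->
  kerof M (sg g) -> exists X (f : rmod_hom (F X) M),
  forall Y (f' : rmod_hom (F Y) M), exists h : Y ~> X, forall x, f' x = f (h ∘ x).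
Proof.
move=> hV' [i [ii ie]]; have [Y0 [a [c [_ gc]]]] := angle_exists A g.
have [_ [X [_ [p [_ _ _ pg]]]]] := cadj_last (P := fun=> True) gc I I (callT c (fun=> I)).
have pgE Y (u : Y ~> so V) : sg g ∘ u = 0 <-> exists v, u = p ∘ v.
  rewrite -(pg.1 _ u) scale_compl; split=> [->|/eqP]; first by rewrite scaler0.
  by rewrite scaler_eq0 (negPf (csgn_neq0 k d)) => /eqP.
have [f fE] : exists f : rmod_hom (F X) M, forall x, i (f x) = Fm p x.
  by apply: factor_inj => // x; apply/ie; rewrite !hom_mapE; apply/pgE; exists x.
exists X, f => Y f'.
have [u uE] := hom_full hT (rmod_comp i f').
have [|h hE] := (pgE _ u).1.
  apply: hV' => x; rewrite -lcompA -uE rmod_compE -hom_mapE.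
  by apply/ie; exists (f' x).
by exists h => x; apply: ii; rewrite fE hom_mapE lcompA -hE -uE rmod_compE.
Qed.

Lemma left_coresolution M : exists X (f : rmod_hom M (F X)),
  (forall Y (f' : rmod_hom M (F Y)), exists h : X ~> Y, forall x, f' x = h ∘ (f x)) /\
  exists N, in_image N /\ respath (@in_image k C T) (rmod_iso M) d N.
Proof.
have [T0 [p [s0 ps]]] := cover_exists M; have a0 := sum_in_add hC s0.
have [K [j [ji je]]] := ker_exists p.
have [T1 [q [s1 qs]]] := cover_exists K; have a1 := sum_in_add hC s1.
have [f fE] := (in_add_hom_rep a1 T0).2 (rmod_comp j q).
have fp : exact_at (Fm f) p.
  move=> y; rewrite (je y); split=> -[x <-]; last first.
    by exists (q x); rewrite hom_mapE -fE rmod_compE.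
  by have [z <-] := qs x; exists z; rewrite hom_mapE -fE rmod_compE.
have [Y1 [a [c [fc /cadj_crcons cc]]]] := angle_exists A f.
have cc' := sub_cadj (@wexact_Fexact k C T) cc.
(* In the angle T_1 -> T_0 -> Y_1 -> ..., M is the image of F T_0 -> F Y_1; the weak cokernel
   property of Y_1 makes this embedding a left approximation. *)
have [i iE] : exists i : rmod_hom M (F Y1), forall x, i (p x) = Fm a x.
  by apply: factor_surj => // x /fp xf; apply/(wexact_Fexact fc).
have ii : injective i.
  move=> x y e; apply/eqP; rewrite -subr_eq0; have [z zE] := ps (x - y).
  rewrite -zE; apply/eqP/fp/(wexact_Fexact fc); rewrite -iE zE rhB e subrr //.
exists Y1, i; split.
  move=> Y f'.
  have [u uE] := (in_add_hom_rep a0 Y).2 (rmod_comp f' p).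
  have [|h hE] := (fc.2 _ u).1.
    apply: (in_add_hom_rep a1 Y).1 => x; rewrite -lcompA -uE rmod_compE.
    have -> : p (f ∘ x) = 0 by apply/fp; exists x; rewrite hom_mapE.
    by apply: (rh0 f').
  exists h => x; have [y <-] := ps x.
  by rewrite iE hom_mapE lcompA -hE -uE rmod_compE.
have hM : kfirst M c.
  apply: (kfirst_image cc' ii) => y; split=> -[x <-].
    by have [z <-] := ps x; exists z; rewrite iE.
  by exists (p x); rewrite iE.
exists (F (cpen c)); split; first exact: in_image_hom.
apply: (@chain_kernels k C T (respath (@in_image k C T) (rmod_iso M)) (fun=> True) _ _ d 0
  _ _ c M _ _ _ hM _ (rmod_iso_refl M)).
- by move=> r N N'; apply: respath_iso => D D' h1 h2; apply: rmod_iso_trans h2 h1.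
- by move=> r X D D' _ s hD; exists D, (F X); split=> //; apply: in_image_hom.
- exact: cadj_cpairs cc'.
- exact: csrcT.
- exists (rmod_id _); split=> [x y|y]; first by rewrite !rmod_idE.
  rewrite hom_mapE (no_map_susp_add hT a1 (_ ∘ y)).
  by split=> // _; exists y; rewrite rmod_idE.
Qed.

Lemma ext_vanish_in_image M N (R : proj_resolution M) i :
  in_image (T := T) M -> in_image (T := T) N -> (i < d)%N -> coh_zero R N i.+1.
Proof.
move=> [X XM] [Y YN] hi; apply: (coh_iso YN).
have [R' hR'] := ext_vanish_iso XM (ext_vanish_hom hC hT X).
exact: (@coh_indep _ _ ei _ R' R _ _ (hR' Y i hi)).
Qed.

(** The first sequence 0 -> B -> E -> M -> 0 of the resolution splits: Ext^1(M, B) is shifted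
    through D up to the zero module at the far end. *)
Lemma in_image_maximal_left M : respath (@in_image k C T) Z0 d.+1 M ->
  (forall i N, (0 < i < d.+1)%N -> in_image N -> ext_zero i M N) -> in_image (T := T) M.
Proof.
move=> [B [E [s hE hB]]] h.
have [R _] := resolution_exists ep M.
have [|_ hM] := ses_split_retract (R := R) _ s; last exact: (in_image_retract hC hT hM).
apply: (respath_coh (r := d) _ _ hB) => // [E' i DE' hi|E' i E'0 _].
  by apply: ext_zero_coh => //; apply: h.
exact: coh_zero_mod.
Qed.

(* In 0 -> M -> E_1 -> ... -> E_n -> N -> 0 the last short exact sequence splits, *)
(* because Ext^1(N, ker (E_n -> N)) embeds in Ext^n(N, M) = 0; so N can be cut off. *)
Lemma in_image_maximal_right M N n : (n <= d)%N ->
  respath (@in_image k C T) (rmod_iso M) n N -> in_image (T := T) N ->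
  (forall i N, (0 < i < d.+1)%N -> in_image N -> ext_zero i N M) -> in_image (T := T) M.
Proof.
move=> nd + + h; elim: n N nd => [|n IH] N nd.
  by move=> /rmod_iso_sym MN; apply: in_image_iso.
move=> [B [E [s hE hB]]] hN.
have [R _] := resolution_exists ep N.
have [|hB' _] := ses_split_retract (R := R) _ s; last first.
  by apply: (IH B (ltnW nd)) => //; apply: (in_image_retract hC hT hB').
have d0 : (0 < d)%N by apply: leq_ltn_trans nd.
apply: (respath_coh (r := d.-1) _ _ hB) => [E' i DE' hi|E' i ME'|].
- by apply: ext_vanish_in_image => //; apply: leq_trans hi (leq_pred _).
- rewrite prednK // => hi; apply: (coh_iso ME').
  by apply: ext_zero_coh => //; apply: h.
- by rewrite prednK.
Qed.
End Maximality.

(** * Duality by the Serre functor *)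

Lemma lfun_exists (k : fieldType) (U V : vectType k) (f : U -> V) :
  linear f -> exists h : 'Hom(U, V), forall x, h x = f x.
Proof.
move=> fl; pose L := GRing.isLinear.Build k U V *:%R f fl.
pose g : {linear U -> V} := HB.pack f L.
by exists (linfun g) => x; apply: (lfunE g).
Qed.

Lemma functional_factor (k : fieldType) (U V : vectType k) (W : vectType k)
    (phi : U -> V) (xi : 'Hom(U, W)) :
  linear phi -> (forall u, phi u = 0 -> xi u = 0) ->
  exists zeta : 'Hom(V, W), forall u, xi u = zeta (phi u).
Proof.
move=> /lfun_exists [h hE] hk; exists (xi \o h^-1)%VF => u.
rewrite comp_lfunE; apply/eqP; rewrite -subr_eq0 -linearB; apply/eqP/hk.
by rewrite -hE linearB /= -hE limg_lfunVK ?memv_img ?memvf // subrr.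
Qed.

Section Serre.
Variables (k : fieldType) (C : addcat k) (S : functor (ucat C) (ucat C)).
Variable eta : forall X Y : C, 'Hom(X ~> Y, k^o) -> (Y ~> S X).
Hypothesis eta_linear : forall X Y, linear (@eta X Y).
Hypothesis eta_bij : forall X Y, bijective (@eta X Y).
Hypothesis eta_nat1 : forall (X Y Y' : C) (g : Y ~> Y') (xi : 'Hom(X ~> Y', k^o))
  (xi' : 'Hom(X ~> Y, k^o)),
  (forall u, xi' u = xi (g ∘ u)) -> eta xi' = eta xi ∘ g.
Hypothesis eta_nat2 : forall (X X' Y : C) (f : X ~> X') (xi : 'Hom(X ~> Y, k^o))
  (xi' : 'Hom(X' ~> Y, k^o)),
  (forall u, xi' u = xi (u ∘ f)) -> eta xi' = smap S f ∘ eta xi.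

Lemma eta_inj X Y : injective (@eta X Y).
Proof. exact: bij_inj. Qed.

Lemma eta_surj X Y (y : Y ~> S X) : exists xi : 'Hom(X ~> Y, k^o), eta xi = y.
Proof. by have [g _ h] := eta_bij X Y; exists (g y). Qed.

Lemma eta0 X Y : eta (0 : 'Hom(X ~> Y, k^o)) = 0.
Proof.
have := eta_linear 1 (0 : 'Hom(X ~> Y, k^o)) 0; rewrite !scale1r addr0 => e.
by apply: (addrI (eta (0 : 'Hom(X ~> Y, k^o)))); rewrite -e addr0.
Qed.

Lemma eta_eq0 (X Y : C) (xi : 'Hom(X ~> Y, k^o)) : eta xi = 0 <-> forall u, xi u = 0.
Proof.
split=> [|h]; first by rewrite -eta0 => /eta_inj -> u; rewrite lfunE.
by rewrite -(eta0 X Y); congr eta; apply/lfunP => u; rewrite h lfunE.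
Qed.

Lemma precomp_functional (X X' Y : C) (f : X ~> X') (xi : 'Hom(X ~> Y, k^o)) :
  exists xi' : 'Hom(X' ~> Y, k^o), forall u, xi' u = xi (u ∘ f).
Proof.
by apply: lfun_exists => c u v; rewrite lcompDl scale_compl linearP.
Qed.

Lemma postcomp_functional (X Y Y' : C) (g : Y ~> Y') (xi : 'Hom(X ~> Y', k^o)) :
  exists xi' : 'Hom(X ~> Y, k^o), forall u, xi' u = xi (g ∘ u).
Proof.
by apply: lfun_exists => c u v; rewrite lcompDr scale_compr linearP.
Qed.

(** Choosing xi with eta xi = id, naturality writes S f as eta of the functional u -> xi(u f), which
    is additive in f. *)
Lemma serre_additive (X Y : C) (f g : X ~> Y) : smap S (f + g) = smap S f + smap S g.
Proof.
have [xi xiE] := eta_surj (lid (S X)).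
have [a aE] := precomp_functional f xi; have [b bE] := precomp_functional g xi.
rewrite -[LHS]lcompm1 -[X in _ = X + _]lcompm1 -[X in _ = _ + X]lcompm1 -xiE.
rewrite -(eta_nat2 aE) -(eta_nat2 bE).
have -> : eta a + eta b = eta (a + b).
  by have := eta_linear 1 a b; rewrite !scale1r => ->.
by symmetry; apply: eta_nat2 => u; rewrite lfunE /= aE bE lcompDr linearD.
Qed.

Lemma serre_map0 (X Y : C) : smap S (0 : X ~> Y) = 0.
Proof.
by apply: (addrI (smap S (0 : X ~> Y))); rewrite -serre_additive !addr0.
Qed.

Variable T : C.
Local Notation G := (End_alg T).
Local Notation F := (hom_rmod T).
Local Notation Fm := (hom_map T).

Lemma serre_faithful Y (u : Y ~> S T) : (forall x : T ~> Y, u ∘ x = 0) -> u = 0.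
Proof.
have [xi <-] := eta_surj u => h; apply/eta_eq0 => x.
have [xi' xi'E] := postcomp_functional x xi.
have /eta_eq0 /(_ (lid T)) : eta xi' = 0 by rewrite (eta_nat1 xi'E) h.
by rewrite xi'E lcompm1.
Qed.

(** F(S T) is D Gamma, and the functional [l] corresponds to the homomorphism m -> (a -> l(m a));
    [serre_functional] is the inverse passage. *)
Lemma serre_hom (M : rmod G) (l : 'Hom(M, k^o)) :
  exists h : rmod_hom M (F (S T)), forall m (xi : 'Hom(T ~> T, k^o)),
    (forall a, xi a = l (ract m (a : G))) -> h m = eta xi.
Proof.
have H m : exists xi : 'Hom(T ~> T, k^o), forall a, xi a = l (ract m (a : G)).
  by apply: lfun_exists => c a b; rewrite ract_linearr linearP.
pose x m := sval (cid (H m)); have xE m := svalP (cid (H m)).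
have hE m (xi : 'Hom(T ~> T, k^o)) : (forall a, xi a = l (ract m (a : G))) ->
    eta (x m) = eta xi.
  by move=> e; congr eta; apply/lfunP => a; rewrite e xE.
have [c m n|m a|h hh] := @rmod_hom_exists k G M (F (S T)) (fun m => eta (x m)).
- rewrite -eta_linear; apply: hE => a.
  by rewrite lfunE /= lfunE /= !xE ract_linearl linearP.
- rewrite /= -(eta_nat1 (xi' := x (ract m a))) // => b.
  by rewrite !xE -ractM.
by exists h => m xi e; rewrite hh; apply: hE.
Qed.

Lemma serre_functional (M : rmod G) (f : rmod_hom M (F (S T))) :
  exists l : 'Hom(M, k^o), forall m (xi : 'Hom(T ~> T, k^o)),
    f m = eta xi -> forall a, xi a = l (ract m (a : G)).
Proof.
pose x m := sval (cid (eta_surj (f m))).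
have xE m : eta (x m) = f m := svalP (cid (eta_surj (f m))).
have [|l lE] := @lfun_exists k M k^o (fun m => x m (lid T)).
  move=> c m n; have -> : x (c *: m + n) = c *: x m + x n.
    by apply: eta_inj; rewrite eta_linear !xE; exact: (rh_linear f c m n).
  by rewrite lfunE /= lfunE.
exists l => m xi e a; rewrite lE.
have [xi' xi'E] := postcomp_functional a xi.
have -> : x (ract m (a : G)) = xi'.
  by apply: eta_inj; rewrite xE rh_act (eta_nat1 xi'E) e.
by rewrite xi'E lcompm1.
Qed.

Lemma serre_injective : injective_mod (F (S T)).
Proof.
move=> M N g f gi; have [l lE] := serre_functional f.
have [h hE] := serre_hom (l \o (rh_fun g)^-1)%VF.
exists h; apply: rmod_homP => m; rewrite rmod_compE.
have [xi xiE] := eta_surj (f m); rewrite -xiE; apply: hE => a.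
rewrite (lE m xi) // comp_lfunE -rh_act lker0_lfunK //.
exact/lker0P.
Qed.

Definition Sexact X Y Z (f : X ~> Y) (g : Y ~> Z) :=
  exact_at (Fm (smap S f)) (Fm (smap S g)).

(* Under [eta], the sequence T(T, S X) -> T(T, S Y) -> T(T, S Z) is dual to    *)
(* T(Z, T) -> T(Y, T) -> T(X, T).                                              *)
Lemma wexact_Sexact X Y Z (f : X ~> Y) (g : Y ~> Z) : wexact f g -> Sexact f g.
Proof.
move=> fg y; have [xi <-] := eta_surj (y : T ~> S Y).
have [xg xgE] := precomp_functional g xi.
rewrite hom_mapE -(eta_nat2 xgE) eta_eq0; split=> [h|[x]].
  have [|zeta zE] := @functional_factor k _ _ _ (fun u : Y ~> T => u ∘ f) xi
    (@lcomp_linearl k C _ _ _ f).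
    by move=> u /(fg.2 _ u) [v ->]; rewrite -xgE h.
  by exists (eta zeta); rewrite hom_mapE -(eta_nat2 zE).
have [zeta <-] := eta_surj (x : T ~> S X).
have [zf zfE] := precomp_functional f zeta.
rewrite hom_mapE -(eta_nat2 zfE) => /eta_inj e v.
have gf : g ∘ f = 0 by apply/(fg.1 _ f); exists (lid _); rewrite lcompm1.
by rewrite xgE -e zfE -lcompA gf lcompm0 linear0.
Qed.

(** The modules F(S Y) along the chain form an injective coresolution of [B], which stops because
    F(S X) = 0. *)
Lemma Sexact_injpath n V X (c : chain n V X) (B : rmod G) :
  (forall x : T ~> S X, x = 0) -> call (fun Y => injective_mod (F (S Y))) c ->
  injective_mod (F (S V)) -> cpairs Sexact c ->
  (exists i : rmod_hom B (F (S V)), injective i /\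
     cfirst (fun Y g => exact_at i (Fm (smap S g))) c) ->
  injpath n B.
Proof.
move=> X0; elim: n V c B => [|n IH] V c B /=.
  move=> _ iV _ [i [ii ie]]; apply: (retract_injective iV).
  have si : surjective_hom i by move=> y; apply/ie; apply: X0.
  exact: rmod_iso_retract (@rmod_iso_bij _ _ B (F (S V)) i ii si).
move=> [iY ic] iV hc [i [ii ie]].
have [B' [q [qs qk]]] := coker_exists i.
have [i' i'E] : exists i' : rmod_hom B' (F (S (cob c))), forall x, i' (q x) = Fm (smap S (chd c)) x.
  by apply: factor_surj => // x /qk /ie.
have i'i : injective i'.
  move=> x y e; apply/eqP; rewrite -subr_eq0; have [z zE] := qs (x - y).
  rewrite -zE; apply/eqP/qk/ie; rewrite -i'E zE rhB e subrr //.
exists (F (S V)), B'; split=> //; first by exists i, q.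
apply: (IH _ (ctl c)) => //; first exact: cadj_cpairs hc.
exists i'; split=> //; apply: (cadj_cfirst hc) => Y g h y; rewrite (h y).
split=> -[x <-]; first by exists (q x); rewrite i'E.
by have [z <-] := qs x; exists z; rewrite i'E.
Qed.
End Serre.

(** * The main theorem *)

Lemma hom_bip_injective (k : fieldType) (C : addcat k) (T X Y B : C)
    (i1 : X ~> B) (i2 : Y ~> B) (p1 : B ~> X) (p2 : B ~> Y) :
  i1 ∘ p1 + i2 ∘ p2 = lid B ->
  injective_mod (hom_rmod T X) -> injective_mod (hom_rmod T Y) ->
  injective_mod (hom_rmod T B).
Proof.
move=> e iX iY M N g f gi.
have [h1 /eq_rmod_comp h1E] := iX _ _ g (rmod_comp (hom_map T p1) f) gi.
have [h2 /eq_rmod_comp h2E] := iY _ _ g (rmod_comp (hom_map T p2) f) gi.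
have [h hE] := rmod_homD (rmod_comp (hom_map T i1) h1) (rmod_comp (hom_map T i2) h2).
exists h; apply: rmod_homP => x.
rewrite rmod_compE hE !rmod_compE h1E h2E !rmod_compE !hom_mapE !lcompA -lcompDl e.
exact: lcomp1m.
Qed.

Lemma hom_retract_injective (k : fieldType) (C : addcat k) (T X Y : C)
    (s : X ~> Y) (r : Y ~> X) : r ∘ s = lid X ->
  injective_mod (hom_rmod T Y) -> injective_mod (hom_rmod T X).
Proof.
move=> rs iY; apply: (retract_injective iY); exists (hom_map T s), (hom_map T r) => x.
by rewrite !hom_mapE lcompA rs lcomp1m.
Qed.

Section Main.
Variables (k : fieldType) (C : addcat k) (d : nat) (A : angulated C d.+1).
Hypothesis hC : split_idempotents C.
Variable T : C.
Hypothesis hT : cluster_tilting A T.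
Variable S : functor (ucat C) (ucat C).
Hypothesis S_equiv : is_equivalence S.
Variable eta : forall X Y : C, 'Hom(X ~> Y, k^o) -> (Y ~> S X).
Hypothesis eta_linear : forall X Y, linear (@eta X Y).
Hypothesis eta_bij : forall X Y, bijective (@eta X Y).
Hypothesis eta_nat1 : forall (X Y Y' : C) (g : Y ~> Y') (xi : 'Hom(X ~> Y', k^o))
  (xi' : 'Hom(X ~> Y, k^o)),
  (forall u, xi' u = xi (g ∘ u)) -> eta xi' = eta xi ∘ g.
Hypothesis eta_nat2 : forall (X X' Y : C) (f : X ~> X') (xi : 'Hom(X ~> Y, k^o))
  (xi' : 'Hom(X' ~> Y, k^o)),
  (forall u, xi' u = xi (u ∘ f)) -> eta xi' = smap S f ∘ eta xi.
Implicit Types X Y Z W V : C.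
Local Notation G := (End_alg T).
Implicit Types M N B : rmod G.
Local Notation F := (hom_rmod T).
Local Notation Fm := (hom_map T).
Local Notation sg := (smap (susp A)).
Local Notation so := (sobj (susp A)).

(* Stated for V rather than Sigma V because morphisms Sigma V -> Sigma V' are then *)
(* suspensions, to which the axiom (F1)(c) is applied without desuspending.        *)
Record cogenerating (V : C) : Prop := Cogenerating {
  cog_hom0 : forall x : T ~> V, x = 0;
  cog_faithful : forall Y (u : Y ~> so V), (forall x : T ~> Y, u ∘ x = 0) -> u = 0;
  cog_injective : injective_mod (F (so V)) }.

Lemma cogenerating_zob : cogenerating (zob C).
Proof.
have z0 := sg_zero_ob A (zobP C).
split=> [x|Y u _|]; first exact: zero_ob_to (zobP C).
  exact: zero_ob_to z0.
apply: (retract_injective (@rzero_injective k G)).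
by apply/rmod_iso_retract/zero_mod_iso => x; apply: zero_ob_to z0.
Qed.

Lemma cogenerating_bip V V' : cogenerating V -> cogenerating V' -> cogenerating (V ⊕ V').
Proof.
move=> [h f i] [h' f' i'].
have e : sg (in1 V V') ∘ sg (pr1 V V') + sg (in2 V V') ∘ sg (pr2 V V') = lid (so (V ⊕ V')).
  by rewrite -!sgM -sgD bip_id sg1.
split=> [x|Y u hu|].
- by rewrite (bip_to_eq x) (h (pr1 _ _ ∘ x)) (h' (pr2 _ _ ∘ x)) !lcompm0 addr0.
- have u1 : sg (pr1 V V') ∘ u = 0 by apply: f => x; rewrite -lcompA hu lcompm0.
  have u2 : sg (pr2 V V') ∘ u = 0 by apply: f' => x; rewrite -lcompA hu lcompm0.
  by rewrite -[u]lcomp1m -e lcompDl -!lcompA u1 u2 !lcompm0 addr0.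
- exact: hom_bip_injective e i i'.
Qed.

(** Desuspend S T to U. Then T(T, U) = T(Sigma T, S T) = D T(T, Sigma T) = 0. *)
Lemma cogenerating_serre : exists (U : C) (f : so U ~> S T) (g : S T ~> so U),
  [/\ g ∘ f = lid (so U), f ∘ g = lid (S T : C) & cogenerating U].
Proof.
have [U [f [g [gf fg]]]] := sg_ess_surj A (S T); exists U, f, g; split=> //.
have finj Y (u : Y ~> so U) : f ∘ u = 0 -> u = 0.
  by move=> e; rewrite -[u]lcomp1m -gf -lcompA e lcompm0.
split=> [x|Y u hu|].
- apply: (sg_inj (A := A)); rewrite sg0; apply: finj.
  have [xi <-] := eta_surj eta_bij (f ∘ sg x).
  by apply/(eta_eq0 eta_linear eta_bij) => y; rewrite (hT.1 y) linear0.
- apply: finj; apply: (serre_faithful eta_linear eta_bij eta_nat1) => x.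
  by rewrite -lcompA hu lcompm0.
- by apply: (hom_retract_injective gf); apply: (serre_injective eta_linear eta_bij eta_nat1).
Qed.

(** Each functional on [M] is detected by a map to F(S T), and the finitely many coordinate
    functionals separate points; V is a sum of one U per coordinate. *)
Lemma cogenerating_embedding M : exists V (i : rmod_hom M (F (so V))),
  cogenerating V /\ injective i.
Proof.
have [U [f [g [gf fg hU]]]] := cogenerating_serre.
have H (s : seq 'Hom(M, k^o)) : exists V (i : rmod_hom M (F (so V))),
    cogenerating V /\ forall m, i m = 0 -> forall l, l \in s -> l m = 0.
  elim: s => [|l s [V [i [hV ih]]]].
    have [i _] := rmod_hom0 M (F (so (zob C))); exists (zob C), i; split=> //.
    exact: cogenerating_zob.
  have [h hE] := serre_hom eta_linear eta_nat1 l.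
  have [j jE] := rmod_homD (rmod_comp (Fm (sg (in1 V U))) i)
    (rmod_comp (Fm (sg (in2 V U) ∘ g)) h).
  exists (V ⊕ U), j; split; first exact: cogenerating_bip.
  move=> m; rewrite jE !rmod_compE !hom_mapE => e.
  have im : i m = 0.
    have := congr1 (fun x => sg (pr1 V U) ∘ x) e; rewrite lcompDr !lcompA -!sgM.
    by rewrite pr1_in1 pr1_in2 sg1 sg0 lcomp1m !lcomp0m lcompm0 addr0.
  have hm : h m = 0.
    move: e; rewrite im lcompm0 add0r => /(congr1 (fun x => f ∘ (sg (pr2 V U) ∘ x))).
    rewrite !lcompA -(lcompA f) -sgM pr2_in2 sg1 lcompm1 fg lcompm0.
    by rewrite lcomp1m => ->.
  move=> l'; rewrite inE => /orP[/eqP ->|]; last exact: ih.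
  have [xi xiE] : exists xi : 'Hom(T ~> T, k^o), forall a, xi a = l (ract m (a : G)).
    by apply: lfun_exists => c a b; rewrite ract_linearr linearP.
  have : eta xi = 0 by rewrite -(hE m xi xiE).
  by move=> /(eta_eq0 eta_linear eta_bij) /(_ (lid T)); rewrite xiE; have -> := ract1 m.
pose b := vbasis {:M}.
have L j : exists l : 'Hom(M, k^o), forall x, l x = coord b j x.
  by apply: lfun_exists => c x y; rewrite linearP.
pose l j := sval (cid (L j)); have lE j x : l j x = coord b j x := svalP (cid (L j)) x.
have [V [i [hV ih]]] := H [seq l j | j <- enum 'I_(\dim {:M})].
exists V, i; split=> // x y e; apply/eqP; rewrite -subr_eq0; apply/eqP.
have {}e : i (x - y) = 0 by rewrite rhB e subrr.
rewrite (coord_vbasis (memvf (x - y))) big1 // => j _.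
have lj : l j \in [seq l j | j <- enum 'I_(\dim {:M})] by apply: map_f; rewrite mem_enum.
by rewrite -lE (ih _ e _ lj) scale0r.
Qed.

Lemma End_enough_injectives : @enough_injectives k G.
Proof.
move=> M; have [V [i [hV ii]]] := cogenerating_embedding M.
by exists (F (so V)), i; split=> //; apply: cog_injective.
Qed.

(** Embed M, then the cokernel; fullness of F and of Sigma realises the composite as F(Sigma g). *)
Lemma cogenerating_copresentation M : exists V V' (g : V ~> V'),
  [/\ cogenerating V, cogenerating V' & kerof M (sg g)].
Proof.
have [V [i [hV ii]]] := cogenerating_embedding M.
have [B [q [qs iq]]] := coker_exists i.
have [V' [j [hV' ji]]] := cogenerating_embedding B.
have [u uE] := hom_full hT (rmod_comp j q).
have [g gE] := sg_full u; exists V, V', g; split=> //.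
exists i; split=> // y; rewrite hom_mapE gE -uE rmod_compE -(iq y).
by split=> [|->]; [rewrite -(rh0 j) => /ji | rewrite rh0].
Qed.

Lemma ess_image_d_cluster_tilting : d_cluster_tilting d.+1 (ess_image (hom_functor T)).
Proof.
have ei := End_enough_injectives.
have ep := End_enough_projectives (T := T) hC.
have ext_in M N i : in_image M -> in_image N -> (0 < i < d.+1)%N -> ext_zero i M N.
  move=> hM hN; case: i => [|i] //= hi; have [R _] := resolution_exists ep M.
  by exists R; exact: (ext_vanish_in_image hC hT ei hM hN hi).
split; first split.
- move=> M; have [V [V' [g [hV hV' hM]]]] := cogenerating_copresentation M.
  have [X [f fE]] := right_approximation hT (cog_faithful hV') hM.
  exists (F X), f; split; first exact/in_imageP/in_image_hom.
  move=> N f' /in_imageP [Y [a [b [ba ab]]]].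
  have [h hE] := fE Y (rmod_comp f' a).
  exists (rmod_comp (Fm h) b); apply: rmod_homP => x.
  by rewrite /= !comp_lfunE /= hom_postE -hE rmod_compE ab.
- move=> M; have [X [f [fE _]]] := left_coresolution hC hT M.
  exists (F X), f; split; first exact/in_imageP/in_image_hom.
  move=> N f' /in_imageP [Y [a [b [ba ab]]]].
  have [h hE] := fE Y (rmod_comp b f').
  exists (rmod_comp a (Fm h)); apply: rmod_homP => x.
  by rewrite /= !comp_lfunE /= hom_postE -hE rmod_compE ab.
- move=> M; split=> [/in_imageP hM i N hi /in_imageP hN|h]; first exact: ext_in.
  apply/in_imageP; have [V [V' [g [hV hV' hM]]]] := cogenerating_copresentation M.
  apply: (in_image_maximal_left hC hT ei (right_resolution (cog_hom0 hV') hM)).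
  by move=> i N hi /in_imageP hN; apply: h.
- move=> M; split=> [/in_imageP hM i N hi /in_imageP hN|h]; first exact: ext_in.
  apply/in_imageP; have [X [f [_ [N [hN hM]]]]] := left_coresolution hC hT M.
  apply: (in_image_maximal_right hC hT ei (leqnn d) hM hN).
  by move=> i N' hi /in_imageP hN'; apply: h.
Qed.

Lemma injective_respath M : injective_mod M ->
  respath (@projective k G) (@zero_mod k G) d.+2 M.
Proof.
move=> iM; have [V [i [hV ii]]] := cogenerating_embedding M.
have [p /eq_rmod_comp pE] := iM _ _ i (rmod_id M) ii.
have [|X [s [r rs]] XM] := retract_hom hC hT (M := M) (X := so V).
  by exists i, p => x; rewrite pE rmod_idE.
have X0 (y : so T ~> X) : y = 0.
  have [z zE] := sg_full (s ∘ y).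
  by rewrite -[y]lcomp1m -rs -lcompA -zE (cog_hom0 hV z) sg0 lcompm0.
have [Td [c [delta [aT ac h dt h0]]]] := tilting_chain hT X.
have [B hB] := kfirst_exists T (crcons c delta).
(* If y : T -> T_d dies in the next term, Sigma y factors through X via a map Sigma T -> X, which is
   zero; hence y = 0. *)
have B0 : zero_mod B.
  have [j [ji je]] := hB => b; apply: ji; rewrite rh0.
  have : Fm (chd c) (j b) = 0 by apply/je; exists b.
  rewrite hom_mapE => e; apply: (sg_inj (A := A)); rewrite sg0.
  have [|y ->] := (dt.1 _ (sg (j b : T ~> Td))).1; last by rewrite (X0 y) lcompm0.
  by rewrite scale_compl -sgM e sg0 scaler0.
apply: respath_iso XM _ => [D D' [f [f' [ff' f'f]]] D0 x|].
  by rewrite -(f'f x) (D0 (f' x)) rh0.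
apply: (@chain_kernels k C T (respath (@projective k G) (@zero_mod k G)) (in_add T) _ _ d.+2 0
  _ _ (crcons c delta) B _ _ _ hB _ B0).
- move=> r' N N'; apply: respath_iso => D D' [f [f' [ff' f'f]]] D0 x.
  by rewrite -(f'f x) (D0 (f' x)) rh0.
- by move=> r' Y D D' aY s' hD; exists D, (F Y); split=> //; apply: in_add_projective.
- exact: (sub_cadj (@wexact_Fexact k C T) h).
- exact: csrc_crcons.
- apply: (clast_crcons (Q := fun Y W h => kerof (F X) h)).
  exists (rmod_id (F X)); split=> [x y|y]; first by rewrite !rmod_idE.
  by rewrite hom_mapE h0; split=> // _; exists y; rewrite rmod_idE.
Qed.

Lemma serre_add_injective T' : in_add T T' -> injective_mod (F (S T')).
Proof.
have S1 X : smap S (lid X) = lid (sobj S X) by exact: (fmap1 S).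
have SM X Y Z (g : Y ~> Z) (f : X ~> Y) : smap S (g ∘ f) = smap S g ∘ smap S f.
  exact: (fmapM S).
have SD := serre_additive eta_linear eta_bij eta_nat2.
apply: (add_ind (Q := fun X => injective_mod (F (S X)))).
- apply: (retract_injective (@rzero_injective k G)).
  apply/rmod_iso_retract/zero_mod_iso => x; apply: zero_ob_to.
  by rewrite /zero_ob -S1 zobP (serre_map0 eta_linear eta_bij eta_nat2).
- exact: (serre_injective eta_linear eta_bij eta_nat1).
- move=> X Y; apply: (hom_bip_injective (i1 := smap S (in1 X Y)) (i2 := smap S (in2 X Y))
    (p1 := smap S (pr1 X Y)) (p2 := smap S (pr2 X Y))).
  by rewrite -!SM -SD bip_id S1.
- move=> X W [s [r rs]]; apply: (hom_retract_injective (s := smap S s) (r := smap S r)).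
  by rewrite -SM rs S1.
Qed.
(* With S X ~ Sigma X', dualising T(T_0, T) -> ... -> T(T_d, T) -> T(X, Sigma T) -> 0 *)
(* gives 0 -> T(T, X') -> T(T, S T_d) -> ... -> T(T, S T_0) -> 0.              *)
Lemma hom_in_add_injpath X' : in_add T X' -> injpath d.+1 (F X').
Proof.
move=> aX'.
have [X [th [ht [thK htK]]]] : exists X (th : so X' ~> S X) (ht : S X ~> so X'),
    ht ∘ th = lid _ /\ th ∘ ht = lid (S X : C).
  have [X [f [g [gf fg]]]] := equivalence_ess_surj S_equiv (so X').
  by exists X, g, f.
have [Td [c [delta [aT ac h dt h0]]]] := tilting_chain hT X.
have cS := sub_cadj (wexact_Sexact eta_linear eta_bij eta_nat2 (T := T)) (cadj_crcons h).
have iS Y : in_add T Y -> injective_mod (F (S Y)) by exact: serre_add_injective.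
apply: (Sexact_injpath (S := S) (c := c)) => //.
- move=> x; rewrite -[x]lcomp1m -htK -lcompA (no_map_susp_add hT aX' (ht ∘ x)).
  exact: lcompm0.
- exact: sub_call iS ac.
- exact: iS.
(* The augmentation is T(T, X') = T(Sigma T, S X) = D T(X, Sigma T) -> D T(T_d, T), dual to v ->
   (Sigma v) delta. *)
have pre (x : T ~> X') : exists xi' : 'Hom(Td ~> T, k^o), exists2 xi : 'Hom(X ~> so T, k^o),
    eta xi = th ∘ sg x & forall v, xi' v = xi (sg v ∘ delta).
  have [xi xiE] := eta_surj eta_bij (th ∘ sg x).
  have [|xi' xi'E] := @lfun_exists k (Td ~> T) k^o (fun v => xi (sg v ∘ delta)).
    by move=> a u v; rewrite (sgP A) lcompDl scale_compl linearP.
  by exists xi', xi.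
pose m x := eta (sval (cid (pre x))).
have mE x (xi : 'Hom(X ~> so T, k^o)) (xi' : 'Hom(Td ~> T, k^o)) :
    eta xi = th ∘ sg x -> (forall v, xi' v = xi (sg v ∘ delta)) -> m x = eta xi'.
  rewrite /m; case: cid => z [y yE zE] /= e xi'E; congr eta; apply/lfunP => v.
  by rewrite zE xi'E; congr (fun_of_lfun _ _); apply: (eta_inj eta_bij); rewrite yE e.
have mP x : exists (xi : 'Hom(X ~> so T, k^o)) (xi' : 'Hom(Td ~> T, k^o)),
    [/\ eta xi = th ∘ sg x, forall v, xi' v = xi (sg v ∘ delta) & m x = eta xi'].
  have [xi' [xi xiE xi'E]] := pre x; exists xi, xi'; split=> //; exact: mE xiE xi'E.
have [a x y|x a|i iE] := @rmod_hom_exists k G (F X') (F (S Td)) m.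
- have [xi [xi' [e e' ->]]] := mP x; have [ze [ze' [f f' ->]]] := mP y.
  rewrite -eta_linear; apply: (mE _ (a *: xi + ze)).
    by rewrite eta_linear e f (sgP A) lcompDr scale_compr.
  by move=> v; rewrite !lfunE /= !lfunE /= e' f'.
- have [xi [xi' [e e' me]]] := mP x.
  have [ze zeE] := postcomp_functional (sg a) xi.
  have [ze' ze'E] := postcomp_functional a xi'.
  rewrite /= me -(eta_nat1 ze'E); apply: (mE _ ze).
    by rewrite (eta_nat1 zeE) e sgM lcompA.
  by move=> v; rewrite ze'E e' zeE sgM lcompA.
(* Surjectivity of v -> (Sigma v) delta, from T(T_0, Sigma T) = 0; dually [i] is injective. *)
have surj_delta (w : X ~> so T) : exists v : Td ~> T, w = sg v ∘ delta.
  have [T1 [T0 [_ [g [_ a0 _ gd]]]]] := cadj_last h aT (ac.1) ac.2.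
  have [|w' ->] := (gd.2 _ w).1.
    by apply: (in_add_hom_rep a0 _).1 => x; rewrite -lcompA; apply: hT.1.
  by have [v <-] := sg_full w'; exists v.
have i_inj : injective i.
  move=> x y e; apply/eqP; rewrite -subr_eq0; apply/eqP.
  have {e} : i (x - y) = 0 by rewrite rhB e subrr.
  rewrite iE; have [xi [xi' [e e' ->]]] := mP (x - y).
  move=> /(eta_eq0 eta_linear eta_bij) xi'0.
  apply: (sg_inj (A := A)); rewrite sg0 -[sg _]lcomp1m -thK -lcompA -e.
  suff -> : eta xi = 0 by rewrite lcompm0.
  apply/(eta_eq0 eta_linear eta_bij) => w.
  by have [v ->] := surj_delta w; rewrite -e' xi'0.
exists i; split=> // y.
have [ze <-] := eta_surj eta_bij (y : T ~> S Td).
have [zc zcE] := precomp_functional (chd c) ze.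
have dc : sg (chd c) ∘ delta = 0.
  have := (dt.1 _ delta).2 (ex_intro _ (lid X) (esym (lcompm1 delta))).
  by rewrite scale_compl => /eqP; rewrite scaler_eq0 (negPf (csgn_neq0 k d)) => /eqP.
rewrite hom_mapE -(eta_nat2 zcE) (eta_eq0 eta_linear eta_bij); split=> [h1|[x]].
  (* If (Sigma v) delta = 0 then v factors through [chd c], and [ze] vanishes on such v by [h1]; so
     [ze] factors through v -> (Sigma v) delta. *)
  have [||xi xiE] := @functional_factor k _ _ _ (fun v : Td ~> T => sg v ∘ delta) ze.
  - by move=> a u v; rewrite (sgP A) lcompDl scale_compl.
  - move=> v /(dt.2 _ (sg v)) [w]; have [w' <-] := sg_full w.
    rewrite scale_compr -sgM => e.
    have -> : v = (csgn k d *: w') ∘ chd c.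
      apply: (sg_inj (A := A)); rewrite e scale_compl.
      by have := sgP A (csgn k d) (w' ∘ chd c) 0; rewrite sg0 !addr0.
    by rewrite -zcE h1.
  have [x xE] := sg_full (ht ∘ eta xi).
  exists x; rewrite iE; apply: (mE _ xi) => //.
  by rewrite xE lcompA htK lcomp1m.
rewrite iE; have [xi [xi' [e e' ->]]] := mP x.
move=> /(eta_inj eta_bij) e0 v.
by rewrite zcE -e0 e' sgM -lcompA dc lcompm0 linear0.
Qed.

Lemma projective_injpath M : projective M -> injpath d.+1 M.
Proof.
move=> pM; have [V [p [sV ps]]] := cover_exists M.
have [q qE] := proj_lift (rmod_id M) pM ps.
have [|X' rX XM] := retract_hom hC hT (M := M) (X := V).
  by exists q, p => x; rewrite qE rmod_idE.
have h := hom_in_add_injpath (retract_in_add hC sV rX).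
have [f [g [gf fg]]] := XM.
move: h => /= [E [B [[i [r [ii rs ir]]] iE hB]]]; exists E, B; split=> //.
exists (rmod_comp i g), r; split=> //.
  by move=> x y; rewrite !rmod_compE => /ii /(congr1 f); rewrite !fg.
move=> y; rewrite (ir y); split=> -[x <-].
  by exists (f x); rewrite rmod_compE gf.
by exists (g x); rewrite rmod_compE.
Qed.

Lemma End_gorenstein : gorenstein G d.+1.
Proof.
split=> M hM; first exact/respath_pd_le/injective_respath.
exact/injpath_id_le/projective_injpath.
Qed.

Lemma End_gldim : (exists n, gldim_le G n) -> gldim_le G d.+1.
Proof.
by apply: (gldim_le_injpath (End_enough_projectives (T := T) hC)) => M; apply: projective_injpath.
Qed.
End Main.

Theorem theorem0p6 (k : closedFieldType) (d : nat) (hd : (1 <= d)%N)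
  (C : addcat k) (A : angulated C d) (hC : split_idempotents C)
  (S : functor (ucat C) (ucat C)) (hS : serre_functor S)
  (T : C) (hT : cluster_tilting A T) :
  [/\ d_cluster_tilting d (ess_image (hom_functor T)),
      exists hI : respects_ideal (add_ideal (susp A T)) (to_ess_image (hom_functor T)),
        is_equivalence (quot_functor hI),
      gorenstein (End_alg T) d
    & (exists n : nat, gldim_le (End_alg T) n) -> gldim_le (End_alg T) d].
Proof.
(* With d a successor, every tilting angle has at least the two terms T_1 -> T_0 that a presentation
   of X needs. *)
case: d hd A hT => // d _ A hT.
have [S_equiv [eta [el eb e1 e2]]] := hS.
split.
- exact: (ess_image_d_cluster_tilting hC hT el eb e1).
- by exists (hom_functor_respects hC hT); apply: quotient_equivalence.
- refine (End_gorenstein hC hT S_equiv el eb e1 e2).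
- refine (End_gldim hC hT S_equiv el eb e1 e2).
Qed.
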